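(* Suppose that $\mathbb{E}(Y^2)<\infty$, $\mathbb{E}\|\mathbf X\|^2<\infty$, and that $\operatorname{rank}(\boldsymbol\mu_{1,X})=d+1$. Then, as $n\to+\infty$: (1) the bootstrap estimator $\boldsymbol\beta^{M,*}$ is strongly consistent for $\boldsymbol\beta$ in the Kolmogorov metric, i.e. almost surely $$\sup_{t\in\mathbb{R}^{d+1}}\left|\mathbb{P}^*\!\left[\sqrt n(\boldsymbol\beta^{M,*}-\widehat{\boldsymbol\beta}^M)\le t\right]-\mathbb{P}\!\left[\sqrt n(\widehat{\boldsymbol\beta}^M-\boldsymbol\beta)\le t\right]\right|\to 0 ,$$ where inequalities between vectors are componentwise; (2) for every risk $\alpha\in(0,1)$ and every component $\beta_j$, $j\in\{0,\dots,d\}$, of $\boldsymbol\beta$, the bootstrap percentile approach provides a consistent confidence set of nominal level $1-\alpha$: $$\mathbb{P}\left[\beta_j\in\left[q^*_{j}(\alpha/2),\,q^*_{j}(1-\alpha/2)\right]\right]\to 1-\alpha ,$$ where $q_j^*(u)=\inf\{x\in\mathbb{R}:\mathbb{P}^*[\beta_j^{M,*}\le x]\ge u\}$.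
   Context: Setting. $Y$ is a real random variable, $\mathbf X=(X_1,\dots,X_d)$ a random vector in $\mathbb{R}^d$, $G$ a categorical variable with values in $\{1,\dots,K\}$ and $\mathbb{P}[G=k]>0$ for all $k$, and the linear model $Y=\beta_0+\sum_{j=1}^d\beta_jX_j+\epsilon$ holds, where $\epsilon$ is independent of $(\mathbf X,G)$, has mean zero and variance $\sigma_\epsilon^2$, and $\boldsymbol\beta=(\beta_0,\dots,\beta_d)^\top$. Put $\boldsymbol\mu_X^k=\mathbb{E}(\mathbf X\mid G=k)\in\mathbb{R}^d$, and let $\boldsymbol\mu_{1,X}$ be the $K\times(d+1)$ matrix with $k$th row $(1,\boldsymbol\mu_X^{k\top})$. Data. $\mathbf X$ and $Y$ are never observed jointly. $K$ is fixed. For each $k$ there are an i.i.d. sample $Y_1^k,\dots,Y_n^k$ from the conditional law of $Y$ given $G=k$ and an i.i.d. sample $\mathbf X_1^k,\dots,\mathbf X_n^k$ from the conditional law of $\mathbf X$ given $G=k$ (the first $n$ terms of infinite i.i.d. sequences); these $2K$ samples are mutually independent and all have the same size $n$. Estimator. $\widehat\mu_Y^k=\frac1n\sum_iY_i^k$, $\widehat{\boldsymbol\mu}_X^k=\frac1n\sum_i\mathbf X_i^k$, $\widehat{\boldsymbol\mu}_Y=(\widehat\mu_Y^1,\dots,\widehat\mu_Y^K)^\top$, $\widehat{\boldsymbol\mu}_{1,X}$ is the $K\times(d+1)$ matrix with $k$th row $(1,\widehat{\boldsymbol\mu}_X^{k\top})$, and $\mathbf w=\mathrm{diag}(w_1,\dots,w_K)$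 with fixed weights $w_k>0$, $\sum_kw_k=1$. The moment estimator is $$\widehat{\boldsymbol\beta}^M=\left(\widehat{\boldsymbol\mu}_{1,X}^\top\mathbf w\widehat{\boldsymbol\mu}_{1,X}\right)^{-1}\widehat{\boldsymbol\mu}_{1,X}^\top\mathbf w\widehat{\boldsymbol\mu}_Y$$ when $\widehat{\boldsymbol\mu}_{1,X}$ has full rank $d+1$ (defined arbitrarily otherwise). Stratified bootstrap. Conditionally on the data, for each $k$ draw $n$ observations uniformly with replacement from $Y_1^k,\dots,Y_n^k$ and, independently, $n$ observations uniformly with replacement from $\mathbf X_1^k,\dots,\mathbf X_n^k$, independently over $k$. $\boldsymbol\beta^{M,*}=(\beta_0^{M,*},\dots,\beta_d^{M,*})^\top$ is obtained by replacing the empirical means by the means of the bootstrap samples in the formula for $\widehat{\boldsymbol\beta}^M$ (arbitrarily defined when the matrix is singular). $\mathbb{P}^*$ denotes conditional probability given the data.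
   Formalization: Adds that every component of the limit law of √n(β̂^M−β) has positive variance (automatic if σ_ε²>0); without it the claim fails: if ε=0 and all slopes are 0, both estimators equal β and the coverage tends to 1, not 1−α. *)

(* Defs.v *)
From HB Require Import structures.
From mathcomp Require Export all_boot all_order all_algebra finmap.
From mathcomp Require Export all_classical all_reals all_analysis.

Set Implicit Arguments.
Unset Strict Implicit.
Unset Printing Implicit Defensive.

Export Order.TTheory GRing.Theory Num.Theory.
Export numFieldNormedType.Exports.

Global Open Scope classical_set_scope.
Global Open Scope ring_scope.

Definition mutually_independent {R : realType} {d : measure_display}
    {T : measurableType d} (P : probability T R) {I : choiceType}
    (E : I -> set_system T) : Prop :=
  forall (J : {fset I}) (A : I -> set T),
    (forall i, i \in J -> E i (A i)) ->
    P (\bigcap_(i in [set` J]) A i) = (\prod_(i <- J) P (A i))%E.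

Definition independent_systems {R : realType} {d : measure_display}
    {T : measurableType d} (P : probability T R) (E F : set_system T) : Prop :=
  forall A B, E A -> F B -> P (A `&` B) = (P A * P B)%E.

(* The sigma-algebra generated by the pair (X, G), where G has finitely many
   values: a measurable set of the product of T' and the discrete 'I_K is given
   by its sections C k. *)
Definition pair_events {T : Type} {d' : measure_display}
    {T' : measurableType d'} {K : nat} (X : T -> T') (G : T -> 'I_K) :
    set_system T :=
  [set A | exists2 C : 'I_K -> set T',
      forall k, measurable (C k) & A = [set w | C (G w) (X w)]].

(* Elementary conditioning on an event E of positive probability. *)
Section conditioning.
Context {R : realType} {d : measure_display} {T : measurableType d}.
Variables (P : probability T R) (E : set T).

Definition cond_prob (A : set T) : R := fine (P (A `&` E)) / fine (P E).

Definition cond_mean (f : T -> R) : R :=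
  (\int[P]_(w in E) f w) / fine (P E).

Definition cond_var (f : T -> R) : R :=
  cond_mean (fun w => (f w - cond_mean f) ^+ 2).

End conditioning.

Section estimator.
Context {R : realType} {K d : nat}.

(* Index 0 of a vector of size 1 + d is the intercept. *)
Definition linear_part (b : 'cV[R]_(1 + d)) (x : d.-tuple R) : R :=
  \sum_(j < d) b (rshift 1 j) 0 * tnth x j.

Definition design (m : 'M[R]_(K, d)) : 'M[R]_(K, 1 + d) :=
  row_mx (const_mx 1) m.

Definition wls (w : 'rV[R]_K) (M : 'M[R]_(K, 1 + d)) : 'M[R]_(1 + d, K) :=
  invmx (M^T *m diag_mx w *m M) *m M^T *m diag_mx w.

Definition sample_mean_Y n (y : 'I_K -> 'I_n -> R) : 'cV[R]_K :=
  \col_k (n%:R^-1 * \sum_(i < n) y k i).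

Definition sample_mean_X n (x : 'I_K -> 'I_n -> d.-tuple R) : 'M[R]_(K, d) :=
  \matrix_(k, j) (n%:R^-1 * \sum_(i < n) tnth (x k i) j).

(* b is a value of the moment estimator on the samples y, x; nothing is
   required of b when the design matrix is rank deficient. *)
Definition moment_estimate (w : 'rV[R]_K) n (y : 'I_K -> 'I_n -> R)
    (x : 'I_K -> 'I_n -> d.-tuple R) (b : 'cV[R]_(1 + d)) : Prop :=
  let M := design (sample_mean_X x) in
  \rank M = (1 + d)%N -> b = wls w M *m sample_mean_Y y.

Definition vec_le (u v : 'cV[R]_(1 + d)) : bool :=
  [forall j, u j 0 <= v j 0].

End estimator.

(* A stratified bootstrap draw: for each k, the n indices drawn from the Y
   sample (s.1 k) and the n indices drawn from the X sample (s.2 k). Drawing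
   uniformly with replacement, independently over k and between Y and X, is the
   uniform distribution on this finite type. *)
Definition draw (K n : nat) : finType :=
  ({ffun 'I_K -> {ffun 'I_n -> 'I_n}} *
   {ffun 'I_K -> {ffun 'I_n -> 'I_n}})%type.

Section bootstrap.
Context {R : realType} {K d : nat}.

Definition Pstar n (A : pred (draw K n)) : R := #|A|%:R / #|draw K n|%:R.

(* In the next two definitions, bs s is the bootstrap estimate for the draw s,
   the data being fixed. *)
Definition boot_cdf n (bs : draw K n -> 'cV[R]_(1 + d)) (b t : 'cV[R]_(1 + d)) :
    R :=
  Pstar [pred s | vec_le (Num.sqrt n%:R *: (bs s - b)) t].

Definition boot_quantile n (bs : draw K n -> 'cV[R]_(1 + d)) (j : 'I_(1 + d))
    (u : R) : R :=
  inf [set x : R | u <= Pstar [pred s | bs s j 0 <= x]].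

End bootstrap.

(* Variance of the j-th component of the limit in law of sqrt n (betaM - beta):
   to first order this vector is
     wls w mu_{1,X} *m \col_k (sqrt n (mean of Y_i^k - (1, X_i^k) beta)),
   and the samples of Y and X are independent. It is positive for every j as
   soon as the noise has positive variance; when it vanishes, the percentile
   interval need not have coverage 1 - alpha (noiseless model with zero slopes:
   both estimators equal beta whenever they are defined). *)
Definition asymptotic_variance {R : realType} {K d : nat} {d0 : measure_display}
    {T : measurableType d0} (P : probability T R) (Y : T -> R)
    (X : T -> d.-tuple R) (G : T -> 'I_K) (w : 'rV[R]_K)
    (mu1X : 'M[R]_(K, 1 + d)) (beta : 'cV[R]_(1 + d)) (j : 'I_(1 + d)) : R :=
  \sum_(k < K) wls w mu1X j k ^+ 2 *
    (cond_var P (G @^-1` [set k]) Y +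
     cond_var P (G @^-1` [set k]) (fun v => linear_part beta (X v))).

Definition pop_mean_X {R : realType} {K d : nat} {d0 : measure_display}
    {T : measurableType d0} (P : probability T R)
    (X : T -> d.-tuple R) (G : T -> 'I_K) : 'M[R]_(K, d) :=
  \matrix_(k, j) cond_mean P (G @^-1` [set k]) (fun v => tnth (X v) j).

(* The family of all observations: Y_i^k has index inl (k, i) and X_i^k has
   index inr (k, i); each contributes the sigma-algebra it generates. *)
Definition data_events {R : realType} {K d : nat} {d1 : measure_display}
    {T : measurableType d1} (Ys : 'I_K -> nat -> T -> R)
    (Xs : 'I_K -> nat -> T -> d.-tuple R)
    (o : ('I_K * nat) + ('I_K * nat)) : set_system T :=
  match o with
  | inl (k, i) => g_sigma_algebra_preimage (Ys k i)
  | inr (k, i) => g_sigma_algebra_preimage (Xs k i)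
  end.

(* Main.v *)
Require Import Defs.
From mathcomp Require Import measurable_realfun ring lra zify.

(* Both sqrt n (betaM - beta) and its bootstrap counterpart are compared with
   one explicit reference law, so that no Gaussian limit is needed: the law of
   A V, where A = (wls, - wls) is the influence matrix and the V_g, one for each
   of the 2K samples, are the independent normalized Rademacher sums
   sig_g n^{-1/2} (+-1 +- ... +-1), a uniform law on a finite space.

   The normal equations linearise the estimation error into A U + o(1), U_g
   being the normalized mean of the centred scores Y_i^k or beta . X_i^k.
   Lindeberg's swapping argument replaces the terms of U by signs inside
   products of cubic splines. These approximate indicators of orthants, and by
   the bound on central binomial coefficients the coordinates of A V put mass
   O(h + n^{-1/2}) on intervals of length h, which turns the smooth comparison
   into a uniform one of distribution functions. For the bootstrap, the needed
   limits of empirical moments hold almost surely by the strong law (Etemadi's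
   proof, for pairwise independent variables).

   The percentile interval contains beta_j when alpha/2 <= F(-T) and
   F(-T -) < 1 - alpha/2, up to ties, with F the bootstrap distribution function and
   T = sqrt n (betaM - beta)_j. Both F and the distribution function of T are
   close to that of (A V)_j, which is symmetric with small atoms, so F(-T) is
   asymptotically uniform on [0, 1]. *)

Set Implicit Arguments.
Unset Strict Implicit.
Unset Printing Implicit Defensive.

(** * Expectations, Taylor jets and spline indicators *)

(** Only second moments are assumed, so the Taylor remainder of a swap is measured by [trunc3], the
    smaller of a square and a cube, and made small by truncation. A swap matches just mean and
    variance. Signs scaled by the population standard deviations [sig] can therefore serve data and
    bootstrap alike, as the empirical variances converge to the same values.

    The base point of the bootstrap is the fitted model. Its residual need not vanish, and after
    scaling by sqrt n the change of [wls] is only bounded; the product is negligible because the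
    residual itself tends to 0, the linear model being exact for the conditional means.

    Positivity of the asymptotic variance gives, for each j, a sample g whose coefficient
    [influence j g * sig g] is nonzero. With the signs of the other samples frozen, the coordinate
    is an affine image of a binomial variable.

    The smoothness constant blows up as the smoothing width h shrinks: h is fixed first and n is
    taken large last, with all bounds uniform in the thresholds. Arbitrary values of the estimators
    at rank deficient designs occur only on an event of small probability. *)

(* [dom f] means that f is integrable. Averages over finite spaces and
   integrals are both instances, so that the data and the bootstrap draws share
   one limit theorem. *)
Record expectation (R : realType) (Om : Type) := Expectation {
  dom : (Om -> R) -> Prop;
  ev : (Om -> R) -> R;
  dom_cst : forall c, dom (fun=> c);
  dom_lin : forall a f g, dom f -> dom g -> dom (fun w => a * f w + g w);
  ev_lin : forall a f g, dom f -> dom g ->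
    ev (fun w => a * f w + g w) = a * ev f + ev g;
  ev_le : forall f g, dom f -> dom g -> (forall w, f w <= g w) -> ev f <= ev g;
  ev_cst1 : ev (fun=> 1) = 1 }.

Section expectation_theory.
Context {R : realType} {Om : Type} (E : expectation R Om).
Implicit Types f g : Om -> R.

Lemma eq_ev f g : f =1 g -> ev E f = ev E g.
Proof. by move=> /funext ->. Qed.

Lemma eq_dom f g : f =1 g -> dom E f -> dom E g.
Proof. by move=> /funext ->. Qed.

Lemma domD f g : dom E f -> dom E g -> dom E (fun w => f w + g w).
Proof.
by move=> Df Dg; apply: eq_dom (dom_lin 1 Df Dg) => w; rewrite mul1r.
Qed.

Lemma evD f g : dom E f -> dom E g ->
  ev E (fun w => f w + g w) = ev E f + ev E g.
Proof.
move=> Df Dg; rewrite -[X in X + _]mul1r -ev_lin//.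
by apply: eq_ev => w; rewrite mul1r.
Qed.

Lemma ev0 : ev E (fun=> 0) = 0.
Proof.
rewrite -[RHS](addNr (ev E (fun=> 0))) -mulN1r -ev_lin; try exact: dom_cst.
by apply: eq_ev => w; rewrite mulr0 addr0.
Qed.

Lemma domZ a f : dom E f -> dom E (fun w => a * f w).
Proof.
move=> Df; apply: eq_dom (dom_lin a Df (dom_cst E 0)) => w.
by rewrite addr0.
Qed.

Lemma evZ a f : dom E f -> ev E (fun w => a * f w) = a * ev E f.
Proof.
move=> Df; rewrite -[RHS]addr0 -ev0 -ev_lin//; last exact: dom_cst.
by apply: eq_ev => w; rewrite addr0.
Qed.

Lemma ev_cst c : ev E (fun=> c) = c.
Proof.
rewrite -[RHS]mulr1 -(ev_cst1 E) -evZ; last exact: dom_cst.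
by apply: eq_ev => w; rewrite mulr1.
Qed.

Lemma domB f g : dom E f -> dom E g -> dom E (fun w => f w - g w).
Proof.
move=> Df Dg; apply: eq_dom (dom_lin (-1) Dg Df) => w.
by rewrite mulN1r addrC.
Qed.

Lemma evB f g : dom E f -> dom E g ->
  ev E (fun w => f w - g w) = ev E f - ev E g.
Proof.
move=> Df Dg; rewrite addrC -mulN1r -ev_lin//.
by apply: eq_ev => w; rewrite mulN1r addrC.
Qed.

Lemma dom_sum (I : Type) (s : seq I) (F : I -> Om -> R) :
  (forall i, dom E (F i)) -> dom E (fun w => \sum_(i <- s) F i w).
Proof.
move=> DF; elim: s => [|i s IH].
  by apply: eq_dom (dom_cst E 0) => w; rewrite big_nil.
by apply: eq_dom (domD (DF i) IH) => w; rewrite big_cons.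
Qed.

Lemma ev_sum (I : Type) (s : seq I) (F : I -> Om -> R) :
  (forall i, dom E (F i)) ->
  ev E (fun w => \sum_(i <- s) F i w) = \sum_(i <- s) ev E (F i).
Proof.
move=> DF; elim: s => [|i s IH].
  rewrite big_nil -[RHS]ev0.
  by apply: eq_ev => w; rewrite big_nil.
rewrite big_cons -IH -evD//; last exact: dom_sum.
by apply: eq_ev => w; rewrite big_cons.
Qed.

Lemma ev_dist_le f g h : dom E f -> dom E g -> dom E h ->
  (forall w, `|f w - g w| <= h w) -> `|ev E f - ev E g| <= ev E h.
Proof.
move=> Df Dg Dh fgh.
have H1 : ev E (fun w => f w - g w) <= ev E h.
  apply: ev_le => //; first exact: domB.
  by move=> w; exact: le_trans (ler_norm _) (fgh w).
have H2 : ev E (fun w => -1 * h w) <= ev E (fun w => f w - g w).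
  apply: ev_le; [exact: domZ|exact: domB|].
  by move=> w; have := fgh w; rewrite mulN1r ler_norml => /andP[].
by move: H1 H2; rewrite evZ// evB// ler_norml mulN1r => -> ->.
Qed.

End expectation_theory.

Section uniform.
Context {R : realType}.

Definition avg (D : finType) (F : D -> R) : R := (\sum_s F s) / #|D|%:R.

Lemma avg_cst (D : finType) (x0 : D) (c : R) : avg (fun _ : D => c) = c.
Proof.
rewrite /avg sumr_const -[c *+ _]mulr_natr mulfK// pnatr_eq0 -lt0n.
by apply/card_gt0P; exists x0.
Qed.

Lemma avg_lin (D : finType) a (f g : D -> R) :
  avg (fun w => a * f w + g w) = a * avg f + avg g.
Proof. by rewrite /avg big_split /= -mulr_sumr mulrDl mulrA. Qed.

Lemma avg_le (D : finType) (f g : D -> R) :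
  (forall w, f w <= g w) -> avg f <= avg g.
Proof.
by move=> fg; rewrite /avg ler_wpM2r ?invr_ge0 ?ler0n// ler_sum.
Qed.

Definition uniform (D : finType) (x0 : D) : expectation R D :=
  @Expectation R D (fun=> True) (@avg D) (fun _ => I) (fun _ _ _ _ _ => I)
    (fun a f g _ _ => avg_lin a f g) (fun f g _ _ => @avg_le D f g)
    (avg_cst x0 1).

Lemma avg_bij (D D' : finType) (h : D -> D') (F : D' -> R) :
  bijective h -> avg F = avg (F \o h).
Proof.
by move=> bh; rewrite /avg (bij_eq_card bh) (reindex h) //; exact: onW_bij.
Qed.

Definition upd {O : finType} {T : Type} (s : {ffun O -> T}) o x : {ffun O -> T} :=
  [ffun p => if p == o then x else s p].

Lemma updE {O : finType} {T : Type} (s : {ffun O -> T}) o x : upd s o x o = x.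
Proof. by rewrite ffunE eqxx. Qed.

(* The map (s, x) |-> (upd s o x, s o) is an involution. *)
Lemma avg_resample (O T : finType) (o : O) (F : {ffun O -> T} -> R) :
  avg F = avg (fun s => avg (fun x => F (upd s o x))).
Proof.
have [T0|] := posnP #|T|.
  suff D0 : #|{ffun O -> T}| = 0%N by rewrite /avg D0 invr0 !mulr0.
  rewrite card_ffun T0 exp0n//; apply/card_gt0P; by exists o.
move=> Tpos; rewrite /avg; congr (_ / _).
rewrite -mulr_suml pair_big/=.
pose phi (p : {ffun O -> T} * T) := (upd p.1 o p.2, p.1 o).
have phiK : involutive phi.
  move=> [s x]; rewrite /phi/= updE; congr (_, _); apply/ffunP => p.
  by rewrite !ffunE; case: eqP => // ->.
rewrite (reindex phi)/=; last exact/onW_bij/inv_bij.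
apply: (canRL (mulfK _)); first by rewrite pnatr_eq0 -lt0n.
rewrite -(pair_big xpredT xpredT (fun s x => F (upd (upd s o x) o (s o))))/=.
rewrite mulr_suml; apply: eq_bigr => s _.
transitivity (\sum_(x : T) F s); first by rewrite sumr_const mulr_natr.
apply: eq_bigr => x _; congr F; apply/ffunP => p.
by rewrite !ffunE; case: eqP => // ->.
Qed.

Lemma avg_proj (O T : finType) (o : O) (h : T -> R) (x0 : T) :
  avg (fun s : {ffun O -> T} => h (s o)) = avg h.
Proof.
rewrite (avg_resample o).
under eq_fun do under eq_fun do rewrite updE.
by rewrite (avg_cst [ffun=> x0]).
Qed.

End uniform.

Section jets.
Context {R : realType}.
Implicit Types (f g : R -> R) (C : R).

(** A single constant bounds the function, its coefficients and its remainder, which makes the class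
    stable under products. Expansions at 0 suffice because [smooth] lets the base point vary. *)
Definition jet2 C f := (forall x, `|f x| <= C) /\
  exists p0 p1 p2, [/\ `|p0| <= C, `|p1| <= C, `|p2| <= C &
    forall x, `|x| <= 1 -> `|f x - (p0 + p1 * x + p2 * x ^+ 2)| <= C * `|x| ^+ 3].

(* Size of the remainder, at x, of a bounded function with a second order
   expansion at 0. *)
Definition trunc3 (x : R) := Num.min (x ^+ 2) (`|x| ^+ 3).

Lemma trunc3_ge0 x : 0 <= trunc3 x.
Proof. by rewrite /trunc3 le_min sqr_ge0 exprn_ge0. Qed.

Lemma trunc3_le_norm x : trunc3 x <= `|x| ^+ 3.
Proof. by rewrite /trunc3 ge_min lexx orbT. Qed.

Lemma trunc3_le_sqr x : trunc3 x <= x ^+ 2.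
Proof. by rewrite /trunc3 ge_min lexx. Qed.

Lemma jet2_ge0 C f : jet2 C f -> 0 <= C.
Proof. by case=> /(_ 0) h _; exact: le_trans h. Qed.

(** Beyond 1 each of f, p0, p1 x and p2 x^2 is at most C x^2, whence the factor 4. *)
Lemma jet2_bound C f : jet2 C f -> exists p0 p1 p2, [/\ `|p2| <= C &
  forall x, `|f x - (p0 + p1 * x + p2 * x ^+ 2)| <= 4 * C * trunc3 x].
Proof.
move=> jf; have C0 := jet2_ge0 jf; case: jf => fC [p0 [p1 [p2 [h0 h1 h2 h3]]]].
exists p0, p1, p2; split=> // x.
have [x1|x1] := leP `|x| 1.
  apply: le_trans (h3 _ x1) _.
  have -> : trunc3 x = `|x| ^+ 3.
    rewrite /trunc3; apply/min_idPr; rewrite -normrX exprS.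
    by rewrite normrM -[leRHS]ger0_norm ?sqr_ge0// ler_piMl.
  by rewrite ler_wpM2r ?exprn_ge0//; lra.
have -> : trunc3 x = x ^+ 2.
  rewrite /trunc3; apply/min_idPl; rewrite -normrX exprS.
  by rewrite normrM -[leLHS]ger0_norm ?sqr_ge0// ler_peMl// ltW.
apply: le_trans (ler_normB _ _) _.
have x2 : `|x| <= x ^+ 2.
  by rewrite -[leRHS]ger0_norm ?sqr_ge0// normrX expr2 ler_peMl// ltW.
have b1 : `|p1 * x| <= C * x ^+ 2.
  by rewrite normrM; apply: ler_pM.
have b2 : `|p2 * x ^+ 2| <= C * x ^+ 2.
  by rewrite normrM (ger0_norm (sqr_ge0 x)); apply: ler_wpM2r; rewrite ?sqr_ge0.
have b0 : C <= C * x ^+ 2.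
  by rewrite ler_peMr//; lra.
have := fC x.
have := ler_normD (p0 + p1 * x) (p2 * x ^+ 2).
have := ler_normD p0 (p1 * x).
lra.
Qed.

(** One Lindeberg swap. The constant term cancels, the linear one vanishes because xi is centred and
    the two signs are symmetric, and the quadratic one leaves the difference of the variances. *)
Lemma jet2_ev Om (E : expectation R Om) (xi : Om -> R) f C tau :
  jet2 C f -> dom E xi -> dom E (fun w => xi w ^+ 2) ->
  dom E (fun w => trunc3 (xi w)) -> dom E (fun w => f (xi w)) ->
  ev E xi = 0 ->
  `|ev E (fun w => f (xi w)) - (f tau + f (- tau)) / 2| <=
   4 * C * (ev E (fun w => trunc3 (xi w)) + `|tau| ^+ 3) +
   C * `|ev E (fun w => xi w ^+ 2) - tau ^+ 2|.
Proof.
move=> jf D1 D2 D3 Df xi0; have C0 := jet2_ge0 jf.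
have [p0 [p1 [p2 [p2C fp]]]] := jet2_bound jf.
have Dq : dom E (fun w => p2 * xi w ^+ 2 + (p1 * xi w + p0)).
  by apply: dom_lin => //; apply: dom_lin => //; apply: dom_cst.
have := @ev_dist_le _ _ E _ _ (fun w => 4 * C * trunc3 (xi w)) Df Dq.
rewrite evZ// ev_lin//; last by apply: dom_lin => //; apply: dom_cst.
rewrite ev_lin//; last exact: dom_cst.
rewrite xi0 ev_cst mulr0 add0r => /(_ (domZ _ D3)) H.
have {}H : `|ev E (fun w : Om => f (xi w)) -
      (p2 * ev E (fun w : Om => xi w ^+ 2) + p0)| <=
      4 * C * ev E (fun w : Om => trunc3 (xi w)).
  apply: H => w; rewrite [X in f (xi w) - X](_ : _ = p0 + p1 * xi w + p2 * xi w ^+ 2) //.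
  by ring.
have tb s : `|s| = `|tau| -> `|f s - (p0 + p1 * s + p2 * s ^+ 2)| <= 4 * C * `|tau| ^+ 3.
  move=> <-; apply: le_trans (fp _) _.
  by apply: ler_wpM2l (trunc3_le_norm _); lra.
have t1 := tb tau erefl.
have t2 := tb (- tau) (normrN _).
have q : `|p2 * (ev E (fun w => xi w ^+ 2) - tau ^+ 2)| <=
    C * `|ev E (fun w => xi w ^+ 2) - tau ^+ 2|.
  by rewrite normrM ler_wpM2r.
rewrite sqrrN in t2.
move: H t1 t2 q; rewrite !ler_norml => /andP[a1 a2] /andP[b1 b2] /andP[c1 c2] /andP[e1 e2].
by apply/andP; split; lra.
Qed.

Lemma jet2_le C C' f : C <= C' -> jet2 C f -> jet2 C' f.
Proof.
move=> CC' [h [p0 [p1 [p2 [h0 h1 h2 h3]]]]]; split.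
  by move=> x; exact: le_trans (h x) CC'.
exists p0, p1, p2; split; try exact: le_trans CC'.
by move=> x x1; apply: le_trans (h3 x x1) _; rewrite ler_wpM2r// exprn_ge0.
Qed.

Lemma jet2_cst c : jet2 `|c| (fun=> c).
Proof.
split=> //; exists c, 0, 0; split; rewrite ?normr0//.
by move=> x _; rewrite !mul0r !addr0 subrr normr0 mulr_ge0// exprn_ge0.
Qed.

(** With F and G the two quadratic polynomials, the remainder is f (g - G) + (f - F) G plus the
    monomials of degree 3 and 4 of F G. In units of C C' they cost 1, 3, 2 and 1, below 8. *)
Lemma jet2M C C' f g : jet2 C f -> jet2 C' g ->
  jet2 (8 * C * C') (fun x => f x * g x).
Proof.
move=> jf jg; have C0 := jet2_ge0 jf; have C'0 := jet2_ge0 jg.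
case: jf => fC [p0 [p1 [p2 [h0 h1 h2 h3]]]].
case: jg => gC [q0 [q1 [q2 [k0 k1 k2 k3]]]].
have CC : 0 <= C * C' by exact: mulr_ge0.
have M a b : `|a| <= C -> `|b| <= C' -> `|a * b| <= C * C'.
  by move=> aC bC; rewrite normrM ler_pM.
split.
  by move=> x; apply: le_trans (M _ _ (fC x) (gC x)) _; lra.
exists (p0 * q0), (p0 * q1 + p1 * q0), (p0 * q2 + p1 * q1 + p2 * q0).
split.
- by apply: le_trans (M _ _ h0 k0) _; lra.
- apply: le_trans (ler_normD _ _) _.
  by have := M _ _ h0 k1; have := M _ _ h1 k0; lra.
- apply: le_trans (ler_normD _ _) _.
  have := ler_normD (p0 * q2) (p1 * q1).
  by have := M _ _ h0 k2; have := M _ _ h1 k1; have := M _ _ h2 k0; lra.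
move=> x x1.
set F := p0 + p1 * x + p2 * x ^+ 2 in h3 *.
set G := q0 + q1 * x + q2 * x ^+ 2 in k3 *.
have xn : x ^+ 2 = `|x| ^+ 2 by rewrite -normrX ger0_norm ?sqr_ge0.
have x3 : `|x| ^+ 4 <= `|x| ^+ 3.
  by rewrite exprS ler_piMl// exprn_ge0.
have y3 : 0 <= `|x| ^+ 3 by rewrite exprn_ge0.
have GB : `|G| <= 3 * C'.
  apply: le_trans (ler_normD _ _) _.
  have := ler_normD q0 (q1 * x).
  have : `|q1 * x| <= C' * 1 by rewrite normrM ler_pM.
  have : `|q2 * x ^+ 2| <= C' * 1.
    by rewrite normrM ler_pM// normrX exprn_ile1.
  by lra.
have -> : f x * g x - (p0 * q0 + (p0 * q1 + p1 * q0) * x +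
    (p0 * q2 + p1 * q1 + p2 * q0) * x ^+ 2) =
  f x * (g x - G) + (f x - F) * G + ((p1 * q2 + p2 * q1) * x ^+ 3 + p2 * q2 * x ^+ 4).
  by rewrite /F /G; ring.
have B1 : `|f x * (g x - G)| <= C * C' * `|x| ^+ 3.
  by rewrite normrM -mulrA ler_pM// k3.
have B2 : `|(f x - F) * G| <= 3 * (C * C') * `|x| ^+ 3.
  rewrite normrM.
  rewrite (_ : 3 * _ * _ = (C * `|x| ^+ 3) * (3 * C')); last by ring.
  by rewrite ler_pM// h3.
have B3 : `|(p1 * q2 + p2 * q1) * x ^+ 3| <= 2 * (C * C') * `|x| ^+ 3.
  rewrite normrM normrX ler_wpM2r//.
  by apply: le_trans (ler_normD _ _) _; have := M _ _ h1 k2; have := M _ _ h2 k1; lra.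
have B4 : `|p2 * q2 * x ^+ 4| <= C * C' * `|x| ^+ 3.
  by rewrite normrM normrX ler_pM// ?M// exprn_ge0.
apply: le_trans (ler_normD _ _) _.
have := ler_normD (f x * (g x - G)) ((f x - F) * G).
have := ler_normD ((p1 * q2 + p2 * q1) * x ^+ 3) (p2 * q2 * x ^+ 4).
have := mulr_ge0 CC y3.
lra.
Qed.

(** C' is chosen before the family G: this is what makes the smoothness constant of [orthant]
    uniform in the threshold. The family F witnesses that the constants are nonnegative. *)
Lemma jet2_prod (I : Type) (s : seq I) (P : pred I) C (F : I -> R -> R) :
  (forall i, jet2 C (F i)) ->
  exists C', forall (G : I -> R -> R), (forall i, jet2 C (G i)) ->
    jet2 C' (fun x => \prod_(i <- s | P i) G i x).
Proof.
move=> jF; elim: s => [|i s [C' IH]].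
  exists 1 => G _; under eq_fun do rewrite big_nil.
  by have := jet2_cst 1; rewrite normr1.
have C'0 : 0 <= C' by have := jet2_ge0 (IH _ jF).
have C0 : 0 <= C by have := jet2_ge0 (jF i).
exists (C' + 8 * C * C') => G jG.
under eq_fun do rewrite big_cons.
case: (P i).
  apply: jet2_le (jet2M (jG i) (IH _ jG)).
  by rewrite lerDr.
by apply: jet2_le (IH _ jG); rewrite lerDl !mulr_ge0.
Qed.

End jets.

Section spline.
Context {R : realType}.
Implicit Types x u y : R.

Definition cubp x := Num.max 0 x ^+ 3.

(* The integral of the quadratic cardinal B-spline: a smoothed indicator. *)
Definition spline x :=
  (cubp x - 3 * cubp (x - 1) + 3 * cubp (x - 2) - cubp (x - 3)) / 6.

(** A sum of pairs, so that destructuring it rewrites the maximum and leaves a sign hypothesis to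
    [lra] and [nra]. *)
Lemma maxP0 x : (0 <= x) * (Num.max 0 x = x) + (x <= 0) * (Num.max 0 x = 0).
Proof.
have [x0|x0] := leP 0 x; [left|right]; split=> //.
exact: ltW.
Qed.

Lemma spline_eq0 x : x <= 0 -> spline x = 0.
Proof.
by move=> x0; rewrite /spline /cubp !max_l; lra.
Qed.

Lemma spline_eq1 x : 3 <= x -> spline x = 1.
Proof.
by move=> x3; rewrite /spline /cubp !max_r; lra.
Qed.

Lemma spline_itv x : 0 <= spline x <= 1.
Proof.
rewrite /spline /cubp.
have [[? ->]|[? ->]] := maxP0 x; have [[? ->]|[? ->]] := maxP0 (x - 1);
have [[? ->]|[? ->]] := maxP0 (x - 2); have [[? ->]|[? ->]] := maxP0 (x - 3);
  rewrite ?expr0n/=; apply/andP; split; try nra.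
- have : (3 - x) ^+ 3 <= 1 by rewrite exprn_ile1; lra.
  lra.
- have : 0 <= (3 - x) ^+ 3 by rewrite exprn_ge0; lra.
  lra.
- have h1 : 0 <= (x - 1) ^+ 2 * (2 - x) by rewrite mulr_ge0 ?sqr_ge0//; lra.
  have h2 : 0 <= (x - 1) ^+ 3 by rewrite exprn_ge0.
  lra.
- have h1 : 0 <= (2 - x) ^+ 2 * (1 + 2 * (x - 1)).
    by rewrite mulr_ge0 ?sqr_ge0//; lra.
  lra.
Qed.

Lemma spline_ge0 x : 0 <= spline x.
Proof. by case/andP: (spline_itv x). Qed.

Lemma spline_le1 x : spline x <= 1.
Proof. by case/andP: (spline_itv x). Qed.

(** The third derivative of [cubp] takes the values 0 and 6, so Taylor's remainder is at most 6
    |y|^3 / 3!. *)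
Lemma cubp_taylor u y :
  `|cubp (u + y) - (cubp u + 3 * Num.max 0 u ^+ 2 * y + 3 * Num.max 0 u * y ^+ 2)|
   <= `|y| ^+ 3.
Proof.
rewrite /cubp -normrX.
have [[? ->]|[? ->]] := maxP0 (u + y); have [[? ->]|[? ->]] := maxP0 u.
- rewrite (_ : _ - _ = y ^+ 3)//; ring.
- rewrite !expr0n/= !mulr0 !mul0r !addr0 subr0 !ger0_norm ?exprn_ge0//; last lra.
  by rewrite lerXn2r ?nnegrE; lra.
- have h1 : 0 <= (- (u + y)) ^+ 3 by rewrite exprn_ge0; lra.
  have h2 : (- (u + y)) ^+ 3 <= (- y) ^+ 3 by rewrite lerXn2r ?nnegrE; lra.
  by rewrite [leRHS]ler0_norm ?ler_norml; [apply/andP; split|]; lra.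
- by rewrite !expr0n/= !mulr0 !mul0r !addr0 subr0 normr0 normr_ge0.
Qed.

(** The witnesses are the first derivative and half the second. The four cubic remainders carry
    weights 1, 3, 3, 1 over 6, which sum to 8/6, at most 2. *)
Lemma spline_taylor u : exists p1 p2 : R, [/\ `|p1| <= 1, `|p2| <= 1 &
  forall y, `|spline (u + y) - (spline u + p1 * y + p2 * y ^+ 2)| <= 2 * `|y| ^+ 3].
Proof.
pose m i := Num.max 0 (u - i).
exists ((m 0 ^+ 2 - 3 * m 1 ^+ 2 + 3 * m 2 ^+ 2 - m 3 ^+ 2) / 2).
exists ((m 0 - 3 * m 1 + 3 * m 2 - m 3) / 2).
split.
- rewrite /m subr0 ler_norml.
  have [[? ->]|[? ->]] := maxP0 u; have [[? ->]|[? ->]] := maxP0 (u - 1);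
  have [[? ->]|[? ->]] := maxP0 (u - 2); have [[? ->]|[? ->]] := maxP0 (u - 3);
    rewrite ?expr0n/=; apply/andP; split; try nra.
- rewrite /m subr0 ler_norml.
  have [[? ->]|[? ->]] := maxP0 u; have [[? ->]|[? ->]] := maxP0 (u - 1);
  have [[? ->]|[? ->]] := maxP0 (u - 2); have [[? ->]|[? ->]] := maxP0 (u - 3);
    rewrite ?expr0n/=; apply/andP; split; try nra.
move=> y.
have h0 := cubp_taylor u y; have h1 := cubp_taylor (u - 1) y.
have h2 := cubp_taylor (u - 2) y; have h3 := cubp_taylor (u - 3) y.
rewrite -/(m 1) in h1; rewrite -/(m 2) in h2; rewrite -/(m 3) in h3.
rewrite -[in Num.max _ _](subr0 u) -/(m 0) in h0.
rewrite /spline; rewrite ![u + y - _]addrAC.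
move: h0 h1 h2 h3; rewrite !ler_norml.
move=> /andP[? ?] /andP[? ?] /andP[? ?] /andP[? ?]; apply/andP; split; lra.
Qed.

(** The factor 2 comes from [spline_taylor], and (1 + B)^3 dominates 1, B, B^2 and B^3 at once. *)
Lemma jet2_spline (a B c : R) : `|a| <= B ->
  jet2 (2 * (1 + B) ^+ 3) (fun x => spline (c + a * x)).
Proof.
move=> aB; have B0 : 0 <= B := le_trans (normr_ge0 _) aB.
have B2 : B ^+ 2 <= (1 + B) ^+ 3.
  apply: (@le_trans _ _ ((1 + B) ^+ 2)); first by rewrite lerXn2r ?nnegrE; lra.
  by rewrite [leRHS]exprSr ler_peMr ?exprn_ge0//; lra.
have B1 : 1 + B <= (1 + B) ^+ 3.
  by rewrite exprS ler_peMr ?exprn_ege1//; lra.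
have B3 : B ^+ 3 <= (1 + B) ^+ 3 by rewrite lerXn2r ?nnegrE; lra.
have sp x : `|spline x| <= 2 * (1 + B) ^+ 3.
  by rewrite ger0_norm ?spline_ge0//; have := spline_le1 x; lra.
split=> [x|]; first exact: sp.
have [p1 [p2 [h1 h2 h3]]] := spline_taylor c.
exists (spline c), (p1 * a), (p2 * a ^+ 2); split.
- exact: sp.
- apply: (@le_trans _ _ (1 * B)); first by rewrite normrM ler_pM.
  lra.
- apply: (@le_trans _ _ (1 * B ^+ 2)).
    by rewrite normrM normrX ler_pM ?exprn_ge0// lerXn2r// nnegrE.
  lra.
move=> x _.
have -> : spline c + p1 * a * x + p2 * a ^+ 2 * x ^+ 2 =
  spline c + p1 * (a * x) + p2 * (a * x) ^+ 2 by ring.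
apply: le_trans (h3 _) _.
have -> : 2 * `|a * x| ^+ 3 = 2 * `|a| ^+ 3 * `|x| ^+ 3.
  by rewrite normrM; ring.
rewrite ler_wpM2r ?exprn_ge0// ler_wpM2l//.
by apply: le_trans B3; rewrite lerXn2r// nnegrE.
Qed.

End spline.

Section smooth.
Context {R : realType} {Gam : finType}.
Implicit Types (u v : Gam -> R) (psi : (Gam -> R) -> R).

Definition pt (g : Gam) (x : R) : Gam -> R := fun g' => if g' == g then x else 0.

(** A swap moves one coordinate only, so jets along the axes, uniform in the base point u, are what
    the replacement argument consumes. *)
Definition smooth C psi := forall u g, jet2 C (fun x => psi (u + pt g x)).

(** A smoothed indicator of the orthant A u <= t restricted to the coordinates in J; the transition
    along each coordinate has width 3 / s. *)
Definition orthant (D : finType) (J : pred D) (A : D -> Gam -> R) (s : R)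
    (t : D -> R) u : R :=
  \prod_(j | J j) spline (s * (t j - \sum_g A j g * u g)).

Lemma sum_pt (a u : Gam -> R) g x :
  \sum_g' a g' * (u + pt g x) g' = \sum_g' a g' * u g' + a g * x.
Proof.
transitivity (\sum_g' (a g' * u g' + (if g' == g then a g' * x else 0))).
  apply: eq_bigr => g' _; rewrite fctE mulrDr /pt; congr (_ + _).
  by case: ifP => // _; rewrite mulr0.
by rewrite big_split/= -big_mkcond big_pred1_eq.
Qed.

Lemma orthant_smooth (D : finType) (J : pred D) (A : D -> Gam -> R) (s : R) :
  exists C, forall t, smooth C (orthant J A s t).
Proof.
pose B : R := \sum_j \sum_g `|s * A j g|.
have AB j g : `|- (s * A j g)| <= B.
  rewrite normrN; apply: (@le_trans _ _ (\sum_g `|s * A j g|)).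
    by rewrite (bigD1 g)//= lerDl sumr_ge0.
  by rewrite /B (bigD1 j)//= lerDl; apply: sumr_ge0 => *; apply: sumr_ge0.
have B0 : `|0 : R| <= B by rewrite normr0 /B; apply: sumr_ge0 => *; apply: sumr_ge0.
(* The constant family instantiates [jet2_prod]; the C obtained is valid for all families with
   slopes at most B, hence for every t. *)
have [C jC] := @jet2_prod R D (index_enum D) J _
  (fun _ x => spline (0 + 0 * x)) (fun i => jet2_spline 0 B0).
exists C => t u g.
have := jC (fun j x => spline (s * (t j - \sum_g A j g * u g) + - (s * A j g) * x))
  (fun j => jet2_spline _ (AB j g)).
congr (jet2 _ _); apply/funext => x; rewrite /orthant.
by apply: eq_bigr => j _; rewrite sum_pt; congr spline; ring.
Qed.

End smooth.

(** * Lindeberg's swapping argument *)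

Section lindeberg.
Context {R : realType} {Gam : finType} {O : eqType} {Om : Type}.
Variables (E : expectation R Om) (grp : O -> Gam) (xi : O -> Om -> R)
  (tau : O -> R) (psi : (Gam -> R) -> R).
Implicit Types (os : seq O) (a : Gam -> R).

Definition gsum os (w : Om) : Gam -> R := \sum_(o <- os) pt (grp o) (xi o w).

(** The average over signs, written as iterated half-sums in the order of the swaps so that the
    induction matches it; [radopE] gives its closed form. *)
Fixpoint radop os a : R := if os is o :: os' then
  (radop os' (a + pt (grp o) (tau o)) + radop os' (a + pt (grp o) (- tau o))) / 2
  else psi a.

Variable b : O -> R.
Hypothesis dom_gsum : forall os a, dom E (fun w => psi (gsum os w + a)).
(** Independence of the term o from the remaining ones is expressed as a Fubini identity, a form
    available for finite resampling as well as for integrals. *)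
Hypothesis dom_indep : forall o os a, o \notin os ->
  dom E (fun w => ev E (fun w' => psi (gsum os w + a + pt (grp o) (xi o w')))).
Hypothesis ev_indep : forall o os a, o \notin os ->
  ev E (fun w => psi (gsum os w + a + pt (grp o) (xi o w))) =
  ev E (fun w => ev E (fun w' => psi (gsum os w + a + pt (grp o) (xi o w')))).
Hypothesis step : forall o u,
  `|ev E (fun w' => psi (u + pt (grp o) (xi o w'))) -
    (psi (u + pt (grp o) (tau o)) + psi (u + pt (grp o) (- tau o))) / 2| <= b o.

(** The free shift a absorbs the signs already swapped in: after the swap of o, the induction
    hypothesis is used at both a + tau and a - tau. *)
Lemma lindeberg_replacement os a : uniq os ->
  `|ev E (fun w => psi (gsum os w + a)) - radop os a| <= \sum_(o <- os) b o.
Proof.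
elim: os a => [|o os IH] a /=.
  move=> _; rewrite big_nil.
  have -> : (fun w : Om => psi (gsum [::] w + a)) = fun=> psi a.
    by apply/funext => w; rewrite /gsum big_nil add0r.
  by rewrite ev_cst subrr normr0.
move=> /andP[oos uos]; rewrite big_cons.
have -> : ev E (fun w => psi (gsum (o :: os) w + a)) =
    ev E (fun w => ev E (fun w' => psi (gsum os w + a + pt (grp o) (xi o w')))).
  rewrite -ev_indep//; apply: eq_ev => w; rewrite /gsum big_cons.
  by rewrite -addrA addrC.
pose ap := a + pt (grp o) (tau o); pose am := a + pt (grp o) (- tau o).
have := IH ap uos; have := IH am uos.
have Dpm : dom E (fun w => 2^-1 * psi (gsum os w + ap) + 2^-1 * psi (gsum os w + am)).
  by apply: domD; apply: domZ.
have := @ev_dist_le _ _ E _ _ (fun=> b o) (dom_indep a oos) Dpm (dom_cst _ _).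
rewrite evD ?evZ//; try exact: domZ.
rewrite ev_cst -/ap -/am => H H1 H2.
have {}H : `|ev E (fun w => ev E (fun w' => psi (gsum os w + a + pt (grp o) (xi o w')))) -
    (2^-1 * ev E (fun w => psi (gsum os w + ap)) +
     2^-1 * ev E (fun w => psi (gsum os w + am)))| <= b o.
  apply: H => w; have := step o (gsum os w + a).
  by rewrite -!addrA -/ap -/am mulrDl ![_ / 2]mulrC.
move: H H1 H2; rewrite !ler_norml.
by move=> /andP[? ?] /andP[? ?] /andP[? ?]; apply/andP; split; lra.
Qed.

End lindeberg.

Section finite_sampling.
Context {R : realType} {Gam O T : finType}.
Variables (grp : O -> Gam) (z : O -> T -> R) (x0 : T).
Implicit Types (psi : (Gam -> R) -> R).

Let Om := {ffun O -> T}.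
Let E : expectation R Om := uniform [ffun=> x0].
Let xi (o : O) (s : Om) : R := z o (s o).

Lemma gsum_upd (o : O) (os : seq O) (s : Om) x : o \notin os ->
  gsum grp xi os (upd s o x) = gsum grp xi os s.
Proof.
move=> oos; rewrite /gsum; apply: eq_big_seq => p pos.
rewrite /xi ffunE; case: eqP => // po; by rewrite -po pos in oos.
Qed.

(** Redrawing coordinate o preserves the uniform law and does not affect the terms indexed by os. *)
Lemma finite_indep psi (o : O) os a : o \notin os ->
  ev E (fun w => psi (gsum grp xi os w + a + pt (grp o) (xi o w))) =
  ev E (fun w => ev E (fun w' => psi (gsum grp xi os w + a + pt (grp o) (xi o w')))).
Proof.
move=> oos; rewrite [LHS](avg_resample o); congr avg; apply/funext => s.
rewrite /= (avg_proj o (fun x => psi (gsum grp xi os s + a + pt (grp o) (z o x))) x0).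
by congr avg; apply/funext => x; rewrite gsum_upd// /xi updE.
Qed.

End finite_sampling.

Section rademacher.
Context {R : realType} {Gam O : finType}.
Variables (grp : O -> Gam) (tau : O -> R).

Definition signed (b : bool) (x : R) := if b then x else - x.

Definition radsum (s : {ffun O -> bool}) : Gam -> R :=
  \sum_o pt (grp o) (signed (s o) (tau o)).

(** The replacement bound is applied to the signs themselves, for which every swap has error 0. *)
Lemma radopE (psi : (Gam -> R) -> R) :
  radop grp tau psi (index_enum O) 0 = avg (fun s => psi (radsum s)).
Proof.
pose E := @uniform R _ [ffun _ : O => true].
have := @lindeberg_replacement R Gam O _ E grp
   (fun o s => signed (s o) (tau o)) tau psi (fun=> 0)
  (fun _ _ => I) (fun _ _ _ _ => I) (fun o os a oos =>
    @finite_indep R Gam O bool grp (fun o b => signed b (tau o)) true psi o os a oos).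
move=> /(_ _ (index_enum O) 0 (index_enum_uniq O)) H.
apply/eqP; rewrite eq_sym -subr_eq0 -normr_le0.
rewrite big1// in H; apply: le_trans (H _).
  by under [fun s => psi _]eq_fun do rewrite -[radsum _]addr0.
move=> o u /=; rewrite (avg_proj o (fun b => psi (u + pt (grp o) (signed b (tau o)))) true).
by rewrite /avg card_bool big_bool/= subrr normr0.
Qed.

End rademacher.

(** * Anti-concentration of Rademacher sums *)

Definition ind {R : realType} (b : bool) : R := b%:R.

Section binomial.
Local Open Scope nat_scope.

Lemma bin_le_central m k : 'C(m.*2, k) <= 'C(m.*2, m).
Proof.
wlog km : k / k <= m => [H|].
  have [|mk] := leqP k m; first exact: H.
  have [kn|kn] := leqP k m.*2; last by rewrite bin_small.
  by rewrite -bin_sub// H//; lia.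
have [e] : exists e, e + k = m by exists (m - k); rewrite subnK.
elim: e k {km} => [|e IH] k ekm; first by rewrite -ekm add0n.
apply: leq_trans (IH k.+1 _); last by rewrite -ekm addSnnS.
have h := mul_bin_left m.*2 k.
rewrite -(@leq_pmul2l k.+1)// h leq_mul2r; apply/orP; right.
by rewrite -ekm; lia.
Qed.

(** By the recursion (m+1) C(2m+2, m+1) = 2 (2m+1) C(2m, m), the induction reduces to (2m+1)(2m+3)
    <= (2m+2)^2. The factor 2m+1, instead of 2m, is also what the odd case of [bin_bound]
    requires. *)
Lemma central_bin_bound m : 'C(m.*2, m) ^ 2 * m.*2.+1 <= 4 ^ m.*2.
Proof.
elim: m => [|m IH]; first by rewrite bin0.
have e : m.+1 * 'C(m.+1.*2, m.+1) = m.*2.+1.*2 * 'C(m.*2, m).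
  have e1 := mul_bin_diag m.*2.+1 m.
  have e2 : 'C(m.*2.+1, m) = 'C(m.*2.+1, m.+1).
    by rewrite -[RHS]bin_sub; [congr 'C(_, _)|]; lia.
  by rewrite doubleS binS e2 addnn -doubleMr -e1/= doubleMl.
rewrite -(@leq_pmul2l (m.+1 ^ 2))// mulnA -expnMn e.
have -> : 4 ^ m.+1.*2 = 16 * 4 ^ m.*2 by rewrite doubleS !expnS mulnA.
apply: (@leq_trans (('C(m.*2, m) ^ 2 * m.*2.+1) * (4 * m.*2.+1 * m.*2.+3))).
  by rewrite doubleS !expnS !expn0 -!muln2; lia.
apply: (@leq_trans (4 ^ m.*2 * (4 * m.*2.+1 * m.*2.+3))).
  by rewrite leq_mul2r IH orbT.
have -> : m.+1 ^ 2 * (16 * 4 ^ m.*2) = 4 ^ m.*2 * (16 * m.+1 ^ 2) by ring.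
rewrite leq_mul2l; apply/orP; right.
by rewrite !expnS expn0; lia.
Qed.

(** In probabilistic terms, a binomial law with n fair trials has no atom above 1 / sqrt n. Odd n
    follows from Pascal's rule, which costs a factor 2 on the central coefficient. *)
Lemma bin_bound n k : 'C(n, k) ^ 2 * n <= 4 ^ n.
Proof.
have [m [->|->]] : exists m, n = m.*2 \/ n = m.*2.+1.
  by exists n./2; rewrite -{1 3}(odd_double_half n); case: odd; [right|left].
- apply: leq_trans (central_bin_bound m).
  by rewrite leq_mul// leq_exp2r// bin_le_central.
- have h : 'C(m.*2.+1, k) <= 2 * 'C(m.*2, m).
    case: k => [|k]; first by rewrite bin0; have := bin_gt0 m.*2 m; lia.
    rewrite binS; have := bin_le_central m k; have := bin_le_central m k.+1.
    lia.
  apply: (@leq_trans ((2 * 'C(m.*2, m)) ^ 2 * m.*2.+1)).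
    by rewrite leq_mul// leq_exp2r.
  rewrite expnMn -mulnA [leqRHS]expnS.
  by rewrite (@leq_pmul2l 4)// central_bin_bound.
Qed.

End binomial.

Section card_window.
Context {R : realType}.

Lemma card_window N (A : {set 'I_N}) (x rho : R) : 0 <= rho ->
  (forall k, k \in A -> `|(k : nat)%:R - x| <= rho) -> #|A|%:R <= 2 * rho + 1.
Proof.
move=> rho0 Arho.
have [->|/set0Pn[k0 k0A]] := eqVneq A finset.set0.
  by rewrite cards0; lra.
case: (arg_minnP (fun k : 'I_N => k : nat) k0A) => m mA mmin.
case: (arg_maxnP (fun k : 'I_N => k : nat) k0A) => M MA Mmax.
have mM : (m <= M)%N by exact: Mmax.
have cA : (#|A| <= M - m + 1)%N.
  rewrite cardE -(size_map val) -[X in (_ <= X)%N](size_iota m).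
  apply: uniq_leq_size; first by rewrite map_inj_uniq ?enum_uniq//; exact: val_inj.
  move=> _ /mapP[k kA ->]; rewrite mem_enum in kA; rewrite mem_iota.
  by have := mmin _ kA; have := Mmax _ kA; rewrite /=; lia.
apply: (@le_trans _ _ ((M - m + 1)%N%:R)); first by rewrite ler_nat.
rewrite natrD natrB//.
have := Arho _ mA; have := Arho _ MA; rewrite !ler_norml.
by move=> /andP[? ?] /andP[? ?]; lra.
Qed.

Lemma avg_card (n : nat) (f : nat -> R) :
  avg (fun r : {ffun 'I_n -> bool} => f (\sum_i r i)%N) =
  (\sum_(k < n.+1) ('C(n, k))%:R * f k) / 2 ^+ n.
Proof.
rewrite /avg card_ffun card_bool card_ord natrX; congr (_ / _).
have sn (r : {ffun 'I_n -> bool}) : (\sum_i r i < n.+1)%N.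
  rewrite ltnS -[leqRHS]card_ord -sum1_card leq_sum// => i _; exact: leq_b1.
rewrite (partition_big (fun r => Ordinal (sn r)) xpredT)//=.
apply: eq_bigr => k _.
rewrite (eq_bigr (fun=> f k)); last by move=> r /eqP/(congr1 val)/= ->.
rewrite sumr_const mulr_natl; congr (_ *+ _).
have -> : 'C(n, k) = #|[set A : {set 'I_n} | #|A| == k]%SET|.
  by rewrite card_draws card_ord.
pose h (A : {set 'I_n}) : {ffun 'I_n -> bool} := [ffun i => i \in A].
have hE A : (\sum_i h A i = #|A|)%N.
  by rewrite -sum1_card [RHS]big_mkcond/=; apply: eq_bigr => i _; rewrite ffunE; case: ifP.
have hinj : injective h.
  by move=> A B /ffunP AB; apply/setP => i; have := AB i; rewrite !ffunE.
rewrite -(card_imset _ hinj); apply: eq_card => r; rewrite unfold_in.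
apply/idP/idP.
- move=> /eqnP /= rk; apply/imsetP; exists [set i | r i]%SET.
    rewrite inE -hE -rk; apply/eqP/eq_bigr => i _; by rewrite ffunE inE.
  by apply/ffunP => i; rewrite ffunE inE.
- by move=> /imsetP[A]; rewrite inE => /eqP Ak ->; apply/eqnP; rewrite /= hE.
Qed.

(** The sum is an affine function of the number k of plus signs. The window contains at most h sqrt
    n / |a| + 1 values of k, each of probability at most 1 / sqrt n. *)
Lemma binomial_concentration (n : nat) (a c h : R) : a != 0 -> 0 <= h ->
  (0 < n)%N ->
  avg (fun r : {ffun 'I_n -> bool} =>
    ind (`|\sum_i signed (r i) (a / Num.sqrt n%:R) - c| <= h)) <=
  h / `|a| + (Num.sqrt n%:R)^-1.
Proof.
move=> a0 h0 n0.
have sn : 0 < Num.sqrt n%:R :> R by rewrite sqrtr_gt0 ltr0n.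
have sn2 : Num.sqrt n%:R ^+ 2 = n%:R :> R by rewrite sqr_sqrtr.
have pa : 0 < `|a| by rewrite normr_gt0.
pose s : R := Num.sqrt n%:R.
(* Centre and radius of the window on the scale of k. *)
pose x := (c * s / a + n%:R) / 2; pose rho := h * s / `|a| / 2.
have rho0 : 0 <= rho by rewrite /rho !mulr_ge0 ?invr_ge0 ?(ltW pa) ?(ltW sn).
pose f (k : nat) : R := ind (`|k%:R - x| <= rho).
have -> : (fun r : {ffun 'I_n -> bool} =>
    ind (`|\sum_i signed (r i) (a / Num.sqrt n%:R) - c| <= h)) =
    (fun r => f (\sum_i r i)%N) :> (_ -> R).
  apply/funext => r; rewrite /f; congr ind.
  have -> : \sum_i signed (r i) (a / Num.sqrt n%:R) =
      a / s * (2 * (\sum_i r i)%N%:R - n%:R).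
    have {2}-> : n%:R = \sum_(i < n) 1 :> R by rewrite sumr_const card_ord.
    rewrite natr_sum mulr_sumr -sumrB mulr_sumr; apply: eq_bigr => i _.
    by rewrite /signed /s; case: (r i) => /=; ring.
  have -> : a / s * (2 * (\sum_i r i)%N%:R - n%:R) - c =
      2 * a / s * ((\sum_i r i)%N%:R - x).
    rewrite /x; field; rewrite a0/=; exact: lt0r_neq0.
  rewrite !normrM normrV ?unitfE ?lt0r_neq0// (gtr0_norm sn) ger0_norm//.
  rewrite -ler_pdivlMl; last by rewrite !mulr_gt0 ?invr_gt0.
  congr (_ <= _); rewrite /rho /s; field; rewrite !lt0r_neq0//.
rewrite avg_card.
have B k : ('C(n, k))%:R <= 2 ^+ n / s :> R.
  rewrite ler_pdivlMr// -(ler_pXn2r (n := 2))//; last 2 first.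
  - by rewrite nnegrE mulr_ge0// ltW.
  - by rewrite nnegrE exprn_ge0.
  rewrite exprMn sn2 -!natrX -natrM ler_nat.
  by have := bin_bound n k; rewrite (_ : 4 = 2 ^ 2)%N// -!expnM [(2 * n)%N]mulnC.
apply: (@le_trans _ _ ((\sum_(k < n.+1) 2 ^+ n / s * f k) / 2 ^+ n)).
  rewrite ler_wpM2r ?invr_ge0 ?exprn_ge0//; apply: ler_sum => k _.
  by rewrite ler_wpM2r ?B// ler0n.
rewrite -mulr_sumr.
have -> : \sum_(k < n.+1) f k = #|[set k : 'I_n.+1 | `|(k : nat)%:R - x| <= rho]%SET|%:R.
  rewrite -sum1_card natr_sum [RHS]big_mkcond/=; apply: eq_bigr => k _.
  by rewrite inE /f; case: (_ <= _).
have := @card_window n.+1 [set k : 'I_n.+1 | `|(k : nat)%:R - x| <= rho]%SET x rho rho0.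
have WA k : k \in [set k : 'I_n.+1 | `|(k : nat)%:R - x| <= rho]%SET ->
  `|(k : nat)%:R - x| <= rho by rewrite inE.
move=> /(_ WA) W; rewrite -!mulrA mulrC -!mulrA mulVf ?mulr1; last by rewrite expf_neq0.
apply: (@le_trans _ _ (s^-1 * (2 * rho + 1))); first by rewrite ler_wpM2l// invr_ge0 ltW.
rewrite le_eqVlt; apply/orP; left; apply/eqP.
rewrite /rho /s; field; by rewrite !lt0r_neq0.
Qed.

End card_window.

Section radsum_concentration.
Context {R : realType} {Gam : finType}.

(** The involution of [avg_resample], exchanging the whole block g of s with r instead of one
    entry. *)
Lemma avg_resample_block (I T : finType) (g : Gam)
    (F : {ffun Gam * I -> T} -> R) :
  avg F = avg (fun s : {ffun Gam * I -> T} => avg (fun r : {ffun I -> T} =>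
    F [ffun p => if p.1 == g then r p.2 else s p])).
Proof.
pose blk (s : {ffun Gam * I -> T}) (r : {ffun I -> T}) : {ffun Gam * I -> T} :=
  [ffun p => if p.1 == g then r p.2 else s p].
pose phi (p : {ffun Gam * I -> T} * {ffun I -> T}) :=
  (blk p.1 p.2, [ffun i => p.1 (g, i)]).
have phiK : involutive phi.
  move=> [s r]; rewrite /phi/=; congr (_, _); apply/ffunP.
    by move=> [p i]; rewrite !ffunE; case: eqP => //= ->.
  by move=> i; rewrite !ffunE/= eqxx.
have [D0|Dpos] := posnP #|{ffun I -> T}|.
  have [s0 _|D0'] := pickP {ffun Gam * I -> T}.
    have : (0 < #|{ffun I -> T}|)%N.
      by apply/card_gt0P; exists [ffun i => s0 (g, i)].
    by rewrite D0.
  by rewrite /avg !big_pred0// !mul0r.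
rewrite /avg; congr (_ / _); rewrite -mulr_suml pair_big/=.
rewrite (reindex phi)/=; last exact/onW_bij/inv_bij.
apply: (canRL (mulfK _)); first by rewrite pnatr_eq0 -lt0n.
transitivity (\sum_s \sum_(r : {ffun I -> T}) F s).
  by rewrite mulr_suml; apply: eq_bigr => s _; rewrite sumr_const mulr_natr.
rewrite pair_big/=; apply: eq_bigr => -[s r] _ /=; congr F.
exact: (esym (congr1 fst (phiK (s, r)))).
Qed.

Lemma sum_radsum (O : finType) (grp : O -> Gam) (tau : O -> R) (A : Gam -> R) s :
  \sum_g A g * radsum grp tau s g =
  \sum_o A (grp o) * signed (s o) (tau o).
Proof.
under eq_bigr do rewrite /radsum fct_sumE mulr_sumr.
rewrite exchange_big; apply: eq_bigr => o _ /=.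
rewrite (bigD1 (grp o))//= /pt eqxx big1 ?addr0// => g /negPf ->.
by rewrite mulr0.
Qed.

(** The signs outside group g are frozen and shift the centre c by [rest]; what remains is a sum of
    n equal terms with random signs. *)
Lemma radsum_concentration n (A sig : Gam -> R) g (c h : R) :
  A g * sig g != 0 -> 0 <= h -> (0 < n)%N ->
  avg (fun s : {ffun Gam * 'I_n -> bool} => ind (`|\sum_g A g *
    radsum fst (fun o => sig o.1 / Num.sqrt n%:R) s g - c| <= h)) <=
  h / `|A g * sig g| + (Num.sqrt n%:R)^-1.
Proof.
move=> a0 h0 n0; rewrite (avg_resample_block g).
rewrite -[leRHS](avg_cst ([ffun=> true] : {ffun Gam * 'I_n -> bool})).
apply: avg_le => s.
pose rest := \sum_(o : Gam * 'I_n | o.1 != g)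
  A o.1 * signed (s o) (sig o.1 / Num.sqrt n%:R).
apply: le_trans (binomial_concentration (c - rest) a0 h0 n0).
apply: avg_le => r; rewrite sum_radsum (bigID (fun o : Gam * 'I_n => o.1 == g))/=.
rewrite le_eqVlt; apply/orP; left; apply/eqP; congr (ind (`|_| <= _)).
rewrite opprB [_ + (rest - c)]addrA; congr (_ + _ - _).
- transitivity (\sum_(p | p == g) \sum_(i < n)
    A p * signed (r i) (sig p / Num.sqrt n%:R)).
    rewrite pair_big/=; apply: eq_big => [[p i]|[p i] /= /eqP og].
      by rewrite andbT.
    by rewrite ffunE/= og eqxx.
  rewrite big_pred1_eq; apply: eq_bigr => i _.
  by rewrite /signed; case: (r i); ring.
- by apply: eq_bigr => o /negPf og; rewrite ffunE og.
Qed.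

End radsum_concentration.

(** * Comparison with Rademacher sums, from smooth functions to distribution functions *)

Section lindeberg_rademacher.
Context {R : realType} {Gam O : finType} {Om : Type}.
Variables (E : expectation R Om) (grp : O -> Gam) (xi : O -> Om -> R)
  (tau : O -> R) (psi : (Gam -> R) -> R) (C : R).

Hypothesis smooth_psi : smooth C psi.
Hypothesis dom_gsum : forall os a, dom E (fun w => psi (gsum grp xi os w + a)).
Hypothesis dom_pt : forall o a, dom E (fun w => psi (a + pt (grp o) (xi o w))).
Hypothesis dom_indep : forall o os a, o \notin os ->
  dom E (fun w => ev E (fun w' => psi (gsum grp xi os w + a + pt (grp o) (xi o w')))).
Hypothesis ev_indep : forall o os a, o \notin os ->
  ev E (fun w => psi (gsum grp xi os w + a + pt (grp o) (xi o w))) =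
  ev E (fun w => ev E (fun w' => psi (gsum grp xi os w + a + pt (grp o) (xi o w')))).
Hypothesis dom_xi : forall o, dom E (xi o).
Hypothesis dom_xi2 : forall o, dom E (fun w => xi o w ^+ 2).
Hypothesis dom_xi3 : forall o, dom E (fun w => trunc3 (xi o w)).
Hypothesis ev_xi : forall o, ev E (xi o) = 0.

Lemma lindeberg_rademacher :
  `|ev E (fun w => psi (gsum grp xi (index_enum O) w)) -
    avg (fun s => psi (radsum grp tau s))| <=
  \sum_o (4 * C * (ev E (fun w => trunc3 (xi o w)) + `|tau o| ^+ 3) +
          C * `|ev E (fun w => xi o w ^+ 2) - tau o ^+ 2|).
Proof.
rewrite -radopE.
under eq_ev do rewrite -[gsum _ _ _ _]addr0.
apply: (lindeberg_replacement dom_gsum dom_indep ev_indep _ 0 (index_enum_uniq O)).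
move=> o u; apply: (@jet2_ev R Om E (xi o) (fun x => psi (u + pt (grp o) x))) => //.
Qed.

End lindeberg_rademacher.

Section kolmogorov.
Context {R : realType} {D Gam : finType}.
Variables (J : pred D) (A : D -> Gam -> R) (sig : Gam -> R) (n : nat).

Definition rad (s : {ffun Gam * 'I_n -> bool}) : Gam -> R :=
  radsum fst (fun o => sig o.1 / Num.sqrt n%:R) s.

Definition lin (u : Gam -> R) (j : D) : R := \sum_g A j g * u g.

Definition below (x t : D -> R) : bool := [forall j, J j ==> (x j <= t j)].

(** The distribution function of the reference law, for the coordinates in J: later [predT] for the
    joint law and [pred1 j] for a single component. *)
Definition radcdf (t : D -> R) : R := avg (fun s => ind (below (lin (rad s)) t)).

Lemma ind_ge0 b : 0 <= ind b :> R. Proof. exact: ler0n. Qed.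

Lemma ind_le1 b : ind b <= 1 :> R. Proof. by case: b. Qed.

Lemma ind_le (b b' : bool) : (b -> b') -> ind b <= ind b' :> R.
Proof. by rewrite /ind ler_nat; case: b => // ->. Qed.

Lemma belowP x t : reflect (forall j, J j -> x j <= t j) (below x t).
Proof.
apply: (iffP forallP) => h j; last by apply/implyP; exact: h.
by move=> Jj; have := h j; rewrite Jj.
Qed.

Variable c0 : R.
Hypothesis c0_gt0 : 0 < c0.
Hypothesis c0P : forall j, J j -> exists g, c0 <= `|A j g * sig g|.
Hypothesis n_gt0 : (0 < n)%N.

Definition window (h : R) : R := #|D|%:R * (h / c0 + (Num.sqrt n%:R)^-1).

(** A point below t' but not below t has a coordinate in J exceeding t_j by at most h.
    Anti-concentration bounds this for each j, and the factor #|D| of [window] is the union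
    bound. *)
Lemma radcdf_window (t t' : D -> R) (h : R) : 0 <= h -> (forall j, t' j <= t j + h) ->
  radcdf t' <= radcdf t + window h.
Proof.
move=> h0 tt'.
pose hit j s : R := ind (J j && (`|lin (rad s) j - t j| <= h)).
apply: (@le_trans _ _ (avg (fun s => 1 * ind (below (lin (rad s)) t) + \sum_j hit j s))).
  apply: avg_le => s; rewrite mul1r.
  have [b|nb] := boolP (below (lin (rad s)) t).
    by rewrite (le_trans (ind_le1 _))// lerDl sumr_ge0// => j _; exact: ind_ge0.
  rewrite add0r; case: belowP => [b|_]; last by apply: sumr_ge0 => *; exact: ind_ge0.
  have [j /andP[Jj tj]] : exists j, J j && (t j < lin (rad s) j).
    apply/existsP; apply: contraR nb => /existsPn nb; apply/belowP => j Jj.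
    by have := nb j; rewrite Jj/= -leNgt.
  rewrite (bigD1 j)//= -[leLHS]addr0 lerD//; last by apply: sumr_ge0 => *; exact: ind_ge0.
  rewrite /hit Jj/= ger0_norm; last by rewrite subr_ge0 ltW.
  by apply: ind_le => _; rewrite lerBlDl; exact: le_trans (b _ Jj) (tt' j).
rewrite avg_lin mul1r lerD2l.
have /= -> := @ev_sum _ _ (uniform [ffun=> true]) D (index_enum D) hit (fun _ => I).
apply: (@le_trans _ _ (\sum_(j : D) (h / c0 + (Num.sqrt n%:R)^-1))); last first.
  by rewrite sumr_const /window mulr_natl.
apply: ler_sum => j _ /=; rewrite /hit.
have w0 : 0 <= h / c0 + (Num.sqrt n%:R)^-1.
  by rewrite addr_ge0 ?invr_ge0// divr_ge0// ltW.
case: (boolP (J j)) => Jj /=; last by rewrite (avg_cst [ffun=> true]).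
have [g cg] := c0P Jj.
have a0 : 0 < `|A j g * sig g| := lt_le_trans c0_gt0 cg.
have := radsum_concentration (t j) (g := g) (A := A j) (sig := sig) _ h0 n_gt0.
rewrite -normr_gt0 => /(_ a0) /le_trans; apply.
by rewrite lerD2r ler_wpM2l// lef_pV2.
Qed.

Lemma orthant_le_below (s : R) t u : 0 < s ->
  orthant J A s t u <= ind (below (lin u) t).
Proof.
move=> s0; case: belowP => [_|H].
  apply: prodr_ile1 => j _; exact: spline_itv.
have [j /andP[Jj tj]] : exists j, J j && (t j < lin u j).
  apply: contrapT => nb; apply: H => j Jj; rewrite leNgt; apply/negP => tj.
  by apply: nb; exists j; rewrite Jj.
rewrite /orthant (bigD1 j)//= spline_eq0 ?mul0r//.
by rewrite pmulr_rle0// subr_le0 ltW.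
Qed.

(** Since [spline] rises from 0 to 1 on [0, 3], the scale 3 / h places the whole transition within a
    margin h below the threshold. *)
Lemma orthant_ge_below (h : R) t u : 0 < h ->
  ind (below (lin u) (fun j => t j - h)) <= orthant J A (3 / h) t u.
Proof.
move=> h0; case: belowP => [H|_]; last first.
  by apply: prodr_ge0 => j _; exact: spline_ge0.
rewrite /orthant big1// => j Jj; rewrite spline_eq1//.
rewrite mulrAC ler_pdivlMr// ler_wpM2l//.
by rewrite lerBrDl -lerBrDr; exact: H.
Qed.

(* [bad] dominates the indicator of the event that T is far from its
   linearisation. *)
Lemma kolmogorov_bound Om (E : expectation R Om) (U : Om -> Gam -> R)
    (T : Om -> D -> R) (bad : Om -> R) (h del : R) : 0 < h ->
  dom E bad -> (forall w, 0 <= bad w) ->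
  (forall w, bad w < 1 -> forall j, J j -> `|T w j - lin (U w) j| <= h) ->
  (forall t, dom E (fun w => orthant J A (3 / h) t (U w))) ->
  (forall t, dom E (fun w => ind (below (T w) t))) ->
  (forall t, `|ev E (fun w => orthant J A (3 / h) t (U w)) -
               avg (fun s => orthant J A (3 / h) t (rad s))| <= del) ->
  forall t, `|ev E (fun w => ind (below (T w) t)) - radcdf t| <=
            ev E bad + del + window (2 * h).
Proof.
move=> h0 Db b0 bT DU DT close t.
have s0 : 0 < 3 / h by rewrite divr_gt0.
have hh : 0 <= 2 * h by lra.
(* In [tp] one h pays for the linearisation and one for the smoothing. In [tm] only the
   linearisation is paid, because [orthant] vanishes above its threshold; the smoothing is then paid
   on the reference side, in [rlo]. *)
pose tp j := t j + 2 * h; pose tm j := t j - h.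
have up : ev E (fun w => ind (below (T w) t)) <=
    ev E bad + ev E (fun w => orthant J A (3 / h) tp (U w)).
  rewrite -evD//; apply: ev_le => //; first exact: domD.
  move=> w; have [b1|b1] := leP 1 (bad w).
    rewrite (le_trans (ind_le1 _))// (le_trans b1)// lerDl.
    by apply: prodr_ge0 => j _; exact: spline_ge0.
  apply: (@le_trans _ _ (orthant J A (3 / h) tp (U w))); last by rewrite lerDr.
  apply: le_trans (orthant_ge_below _ _ h0); apply: ind_le => /belowP Tt.
  apply/belowP => j Jj; have := bT _ b1 j Jj; have := Tt j Jj.
  by rewrite ler_norml /tp => ? /andP[? ?]; lra.
have lo : ev E (fun w => orthant J A (3 / h) tm (U w)) <=
    ev E bad + ev E (fun w => ind (below (T w) t)).
  rewrite -evD//; apply: ev_le => //; first exact: domD.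
  move=> w; have [b1|b1] := leP 1 (bad w).
    rewrite (le_trans (orthant_le_below _ _ s0))// (le_trans (ind_le1 _))//.
    by rewrite (le_trans b1)// lerDl ind_ge0.
  apply: (@le_trans _ _ (ind (below (T w) t))); last by rewrite lerDr.
  apply: le_trans (orthant_le_below _ _ s0) _; apply: ind_le => /belowP Tt.
  apply/belowP => j Jj; have := bT _ b1 j Jj; have := Tt j Jj.
  by rewrite ler_norml /tm => ? /andP[? ?]; lra.
have rup : avg (fun s => orthant J A (3 / h) tp (rad s)) <= radcdf t + window (2 * h).
  apply: le_trans (radcdf_window hh (fun j => lexx _)).
  by apply: avg_le => s; exact: orthant_le_below.
have rlo : radcdf t <= avg (fun s => orthant J A (3 / h) tm (rad s)) + window (2 * h).
  apply: (@le_trans _ _ (radcdf (fun j => t j - 2 * h) + window (2 * h))).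
    by apply: radcdf_window => // j; lra.
  rewrite lerD2r; apply: avg_le => s.
  apply: le_trans (orthant_ge_below _ _ h0); apply: ind_le => /belowP H.
  by apply/belowP => j Jj; apply: le_trans (H j Jj) _; rewrite /tm; lra.
have := close tp; have := close tm.
rewrite !ler_norml => /andP[? ?] /andP[? ?]; apply/andP; split; lra.
Qed.

End kolmogorov.

(** * Perturbation of weighted least squares *)

Section entrywise_limits.
Context {R : realType} {T : Type} (F : set_system T) {FF : Filter F}.

Definition mxcvg p q (M_ : T -> 'M[R]_(p, q)) (M : 'M[R]_(p, q)) :=
  forall i j, M_ x i j @[x --> F] --> M i j.

Lemma cvg_sum_fin (I : Type) (r : seq I) (P : pred I) (f : I -> T -> R)
    (l : I -> R) :
  (forall i, f i x @[x --> F] --> l i) ->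
  \sum_(i <- r | P i) f i x @[x --> F] --> \sum_(i <- r | P i) l i.
Proof. by move=> fl; apply: cvg_big => //; exact: add_continuous. Qed.

Lemma cvg_prod_fin (I : Type) (r : seq I) (P : pred I) (f : I -> T -> R)
    (l : I -> R) :
  (forall i, f i x @[x --> F] --> l i) ->
  \prod_(i <- r | P i) f i x @[x --> F] --> \prod_(i <- r | P i) l i.
Proof. by move=> fl; apply: cvg_big => //; exact: mul_continuous. Qed.

Lemma near_forall2 p q (f : 'I_p -> 'I_q -> T -> Prop) :
  (forall i j, \forall x \near F, f i j x) ->
  \forall x \near F, forall i j, f i j x.
Proof.
move=> Ff; apply: (@filter_forall _ _ (fun i x => forall j, f i j x)) => i.
exact: (@filter_forall _ _ (fun j x => f i j x)).
Qed.

Lemma mxcvg_cst p q (M : 'M[R]_(p, q)) : mxcvg (fun=> M) M.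
Proof. by move=> i j; exact: cvg_cst. Qed.

Lemma mxcvg_mul p q r (M_ : T -> 'M[R]_(p, q)) M (N_ : T -> 'M[R]_(q, r)) N :
  mxcvg M_ M -> mxcvg N_ N -> mxcvg (fun x => M_ x *m N_ x) (M *m N).
Proof.
move=> MM NN i j; rewrite mxE; under eq_cvg do rewrite mxE.
by apply: cvg_sum_fin => k; apply: cvgM; [exact: MM|exact: NN].
Qed.

Lemma mxcvg_tr p q (M_ : T -> 'M[R]_(p, q)) M :
  mxcvg M_ M -> mxcvg (fun x => (M_ x)^T) M^T.
Proof. by move=> MM i j; rewrite mxE; under eq_cvg do rewrite mxE; exact: MM. Qed.

Lemma cvg_det p (M_ : T -> 'M[R]_p) M :
  mxcvg M_ M -> \det (M_ x) @[x --> F] --> \det M.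
Proof.
move=> MM; apply: cvg_sum_fin => s; apply: cvgM; first exact: cvg_cst.
by apply: cvg_prod_fin => i; exact: MM.
Qed.

Lemma mxcvg_adj p (M_ : T -> 'M[R]_p) M :
  mxcvg M_ M -> mxcvg (fun x => \adj (M_ x)) (\adj M).
Proof.
move=> MM i j; rewrite mxE; under eq_cvg do rewrite mxE.
apply: cvgM; first exact: cvg_cst.
by apply: cvg_det => k l; rewrite !mxE; under eq_cvg do rewrite !mxE; exact: MM.
Qed.

Lemma near_unitmx p (M_ : T -> 'M[R]_p) M : M \in unitmx ->
  mxcvg M_ M -> \forall x \near F, M_ x \in unitmx.
Proof.
rewrite unitmxE unitfE => M0 MM; have := cvg_det MM.
move=> /cvgr_neq0 /(_ M0); apply: filterS => x.
by rewrite unitmxE unitfE.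
Qed.

(** Cramer's rule: determinants and cofactors are polynomials in the entries. [invmx] follows this
    rule on invertible matrices only, hence the detour through eventual equality. *)
Lemma mxcvg_inv p (M_ : T -> 'M[R]_p) M : M \in unitmx ->
  mxcvg M_ M -> mxcvg (fun x => invmx (M_ x)) (invmx M).
Proof.
move=> uM MM i j.
have : (\det (M_ x))^-1 * \adj (M_ x) i j @[x --> F] --> (\det M)^-1 * \adj M i j.
  apply: cvgM; last exact: mxcvg_adj.
  by apply: cvgV; [by rewrite -unitfE -unitmxE|exact: cvg_det].
have -> : invmx M i j = (\det M)^-1 * \adj M i j by rewrite /invmx uM [LHS]mxE.
apply: cvg_trans; apply: near_eq_cvg.
by apply: filterS (near_unitmx uM MM) => x ux; rewrite /invmx ux [RHS]mxE.
Qed.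

End entrywise_limits.

Section gram.
Context {R : realType} {K d : nat} (w : 'rV[R]_K).
Hypothesis w_pos : forall k, 0 < w 0 k.

Definition gram (M : 'M[R]_(K, 1 + d)) := M^T *m diag_mx w *m M.

(** If v G = 0, then v G v^T, which is the sum of the w_k (v M^T)_k^2, vanishes. Positive weights
    force v M^T = 0, and full rank gives v = 0. *)
Lemma gram_unit M : \rank M = (1 + d)%N -> gram M \in unitmx.
Proof.
move=> rM; rewrite -row_free_unit -kermx_eq0; apply/rowV0P => v.
move=> /sub_kermxP vG.
have fM : row_free M^T by rewrite /row_free mxrank_tr rM.
suff : v *m M^T = 0 by move/eqP; rewrite mulmx_free_eq0// => /eqP.
set u := v *m M^T.
have s0 : \sum_k w 0 k * u 0 k ^+ 2 = 0.
  have : (v *m gram M *m v^T) 0 0 = 0 by rewrite vG mul0mx mxE.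
  have -> : v *m gram M *m v^T = u *m diag_mx w *m u^T.
    by rewrite /u trmx_mul trmxK !mulmxA.
  rewrite mxE => e; rewrite -[RHS]e; apply: eq_bigr => k _.
  by rewrite mul_mx_diag !mxE; ring.
apply/rowP => k; rewrite [RHS]mxE.
move/eqP: s0; rewrite psumr_eq0; last first.
  by move=> i _; rewrite mulr_ge0 ?sqr_ge0// ltW.
move=> /allP /(_ k (mem_index_enum k)) /=.
by rewrite mulf_eq0 gt_eqF//= sqrf_eq0 => /eqP.
Qed.

(** [moment_estimate] constrains the estimator through the rank, while perturbation arguments
    control the Gram matrix; this is the passage between them. *)
Lemma rank_gram M : gram M \in unitmx -> \rank M = (1 + d)%N.
Proof.
move=> uG; apply/eqP; rewrite eqn_leq rank_leq_col/=.
by rewrite -{1}(mxrank_unit uG) mxrankM_maxr.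
Qed.

Lemma wlsK M : gram M \in unitmx -> wls w M *m M = 1%:M.
Proof. by move=> uG; rewrite /wls -!mulmxA [_^T *m _]mulmxA mulVmx. Qed.

Lemma normal_equations M (y : 'cV[R]_K) : gram M \in unitmx ->
  M^T *m diag_mx w *m (y - M *m (wls w M *m y)) = 0.
Proof.
move=> uG; rewrite mulmxBr /wls !mulmxA -/(gram M).
by rewrite mulmxV// mul1mx subrr.
Qed.

End gram.

Section perturbation.
Context {R : realType} {K d : nat} (w : 'rV[R]_K) (m : 'M[R]_(K, d)).
Hypothesis w_pos : forall k, 0 < w 0 k.
Hypothesis full_rank : \rank (design m) = (1 + d)%N.

Definition mxle p q (M : 'M[R]_(p, q)) (c : R) := forall i j, `|M i j| <= c.

Lemma mxleM p q r (M : 'M[R]_(p, q)) (N : 'M[R]_(q, r)) a b :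
  mxle M a -> mxle N b -> mxle (M *m N) (q%:R * (a * b)).
Proof.
move=> Ma Nb i j; rewrite mxE; apply: le_trans (ler_norm_sum _ _ _) _.
apply: (@le_trans _ _ (\sum_(k < q) a * b)); last first.
  by rewrite sumr_const card_ord mulr_natl.
by apply: ler_sum => k _; rewrite normrM ler_pM.
Qed.

Lemma mxleD p q (M N : 'M[R]_(p, q)) a b :
  mxle M a -> mxle N b -> mxle (M + N) (a + b).
Proof.
move=> Ma Nb i j; rewrite mxE; apply: le_trans (ler_normD _ _) _.
exact: lerD.
Qed.

Lemma mxleN p q (M : 'M[R]_(p, q)) a : mxle M a -> mxle (- M) a.
Proof. by move=> Ma i j; rewrite mxE normrN. Qed.

Lemma mxle_ex p q (M : 'M[R]_(p, q)) : exists2 b, 0 <= b & mxle M b.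
Proof.
exists (\sum_i \sum_j `|M i j|); first by apply: sumr_ge0 => *; apply: sumr_ge0.
move=> i j; rewrite (bigD1 i)//= (bigD1 j)//= -addrA lerDl.
by apply: addr_ge0; [|apply: sumr_ge0 => *]; apply: sumr_ge0.
Qed.

(** An epsilon-delta form of continuity, since it will be applied draw by draw, with no filter along
    which m' tends to m. *)
Lemma wls_continuous (e : R) : 0 < e -> exists2 b, 0 <= b & exists2 eta, 0 < eta &
  forall m' : 'M[R]_(K, d), mxle (m' - m) eta ->
    [/\ gram w (design m') \in unitmx, mxle (wls w (design m') - wls w (design m)) e
      & mxle (invmx (gram w (design m'))) b].
Proof.
move=> e0.
have uG := gram_unit w_pos full_rank.
have [b b0 Gb] := mxle_ex (invmx (gram w (design m))).
have des : mxcvg (nbhs m) (fun x => design x) (design m).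
  move=> i j; rewrite /design; case: (split_ordP j) => j' ->.
    rewrite row_mxEl mxE; under eq_cvg do rewrite row_mxEl mxE.
    exact: cvg_cst.
  rewrite row_mxEr; under eq_cvg do rewrite row_mxEr.
  exact: coord_continuous.
have gr : mxcvg (nbhs m) (fun x => gram w (design x)) (gram w (design m)).
  apply: mxcvg_mul => //; apply: mxcvg_mul; last exact: mxcvg_cst.
  exact: mxcvg_tr.
have inv : mxcvg (nbhs m) (fun x => invmx (gram w (design x)))
    (invmx (gram w (design m))) by exact: mxcvg_inv.
have wl : mxcvg (nbhs m) (fun x => wls w (design x)) (wls w (design m)).
  apply: mxcvg_mul; last exact: mxcvg_cst.
  by apply: mxcvg_mul => //; apply: mxcvg_tr.
have n2 : \forall x \near m, forall i j,
    `|wls w (design m) i j - wls w (design x) i j| <= e.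
  apply: (@near_forall2 _ (nbhs m) (nbhs_filter m) _ _ (fun i j x =>
    `|wls w (design m) i j - wls w (design x) i j| <= e)) => i j.
  by have /cvgrPdist_le /(_ _ e0) := wl i j.
have n3 : \forall x \near m, forall i j,
    `|invmx (gram w (design m)) i j - invmx (gram w (design x)) i j| <= 1.
  apply: (@near_forall2 _ (nbhs m) (nbhs_filter m) _ _ (fun i j x =>
    `|invmx (gram w (design m)) i j - invmx (gram w (design x)) i j| <= 1)) => i j.
  by have /cvgrPdist_le /(_ _ ltr01) := inv i j.
have : \forall x \near m,
    [/\ gram w (design x) \in unitmx, mxle (wls w (design x) - wls w (design m)) e
      & mxle (invmx (gram w (design x))) (b + 1)].
  have n1 : \forall x \near m, gram w (design x) \in unitmx by exact: near_unitmx gr.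
  apply: filterS3 n1 n2 n3 => x u2 u3 u4; split => // i j.
    by rewrite [X in `|X|]mxE [X in _ + X]mxE distrC.
  rewrite -[X in `|X|](subrK (invmx (gram w (design m)) i j)).
  by apply: le_trans (ler_normD _ _) _; rewrite addrC lerD// distrC.
move=> /nbhs_ballP[r /= r0 rb]; exists (b + 1); first by rewrite addr_ge0.
exists (r / 2); first by rewrite divr_gt0.
move=> m' mm'; apply: rb; split => // i j.
rewrite /ball/= distrC; have := mm' i j; rewrite !mxE; lra.
Qed.

Variable beta : 'cV[R]_(1 + d).

Let A := wls w (design m).

(* b1 - b0 = wls M1 (y1 - M1 b0), and by the normal equations for b0 the residual
   y0 - M0 b0 only contributes through M1 - M0. *)
Lemma wls_perturbation (L h : R) : 0 <= L -> 0 < h -> exists2 eta, 0 < eta &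
  forall (s : R) (m0 m1 : 'M[R]_(K, d)) (y0 y1 : 'cV[R]_K)
    (b0 b1 : 'cV[R]_(1 + d)),
  mxle (m1 - m) eta -> mxle (b0 - beta) eta ->
  mxle (y0 - design m0 *m b0) eta ->
  (design m0)^T *m diag_mx w *m (y0 - design m0 *m b0) = 0 ->
  (\rank (design m1) = (1 + d)%N -> b1 = wls w (design m1) *m y1) ->
  mxle (s *: (y1 - y0)) L -> mxle (s *: (m1 - m0)) L ->
  mxle (s *: (b1 - b0) -
    A *m (s *: ((y1 - y0) - (design m1 - design m0) *m beta))) h.
Proof.
move=> L0 h0.
have [a a0 Aa] := mxle_ex A.
have [c c0 wc] := mxle_ex (diag_mx w).
have [e e0 eP] : exists2 b, 0 <= b & mxle beta b by exact: mxle_ex.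
pose L1 := L + (1 + d)%:R * (L * e).
have L10 : 0 <= L1 by rewrite addr_ge0// !mulr_ge0.
(* With this closeness of W1 to A, the first term of [key] is at most h / 3; [eta2] below makes the
   two others at most h / 3 together. *)
pose e1 := h / 3 / (K%:R * L1 + 1).
have p1 : 0 < K%:R * L1 + 1 by rewrite ltr_wpDl// mulr_ge0.
have e10 : 0 < e1 by rewrite !divr_gt0.
have [b b0 [eta1 eta10 etaP]] := wls_continuous e10.
pose L2 := K%:R * ((a + e1) * ((1 + d)%:R * L)).
have L20 : 0 <= L2 by rewrite !mulr_ge0// addr_ge0// ltW.
pose L3 := (1 + d)%:R * (b * (K%:R * (K%:R * (L * c)))).
have L30 : 0 <= L3 by rewrite !mulr_ge0.
pose eta2 := h / 3 / (L2 + L3 + 1).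
have p2 : 0 < L2 + L3 + 1 by rewrite ltr_wpDl// addr_ge0.
have eta20 : 0 < eta2 by rewrite !divr_gt0.
exists (Num.min eta1 eta2); first by rewrite lt_min eta10.
move=> s m0 m1 y0 y1 b0' b1 m1m b0b r0 ne b1E yL mL.
have mono p q (M : 'M[R]_(p, q)) x y : x <= y -> mxle M x -> mxle M y.
  by move=> xy Mx i j; exact: le_trans (Mx i j) xy.
have m1m' : mxle (m1 - m) eta1 by apply: mono m1m; rewrite ge_min lexx.
have bb' : mxle (b0' - beta) eta2 by apply: mono b0b; rewrite ge_min lexx orbT.
have r0' : mxle (y0 - design m0 *m b0') eta2.
  by apply: mono r0; rewrite ge_min lexx orbT.
have [uG wA iG] := etaP _ m1m'.
have {}b1E := b1E (rank_gram uG).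
set M0 := design m0 in ne r0' *; set M1 := design m1 in uG wA iG b1E *.
set W1 := wls w M1 in wA b1E *; set r := y0 - M0 *m b0' in ne r0' *.
have ML : mxle (s *: (M1 - M0)) L.
  move=> i j; rewrite /M1 /M0 /design opp_row_mx add_row_mx scale_row_mx.
  case: (split_ordP j) => j' ->; last by rewrite row_mxEr.
  by rewrite row_mxEl !mxE subrr mulr0 normr0.
have W1r : W1 *m r = invmx (gram w M1) *m ((M1 - M0)^T *m diag_mx w *m r).
  rewrite [(M1 - M0)^T](_ : _ = M1^T - M0^T); last by apply/matrixP => i j; rewrite !mxE.
  by rewrite !mulmxBl ne subr0 /W1 /wls !mulmxA.
(* Each term pairs a scaled increment, bounded through L, with a factor that is small by the choice
   of eta: W1 - A, b0 - beta, or the residual r. *)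
have key : s *: (b1 - b0') - A *m (s *: ((y1 - y0) - (M1 - M0) *m beta)) =
    (W1 - A) *m (s *: (y1 - y0) - s *: (M1 - M0) *m beta) +
    - (W1 *m (s *: (M1 - M0)) *m (b0' - beta)) +
    invmx (gram w M1) *m ((s *: (M1 - M0))^T *m diag_mx w *m r).
  have -> : (s *: (M1 - M0))^T = s *: (M1 - M0)^T by apply/matrixP => i j; rewrite !mxE.
  rewrite -!(scalemxAl, scalemxAr) -W1r -!scalerBr -!scalemxAr -!scalerBr -scalerDr.
  congr (s *: _).
  have -> : b1 - b0' = W1 *m (y1 - M1 *m b0').
    by rewrite mulmxBr mulmxA wlsK// mul1mx b1E.
  have -> : y1 - M1 *m b0' =
      (y1 - y0 - (M1 - M0) *m beta) - (M1 - M0) *m (b0' - beta) + r.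
    rewrite /r !mulmxBl !mulmxBr; apply/matrixP => i j; rewrite !mxE; ring.
  rewrite mulmxDr mulmxBr (mulmxBl W1 A) mulmxA.
  by rewrite addrAC [X in X + _]addrAC.
rewrite key.
have B1 : mxle ((W1 - A) *m (s *: (y1 - y0) - s *: (M1 - M0) *m beta)) (h / 3).
  apply: mono (mxleM wA (mxleD yL (mxleN (mxleM ML eP)))).
  rewrite mulrCA -/L1 mulrA mulrC -mulrA /e1 mulrC.
  rewrite -mulrA ler_piMr//; first by rewrite divr_ge0// ltW.
  by rewrite -mulrA mulrC ler_pdivrMr// mul1r; lra.
have W1a : mxle W1 (a + e1).
  by rewrite -[W1](subrKC A); apply: mxleD.
have B2 : mxle (- (W1 *m (s *: (M1 - M0)) *m (b0' - beta))) (L2 * eta2).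
  apply: mxleN; rewrite -mulmxA; apply: mono (mxleM W1a (mxleM ML bb')).
  by rewrite le_eqVlt /L2; apply/orP; left; apply/eqP; ring.
have B3 : mxle (invmx (gram w M1) *m ((s *: (M1 - M0))^T *m diag_mx w *m r)) (L3 * eta2).
  have MLt : mxle (s *: (M1 - M0))^T L by move=> i j; rewrite mxE; exact: ML.
  apply: mono (mxleM iG (mxleM (mxleM MLt wc) r0')).
  by rewrite le_eqVlt /L3; apply/orP; left; apply/eqP; ring.
apply: mono (mxleD (mxleD B1 B2) B3).
rewrite -addrA -mulrDl /eta2.
suff : (L2 + L3) * (h / 3 / (L2 + L3 + 1)) <= h / 3 by lra.
rewrite mulrCA ler_piMr//; first by rewrite divr_ge0// ltW.
by rewrite ler_pdivrMr// mul1r; lra.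
Qed.

End perturbation.

(** * Probability spaces as expectations *)

Section probability_expectation.
Context {R : realType} {d : measure_display} {T : measurableType d}.
Variable P : probability T R.
Implicit Types f g : T -> R.

Let Pdom (f : T -> R) : Prop := P.-integrable setT (EFin \o f).
Let Pev (f : T -> R) : R := \int[P]_w f w.

Let Pdom_cst c : Pdom (fun=> c).
Proof. exact: finite_measure_integrable_cst. Qed.

Let Pdom_lin a f g : Pdom f -> Pdom g -> Pdom (fun w => a * f w + g w).
Proof.
move=> Df Dg.
exact: (integrableD measurableT (@integrableZl _ _ _ P _ measurableT a _ Df) Dg).
Qed.

Let Pev_lin a f g : Pdom f -> Pdom g ->
  Pev (fun w => a * f w + g w) = a * Pev f + Pev g.
Proof.
move=> Df Dg; rewrite /Pev RintegralD// ?RintegralZl//.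
exact: (@integrableZl _ _ _ P _ measurableT a _ Df).
Qed.

Let Pev_le f g : Pdom f -> Pdom g -> (forall w, f w <= g w) -> Pev f <= Pev g.
Proof. by move=> Df Dg fg; apply: le_Rintegral. Qed.

Let Pev_cst1 : Pev (fun=> 1) = 1.
Proof.
rewrite /Pev Rintegral_cst// mul1r; transitivity (fine (1%E : \bar R)) => //.
by congr fine; exact: probability_setT.
Qed.

Definition PE : expectation R T :=
  Expectation Pdom_cst Pdom_lin Pev_lin Pev_le Pev_cst1.

Lemma PE_measurable f : dom PE f -> measurable_fun setT f.
Proof. by move=> /integrableP[/measurable_EFinP]. Qed.

Lemma PE_le f g : measurable_fun setT f -> dom PE g ->
  (forall w, `|f w| <= `|g w|) -> dom PE f.
Proof.
move=> mf Dg fg; apply: (le_integrable _ _ _ Dg) => //.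
  exact/measurable_EFinP.
by move=> w _; rewrite /= lee_fin.
Qed.

Lemma PE_bounded f c : measurable_fun setT f ->
  (forall w, `|f w| <= c) -> dom PE f.
Proof.
move=> mf fc; apply: (PE_le mf (dom_cst PE c)) => w.
by apply: le_trans (fc w) (ler_norm _).
Qed.

Lemma ind_indicE (b : T -> bool) : (fun w => ind (b w)) = \1_[set w | b w] :> (T -> R).
Proof.
apply/funext => w; rewrite indicE /ind; congr (_%:R).
congr nat_of_bool; by apply/idP/idP => [bw|]; rewrite inE.
Qed.

Lemma measurable_ind (b : T -> bool) : measurable [set w | b w] ->
  measurable_fun setT (fun w => ind (b w) : R).
Proof. by move=> mb; rewrite ind_indicE; exact: measurable_indic. Qed.

Lemma PE_ind_dom (b : T -> bool) : measurable [set w | b w] ->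
  dom PE (fun w => ind (b w)).
Proof.
move=> mb; apply: (@PE_bounded _ 1); first exact: measurable_ind.
by move=> w; rewrite ger0_norm ?ind_ge0// ind_le1.
Qed.

Lemma PE_ind (b : T -> bool) : measurable [set w | b w] ->
  ev PE (fun w => ind (b w)) = fine (P [set w | b w]).
Proof.
move=> mb; rewrite ind_indicE /= /Pev /Rintegral integral_indic ?setIT//.
Qed.

End probability_expectation.

Section independence.
Context {R : realType} {d : measure_display} {T : measurableType d}.
Variable P : probability T R.
Implicit Types f g : T -> R.

Definition rv_of d' (T' : measurableType d') (f : T -> T')
  (mf : measurable_fun setT f) : {mfun T >-> T'} :=
  MeasurableFun.Pack (MeasurableFun.Class (isMeasurableFun.Build _ _ _ _ _ mf)).

(** Independence on rectangles identifies the joint law with the product of the laws, and Fubini's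
    theorem there is transported back to T. X has values in an arbitrary measurable type because it
    will be the identity into a coarser sigma-algebra. *)
Lemma indep_fubini d1 d2 (T1 : measurableType d1) (T2 : measurableType d2)
    (X : T -> T1) (Y : T -> T2) (h : T1 * T2 -> R) :
  measurable_fun setT X -> measurable_fun setT Y ->
  (forall A B, measurable A -> measurable B ->
    P (X @^-1` A `&` Y @^-1` B) = (P (X @^-1` A) * P (Y @^-1` B))%E) ->
  measurable_fun setT h -> (exists c, forall p, `|h p| <= c) ->
  [/\ dom (PE P) (fun w => h (X w, Y w)),
      dom (PE P) (fun w => ev (PE P) (fun w' => h (X w, Y w'))) &
  ev (PE P) (fun w => h (X w, Y w)) =
  ev (PE P) (fun w => ev (PE P) (fun w' => h (X w, Y w')))].
Proof.
move=> mX mY XY mh [c hc].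
have mXY : measurable_fun setT (fun w => (X w, Y w)) by exact/measurable_fun_pairP.
pose LX : probability T1 R := distribution P (rv_of mX).
pose LY : probability T2 R := distribution P (rv_of mY).
pose LXY : probability (T1 * T2)%type R := distribution P (rv_of mXY).
have LE A : measurable A -> (LX \x LY)%E A = LXY A.
  by apply: product_measure_unique => B C mB mC; exact: XY.
have Dh : dom (PE P) (fun w => h (X w, Y w)).
  by apply: (@PE_bounded _ _ _ P _ c) => //; exact: measurableT_comp mh mXY.
have mEh : measurable_fun setT (EFin \o h) by exact/measurable_EFinP.
have ih : (LX \x LY)%E.-integrable setT (EFin \o h).
  apply/integrableP; split => //.
  apply: (@le_lt_trans _ _ (\int[(LX \x LY)]_x (c%:E))%E).
    by apply: ge0_le_integral => //; [exact: measurableT_comp|move=> x _; rewrite /= lee_fin].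
  rewrite [X in (X < _)%E](_ : _ = c%:E) ?ltry// integral_cst// -[RHS]mule1.
  by congr (_ * _)%E; apply: etrans (LE _ measurableT) _; exact: probability_setT.
have mhx x : measurable_fun setT (fun w => h (x, Y w)).
  have := measurableT_comp mh (measurable_pair1 x) => mh1.
  exact: measurableT_comp mh1 mY.
have inner x : (\int[LY]_y (h (x, y))%:E = \int[P]_w (h (x, Y w))%:E)%E.
  rewrite integral_distribution//.
    by apply/measurable_EFinP; exact: measurableT_comp mh (measurable_pair1 _).
  by apply: (@PE_bounded _ _ _ P _ c) => //; exact: mhx.
have outer_fin x : (\int[P]_w (h (x, Y w))%:E = (ev (PE P) (fun w => h (x, Y w)))%:E)%E.
  rewrite /= /Rintegral fineK//; apply: integrable_fin_num => //.
  by apply: (@PE_bounded _ _ _ P _ c) => //; exact: mhx.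
have iF := integrable_fubini_F ih.
have FE : fubini_F LY (EFin \o h) =
    (fun x => (ev (PE P) (fun w => h (x, Y w)))%:E).
  by apply/funext => x; rewrite /fubini_F/= inner outer_fin.
rewrite FE in iF.
have mF : measurable_fun setT (fun x => ev (PE P) (fun w => h (x, Y w))).
  by move/integrableP : iF => [/measurable_EFinP].
have Fc x : `|ev (PE P) (fun w => h (x, Y w))| <= c.
  have Dx : dom (PE P) (fun w => h (x, Y w)).
    by apply: (@PE_bounded _ _ _ P _ c) => //; exact: mhx.
  have := @ev_dist_le _ _ (PE P) _ (fun=> 0) (fun=> c) Dx (dom_cst _ _) (dom_cst _ _).
  by rewrite ev0 subr0 ev_cst; apply => w; rewrite subr0.
have DF : dom (PE P) (fun w => ev (PE P) (fun w' => h (X w, Y w'))).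
  by apply: (@PE_bounded _ _ _ P _ c) => //; exact: measurableT_comp mF mX.
split => //.
suff : (\int[P]_w (h (X w, Y w))%:E =
  \int[P]_w (ev (PE P) (fun w' => h (X w, Y w')))%:E)%E by move=> /(congr1 fine).
transitivity (\int[LXY]_p (h p)%:E)%E.
  by rewrite integral_distribution.
transitivity (\int[(LX \x LY)%E]_p (h p)%:E)%E.
  by apply: eq_measure_integral => A mA _; exact: (esym (LE A mA)).
rewrite -(integral12_prod_meas1 ih) FE.
by rewrite integral_distribution//; exact/measurable_EFinP.
Qed.

End independence.

Section second_moments.
Context {R : realType} {Om : Type} (E : expectation R Om).

Lemma ev_sqr_sum (I : eqType) (s : seq I) (x : I -> Om -> R) : uniq s ->
  (forall i j, dom E (fun w => x i w * x j w)) ->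
  {in s &, forall i j, i != j -> ev E (fun w => x i w * x j w) = 0} ->
  dom E (fun w => (\sum_(i <- s) x i w) ^+ 2) /\
  ev E (fun w => (\sum_(i <- s) x i w) ^+ 2) =
  \sum_(i <- s) ev E (fun w => x i w ^+ 2).
Proof.
move=> us Dx x0.
have -> : (fun w => (\sum_(i <- s) x i w) ^+ 2) =
    (fun w => \sum_(i <- s) \sum_(j <- s) x i w * x j w).
  by apply/funext => w; rewrite expr2 mulr_suml; under eq_bigr do rewrite mulr_sumr.
split; first by apply: dom_sum => i; apply: dom_sum => j; exact: Dx.
rewrite ev_sum; last by move=> i; apply: dom_sum => j; exact: Dx.
apply: eq_big_seq => i si; rewrite ev_sum//.
rewrite (bigD1_seq i)//= big_seq_cond big1 ?addr0.
  by apply: eq_ev => w; rewrite expr2.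
by move=> j /andP[sj ji]; rewrite x0// eq_sym.
Qed.

Lemma ev_chebyshev (x : Om -> R) (L : R) : 0 < L ->
  dom E (fun w => x w ^+ 2) -> dom E (fun w => ind (L <= `|x w|)) ->
  ev E (fun w => ind (L <= `|x w|)) <= ev E (fun w => x w ^+ 2) / L ^+ 2.
Proof.
move=> L0 Dx Dh; have L2 : 0 < L ^+ 2 by rewrite exprn_gt0.
rewrite ler_pdivlMr// mulrC -evZ//; apply: ev_le => //; first exact: domZ.
move=> w; case: (leP L `|x w|) => Lx; last by rewrite mulr0 sqr_ge0.
rewrite mulr1 -[leRHS]ger0_norm ?sqr_ge0// normrX lerXn2r// nnegrE//; exact: ltW.
Qed.

End second_moments.

Section product_expectation.
Context {R : realType} {d : measure_display} {T : measurableType d}.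
Variable P : probability T R.

Definition indep_rv d1 d2 (T1 : measurableType d1) (T2 : measurableType d2)
    (X : T -> T1) (Y : T -> T2) := forall A B, measurable A -> measurable B ->
  P (X @^-1` A `&` Y @^-1` B) = (P (X @^-1` A) * P (Y @^-1` B))%E.

Lemma indep_comp d1 d2 d3 d4 (T1 : measurableType d1) (T2 : measurableType d2)
    (T3 : measurableType d3) (T4 : measurableType d4)
    (X : T -> T1) (Y : T -> T2) (f : T1 -> T3) (g : T2 -> T4) :
  measurable_fun setT f -> measurable_fun setT g ->
  indep_rv X Y -> indep_rv (f \o X) (g \o Y).
Proof.
move=> mf mg XY A B mA mB; apply: (XY (f @^-1` A) (g @^-1` B)).
- by rewrite -[X in measurable X]setTI; exact: mf.
- by rewrite -[X in measurable X]setTI; exact: mg.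
Qed.

(** The product is unbounded, so [indep_fubini] does not apply; its integrability under the product
    law is obtained first, from the iterated integral of |x| |y|. *)
Lemma indep_mul (X Y : T -> R) : indep_rv X Y ->
  dom (PE P) X -> dom (PE P) Y ->
  dom (PE P) (fun w => X w * Y w) /\
  ev (PE P) (fun w => X w * Y w) = ev (PE P) X * ev (PE P) Y.
Proof.
move=> XY DX DY; have mX := PE_measurable DX; have mY := PE_measurable DY.
have mXY : measurable_fun setT (fun w => (X w, Y w)) by exact/measurable_fun_pairP.
pose LX : probability R R := distribution P (rv_of mX).
pose LY : probability R R := distribution P (rv_of mY).
pose LXY : probability (R * R)%type R := distribution P (rv_of mXY).
have LE A : measurable A -> (LX \x LY)%E A = LXY A.
  by apply: product_measure_unique => B C mB mC; exact: XY.
have mm : measurable_fun setT (fun p : R * R => p.1 * p.2).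
  by apply: measurable_funM; [exact: measurable_fst|exact: measurable_snd].
have mEm : measurable_fun setT (EFin \o (fun p : R * R => p.1 * p.2)).
  exact/measurable_EFinP.
have lty (Z : T -> R) : dom (PE P) Z -> (\int[P]_w `|(Z w)%:E| < +oo)%E.
  by move=> /integrableP[].
have mabs : measurable_fun setT (fun x : R => `|x%:E|)%E.
  by apply: measurableT_comp.
have nLX (Z : T -> R) (mZ : measurable_fun setT Z) :
    (\int[distribution P (rv_of mZ)]_x `|x%:E| = \int[P]_w `|(Z w)%:E|)%E.
  by rewrite (ge0_integral_distribution _ mabs).
have ih : (LX \x LY)%E.-integrable setT (EFin \o (fun p : R * R => p.1 * p.2)).
  apply/integrable12ltyP => //=.
  under eq_integral.
    move=> x _; under eq_integral do rewrite normrM EFinM.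
    rewrite ge0_integralZl//.
    over.
  rewrite /= ge0_integralZr//; last exact: integral_ge0.
  apply: lte_mul_pinfty.
  - exact: integral_ge0.
  - rewrite ge0_fin_numE; first by rewrite nLX lty.
    exact: integral_ge0.
  - by rewrite nLX lty.
have ihXY : LXY.-integrable setT (EFin \o (fun p : R * R => p.1 * p.2)).
  apply/integrableP; split=> //; move/integrableP: ih => [_]; apply: le_lt_trans.
  rewrite le_eqVlt; apply/orP; left; apply/eqP.
  by apply: eq_measure_integral => A mA _; exact: (esym (LE A mA)).
have D : dom (PE P) (fun w => X w * Y w).
  apply/integrableP; split.
    apply/measurable_EFinP; exact: measurable_funM.
  move/integrableP : ihXY => [_]; rewrite ge0_integral_distribution//.
  exact: measurableT_comp.
split => //.
have iX : (\int[LX]_x x%:E = (ev (PE P) X)%:E)%E.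
  rewrite integral_distribution//.
  by rewrite /= /Rintegral fineK//; exact: integrable_fin_num.
have iY : (\int[LY]_x x%:E = (ev (PE P) Y)%:E)%E.
  rewrite integral_distribution//.
  by rewrite /= /Rintegral fineK//; exact: integrable_fin_num.
suff : (\int[P]_w (X w * Y w)%:E = (ev (PE P) X)%:E * (ev (PE P) Y)%:E)%E.
  by move=> /(congr1 fine).
transitivity (\int[LXY]_p (p.1 * p.2)%:E)%E.
  by rewrite integral_distribution.
transitivity (\int[(LX \x LY)%E]_p (p.1 * p.2)%:E)%E.
  by apply: eq_measure_integral => A mA _; exact: (esym (LE A mA)).
rewrite -(integral12_prod_meas1 ih) /fubini_F/=.
have idLY : LY.-integrable setT EFin.
  apply/integrableP; split; first exact/measurable_EFinP.
  by rewrite nLX lty.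
have idLX : LX.-integrable setT EFin.
  apply/integrableP; split; first exact/measurable_EFinP.
  by rewrite nLX lty.
under eq_integral.
  move=> x _; under eq_integral do rewrite EFinM.
  rewrite integralZl// iY; over.
by rewrite /= integralZr// iX.
Qed.

End product_expectation.

Section same_law.
Context {R : realType} {d d' d1 : measure_display} {T : measurableType d}
  {T' : measurableType d'} {V : measurableType d1}.
Variables (P : probability T R) (P' : probability T' R).

Lemma same_law (X : T -> V) (X' : T' -> V) (f : V -> R) :
  measurable_fun setT X -> measurable_fun setT X' -> measurable_fun setT f ->
  (forall B, measurable B -> P (X @^-1` B) = P' (X' @^-1` B)) ->
  dom (PE P') (f \o X') ->
  dom (PE P) (f \o X) /\ ev (PE P) (f \o X) = ev (PE P') (f \o X').
Proof.
move=> mX mX' mf PP' D'.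
have mEf : measurable_fun setT (EFin \o f) by exact/measurable_EFinP.
have e (g : V -> \bar R) :
    (\int[distribution P (rv_of mX)]_x g x = \int[distribution P' (rv_of mX')]_x g x)%E.
  by apply: eq_measure_integral => A mA _; exact: PP'.
have D : dom (PE P) (f \o X).
  apply/integrableP; split.
    by apply/measurable_EFinP; exact: measurableT_comp.
  move/integrableP : D' => [_].
  have := e (fun x => `|(f x)%:E|)%E.
  rewrite !ge0_integral_distribution//; try exact: measurableT_comp.
  by move=> ->.
split=> //; congr fine.
by have := e (EFin \o f); rewrite !integral_distribution.
Qed.

End same_law.

Section borel_cantelli_ae.
Context {R : realType} {d : measure_display} {T : measurableType d}.
Variable P : probability T R.

Lemma borel_cantelli_ae (F : nat -> T -> bool) (b : nat -> R) (B : R) :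
  (forall m, measurable [set w | F m w]) ->
  (forall m, ev (PE P) (fun w => ind (F m w)) <= b m) ->
  (forall M, \sum_(m < M) b m <= B) ->
  {ae P, forall w : T, exists N, forall m, (N <= m)%N -> ~~ F m w}.
Proof.
move=> mF Fb bB.
pose A m := [set w | F m w].
have PA m : (P (A m) <= (b m)%:E)%E.
  have := Fb m; rewrite PE_ind// -lee_fin fineK//; exact: fin_num_measure.
have sA : (\sum_(n <oo) P (A n) < +oo)%E.
  apply: (@le_lt_trans _ _ B%:E); last exact: ltry.
  apply: lime_le; first exact: is_cvg_nneseries.
  apply: nearW => n; apply: (@le_trans _ _ (\sum_(0 <= m < n) (b m)%:E)%E).
    exact: lee_sum.
  by rewrite sumEFin lee_fin big_mkord.
have := lim_sup_set_cvg0 mF sA.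
move=> L0; exists (lim_sup_set A); split => //.
  apply: bigcap_measurable => // k _.
  by apply: bigcup_measurable => j _; exact: mF.
move=> w /= H k _; apply: contrapT => nk; apply: H; exists k => m km.
by apply/negP => Fm; apply: nk; exists m.
Qed.

End borel_cantelli_ae.

(** * Dyadic sums and averages for the strong law *)

Section averages.
Context {R : realType}.
Implicit Types (z mu : R).

(** If 2^M < z, the geometric sum up to 2^M is less than 2^(M+1), hence than 2 z. *)
Lemma sum_dyadic_above z M : 0 <= z ->
  \sum_(m < M) 2 ^+ m * ind (2 ^+ m < z) <= 2 * z.
Proof.
move=> z0; elim: M => [|M IH]; first by rewrite big_ord0 mulr_ge0.
rewrite big_ord_recr/=; case: ltP => [zM|_]; last by rewrite mulr0 addr0.
apply: (@le_trans _ _ (\sum_(m < M) 2 ^+ m + 2 ^+ M)).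
  rewrite mulr1 lerD2r; apply: ler_sum => m _.
  by rewrite ler_piMr ?ind_le1// exprn_ge0.
suff -> : \sum_(m < M) 2 ^+ m = 2 ^+ M - 1 :> R by lra.
elim: (M) => [|N IHN]; first by rewrite big_ord0 expr0 subrr.
by rewrite big_ord_recr/= IHN exprS; ring.
Qed.

Lemma sum_dyadic_below z M : 0 <= z ->
  \sum_(m < M) (2 ^+ m)^-1 * (z ^+ 2 * ind (z <= 2 ^+ m)) <= 2 * z.
Proof.
move=> z0.
(* The subtracted term is the part of the geometric series still to come; with it the induction
   closes. *)
suff : \sum_(m < M) (2 ^+ m)^-1 * (z ^+ 2 * ind (z <= 2 ^+ m)) <=
    if z <= 2 ^+ M then 2 * z - 2 * z ^+ 2 / 2 ^+ M else 0.
  move=> /le_trans; apply; case: ifP => _; last by rewrite mulr_ge0.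
  by rewrite gerBl divr_ge0 ?exprn_ge0// mulr_ge0 ?sqr_ge0.
elim: M => [|M IH].
  by rewrite big_ord0 expr0; case: ifP => // z1; nra.
rewrite big_ord_recr/=; move: IH.
have p0 : 0 < 2 ^+ M :> R by rewrite exprn_gt0.
have e : z ^+ 2 / 2 ^+ M.+1 = z ^+ 2 / 2 ^+ M / 2.
  by rewrite [2 ^+ M.+1]exprS; field; rewrite lt0r_neq0.
case: (leP z (2 ^+ M)) => zM.
  have -> : z <= 2 ^+ M.+1 by apply: le_trans zM _; rewrite exprS; lra.
  have -> : 2 * z ^+ 2 / 2 ^+ M.+1 = z ^+ 2 / 2 ^+ M by rewrite -mulrA e; field.
  rewrite mulr1 [2 ^- M * _]mulrC -[2 * z ^+ 2 / _]mulrA => IH.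
  by lra.
rewrite mulr0 mulr0 addr0 => /le_trans; apply.
case: ifP => // zM1; rewrite subr_ge0 -mulrA ler_wpM2l// expr2 -mulrA.
by rewrite ler_piMr// ler_pdivrMr ?exprn_gt0// mul1r.
Qed.

(* Partial sums of nonnegative terms are monotone, so it suffices to control
   them along the sequences c * 2 ^ m, for all c. *)
Lemma cvg_average_dyadic (a : nat -> R) mu : (forall i, 0 <= a i) -> 0 <= mu ->
  (forall c, (0 < c)%N -> ((c * 2 ^ m)%N%:R^-1 * \sum_(i < c * 2 ^ m) a i)
     @[m --> \oo] --> mu) ->
  (n%:R^-1 * \sum_(i < n) a i) @[n --> \oo] --> mu.
Proof.
move=> a0 mu0 dy; pose S n := \sum_(i < n) a i.
have Smono p q : (p <= q)%N -> S p <= S q.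
  have E r : S r = \sum_(0 <= i < r) a i by rewrite /S big_mkord.
  move=> pq; rewrite !E [leRHS](big_cat_nat (n := p))//= lerDl.
  by apply: sumr_ge0.
apply/cvgrPdist_le => e e0.
pose e' := e / 4; have e'0 : 0 < e' by rewrite divr_gt0.
(* Every large n lies between c 2^m and (c+1) 2^m with L <= c < 2 L. The choice of L makes mu 2^m at
   most e / 2 times n, so one extra block is negligible. *)
pose L := (Num.truncn (2 * mu / e)).+1.
have L0 : (0 < L)%N by [].
have LR : 2 * mu / e < L%:R.
  by rewrite truncnS_gt.
(* Only finitely many multipliers c occur, so one N serves them all. *)
have [N NP] : exists N, forall m c, (N <= m)%N -> (c <= L.*2)%N -> (0 < c)%N ->
    `|mu - (c * 2 ^ m)%N%:R^-1 * S (c * 2 ^ m)%N| <= e'.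
  elim: (L.*2) => [|l [N NP]].
    by exists 0%N => m c _; rewrite leqn0 => /eqP ->.
  have /cvgrPdist_le /(_ _ e'0) [N' _ N'P] := dy l.+1 isT.
  exists (maxn N N') => m c; rewrite geq_max => /andP[Nm N'm].
  rewrite leq_eqVlt => /predU1P[->|cl] c0; first exact: N'P.
  exact: NP.
exists (L * 2 ^ N)%N => // n /= nL.
have nd0 : (0 < n %/ L)%N by rewrite divn_gt0//; apply: leq_trans nL; rewrite leq_pmulr//
  expn_gt0.
pose m := trunc_log 2 (n %/ L); pose c := (n %/ 2 ^ m)%N.
have m1 : (L * 2 ^ m <= n)%N by rewrite mulnC -leq_divRL// trunc_logP.
have m2 : (n < L * 2 ^ m.+1)%N by rewrite mulnC -ltn_divLR// trunc_log_ltn.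
have Nm : (N <= m)%N by rewrite trunc_log_max// leq_divRL// mulnC.
have p0 : (0 < 2 ^ m)%N by rewrite expn_gt0.
have cL : (L <= c)%N by rewrite leq_divRL.
have cL2 : (c < L.*2)%N.
  by rewrite ltn_divLR// -muln2 -mulnA -expnS.
have c0 : (0 < c)%N := leq_trans L0 cL.
have n1 : (c * 2 ^ m <= n)%N by rewrite leq_divM.
have n2 : (n <= c.+1 * 2 ^ m)%N by rewrite ltnW// ltn_ceil.
have n0 : (0 < n)%N by apply: leq_trans n1; rewrite muln_gt0 c0.
have nR : 0 < n%:R :> R by rewrite ltr0n.
have b1 := NP m c Nm (ltnW cL2) c0.
have b2 := NP m c.+1 Nm cL2 isT.
have q1 : 0 < (c * 2 ^ m)%N%:R :> R by rewrite ltr0n muln_gt0 c0.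
have q2 : 0 < (c.+1 * 2 ^ m)%N%:R :> R by rewrite ltr0n muln_gt0.
have s1 : (c * 2 ^ m)%N%:R * (mu - e') <= S n.
  apply: le_trans (Smono _ _ n1); rewrite -ler_pdivlMl//.
  by move: b1; rewrite ler_norml => /andP[? ?]; lra.
have s2 : S n <= (c.+1 * 2 ^ m)%N%:R * (mu + e').
  apply: le_trans (Smono _ _ n2) _; rewrite -ler_pdivrMl//.
  by move: b2; rewrite ler_norml lerNl opprB lerBlDl => /andP[].
have t1 : (c * 2 ^ m)%N%:R <= n%:R :> R by rewrite ler_nat.
have t2 : n%:R <= (c * 2 ^ m)%N%:R + (2 ^ m)%N%:R :> R.
  by rewrite -natrD ler_nat addnC -mulSn.
have t3 : (c.+1 * 2 ^ m)%N%:R = (c * 2 ^ m)%N%:R + (2 ^ m)%N%:R :> R.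
  by rewrite -natrD addnC -mulSn.
have t4 : L%:R * (2 ^ m)%N%:R <= n%:R :> R by rewrite -natrM ler_nat.
have t5 : mu * (2 ^ m)%N%:R <= e / 2 * n%:R.
  apply: (@le_trans _ _ (e / 2 * (L%:R * (2 ^ m)%N%:R))).
    rewrite mulrA ler_wpM2r// -ler_pdivrMl; last by rewrite divr_gt0.
    apply: le_trans (ltW LR); rewrite le_eqVlt; apply/orP; left; apply/eqP.
    by field; rewrite gt_eqF.
  by rewrite ler_wpM2l// divr_ge0// ltW.
have t6 : (2 ^ m)%N%:R <= (c * 2 ^ m)%N%:R :> R by rewrite ler_nat leq_pmull.
have -> : mu - n%:R^-1 * S n = n%:R^-1 * (n%:R * mu - S n).
  by rewrite mulrBr mulKf// gt_eqF.
rewrite normrM gtr0_norm ?invr_gt0// ler_pdivrMl// ler_norml.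
rewrite t3 in s2; move: s1 s2 t1 t2 t5 t6; rewrite /e'.
move: ((c * 2 ^ m)%N%:R) ((2 ^ m)%N%:R) (S n) (n%:R) => x y s k s1 s2 t1 t2 t5 t6.
apply/andP; split; nra.
Qed.

End averages.

Section dominated.
Context {R : realType} {d : measure_display} {T : measurableType d}.
Variable P : probability T R.

Lemma PE_dominated (f_ : nat -> T -> R) (f g : T -> R) :
  (forall n, measurable_fun setT (f_ n)) -> measurable_fun setT f ->
  dom (PE P) g -> (forall n w, `|f_ n w| <= g w) ->
  {ae P, forall w : T, f_ n w @[n --> \oo] --> f w} ->
  ev (PE P) (f_ n) @[n --> \oo] --> ev (PE P) f.
Proof.
move=> mf_ mf Dg fg ff.
have := @dominated_convergence _ T R P setT measurableT
  (fun n => EFin \o f_ n) (EFin \o f) (EFin \o g).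
case.
- by move=> n; exact/measurable_EFinP.
- exact/measurable_EFinP.
- by apply: filterS ff => w fw _; apply: cvg_EFin; [exact: nearW|exact: fw].
- exact: Dg.
- by apply: aeW => w n _; rewrite /= lee_fin.
move=> iF _ cv.
have fin : (\int[P]_x (f x)%:E)%E \is a fin_num by exact: integrable_fin_num.
apply: (@fine_cvg _ _ _ _ (fun n => \int[P]_x (f_ n x)%:E)%E (ev (PE P) f)).
by rewrite /= /Rintegral fineK.
Qed.

End dominated.

(** * Strong law of large numbers *)

Section strong_law.
Context {R : realType} {d : measure_display} {T : measurableType d}.
Variable P : probability T R.
Local Notation E := (ev (PE P)).

Lemma measurable_set_le (f g : T -> R) : measurable_fun setT f ->
  measurable_fun setT g -> measurable [set w | f w <= g w].
Proof.
move=> mf mg; have := measurable_fun_ler mf mg.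
by move=> /(_ measurableT [set true] I); rewrite setTI; congr measurable.
Qed.

Lemma measurable_norm (f : T -> R) : measurable_fun setT f ->
  measurable_fun setT (fun w => `|f w|).
Proof. by move=> mf; exact: measurableT_comp. Qed.

Lemma measurable_set_lt (f g : T -> R) : measurable_fun setT f ->
  measurable_fun setT g -> measurable [set w | f w < g w].
Proof.
move=> mf mg; have := measurable_fun_ltr mf mg.
by move=> /(_ measurableT [set true] I); rewrite setTI; congr measurable.
Qed.

(** The truncation level depends on the dyadic block and not on the index, so the clipped variables
    of a block keep a common law. *)
Definition clip (z : R) (m : nat) : R := z * ind (z <= 2 ^+ m).

Lemma measurable_le_ind (m : R) : measurable_fun setT (fun z : R => ind (z <= m) : R).
Proof.
apply: measurable_ind; rewrite (_ : [set w | w <= m] = `]-oo, m]%classic).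
  exact: measurable_itv.
by apply/seteqP; split => x /=; rewrite in_itv.
Qed.

Lemma measurable_lt_ind (m : R) : measurable_fun setT (fun z : R => ind (m < z) : R).
Proof.
apply: measurable_ind; rewrite (_ : [set w | m < w] = `]m, +oo[%classic).
  exact: measurable_itv.
by apply/seteqP; split => x /=; rewrite in_itv/= andbT.
Qed.

Lemma measurable_clip m : measurable_fun setT (fun z => clip z m).
Proof. by apply: measurable_funM => //; exact: measurable_le_ind. Qed.

Lemma clip_ge0 z m : 0 <= z -> 0 <= clip z m.
Proof. by move=> z0; rewrite mulr_ge0 ?ind_ge0. Qed.

Lemma clip_norm_le z m : 0 <= z -> `|clip z m| <= z.
Proof.
move=> z0; rewrite ger0_norm ?clip_ge0// /clip.
by rewrite ler_piMr// ind_le1.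
Qed.

Lemma clip_bounded z m : 0 <= z -> `|clip z m| <= 2 ^+ m.
Proof.
move=> z0; rewrite ger0_norm ?clip_ge0// /clip.
by case: (leP z (2 ^+ m)) => ?; rewrite ?mulr1// mulr0 exprn_ge0.
Qed.

Lemma clip_sqr z m : clip z m ^+ 2 = z ^+ 2 * ind (z <= 2 ^+ m).
Proof. by rewrite /clip exprMn; case: leP; rewrite ?expr1n// expr0n. Qed.

Lemma nat_le_exp2 (n : nat) : (n%:R : R) <= 2 ^+ n.
Proof. by rewrite -natrX ler_nat ltnW// ltn_expl. Qed.

Section nonnegative.
Variable Z : nat -> T -> R.
Hypothesis mZ : forall i, measurable_fun setT (Z i).
Hypothesis Z_indep : forall i j, i != j -> indep_rv P (Z i) (Z j).
Hypothesis Z_law : forall i B, measurable B -> P (Z i @^-1` B) = P (Z 0%N @^-1` B).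
Hypothesis Z_ge0 : forall i w, 0 <= Z i w.
Hypothesis Z_dom : dom (PE P) (Z 0%N).

Let mu := E (Z 0%N).
Let a m := E (fun w => clip (Z 0%N w) m).

Let mu_ge0 : 0 <= mu.
Proof. by rewrite -(ev0 (PE P)); apply: ev_le => //; exact: dom_cst. Qed.

Let law_dom (f : R -> R) i : measurable_fun setT f ->
  dom (PE P) (fun w => f (Z 0%N w)) -> dom (PE P) (fun w => f (Z i w)) /\
  E (fun w => f (Z i w)) = E (fun w => f (Z 0%N w)).
Proof. by move=> mf; apply: (same_law (mZ i) (mZ 0%N) mf (Z_law i)). Qed.

Let clip_dom m : dom (PE P) (fun w => clip (Z 0%N w) m).
Proof.
apply: (@PE_le _ _ _ P _ _ _ Z_dom); first exact: measurableT_comp (measurable_clip m) (mZ _).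
by move=> w; rewrite (ger0_norm (Z_ge0 _ _)) clip_norm_le.
Qed.

Let clip2_dom m : dom (PE P) (fun w => clip (Z 0%N w) m ^+ 2).
Proof.
apply: (@PE_bounded _ _ _ P _ ((2 ^+ m) ^+ 2)).
  by apply: measurable_funX; exact: measurableT_comp (measurable_clip m) (mZ _).
move=> w; rewrite normrX lerXn2r ?nnegrE ?exprn_ge0//.
exact: clip_bounded.
Qed.

Let a_cvg : a m @[m --> \oo] --> mu.
Proof.
apply: (@PE_dominated _ _ _ P _ (Z 0%N) (Z 0%N)) => //.
- by move=> m; exact: measurableT_comp (measurable_clip m) (mZ _).
- by move=> m w; exact: clip_norm_le.
apply: aeW => w; apply: cvg_near_cst; exists (Num.truncn (Z 0%N w)).+1 => // m /= Nm.
rewrite /clip (_ : _ <= _) ?mulr1//.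
apply: (@le_trans _ _ m%:R); last exact: nat_le_exp2.
apply: (@le_trans _ _ ((Num.truncn (Z 0%N w)).+1%:R)); last by rewrite ler_nat.
by rewrite ltW// truncnS_gt.
Qed.

(** Outside [above] the truncation changes no term of the block; outside [far] the truncated average
    is close to its mean. Both probabilities are summable in m. *)
Let above c m w := [exists i : 'I_(c * 2 ^ m), 2 ^+ m < Z i w].

Let far c e m w := e <= `|((c * 2 ^ m)%N%:R)^-1 *
  \sum_(i < c * 2 ^ m) clip (Z i w) m - a m|.

Let measurable_above c m : measurable [set w | above c m w].
Proof.
rewrite (_ : [set w | _] = \bigcup_(i in [set i | (i < c * 2 ^ m)%N])
    (Z i @^-1` `]2 ^+ m, +oo[)).
  apply: bigcup_measurable => i _; rewrite -[X in measurable X]setTI.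
  by apply: mZ => //; exact: measurable_itv.
apply/seteqP; split => w /=.
  by move=> /existsP[i Zi]; exists i => //=; rewrite in_itv/= andbT.
move=> [i /= ic]; rewrite in_itv/= andbT => Zi.
by apply/existsP; exists (Ordinal ic).
Qed.

(** A union bound gives c 2^m P(Z > 2^m); exchanging sum and expectation leaves
    [sum_dyadic_above]. *)
Let above_sum c M : \sum_(m < M) E (fun w => ind (above c m w)) <= c%:R * (2 * mu).
Proof.
have Dab i m : dom (PE P) (fun w => ind (2 ^+ m < Z i w)).
  apply: (@PE_bounded _ _ _ P _ 1).
    exact: measurableT_comp (measurable_lt_ind _) (mZ i).
  by move=> w; rewrite ger0_norm ?ind_ge0// ind_le1.
apply: (@le_trans _ _ (\sum_(m < M) c%:R * (2 ^+ m * E (fun w => ind (2 ^+ m < Z 0%N w))))).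
  apply: ler_sum => m _.
  apply: (@le_trans _ _ (E (fun w => \sum_(i < c * 2 ^ m) ind (2 ^+ m < Z i w)))).
    apply: ev_le; first exact: PE_ind_dom.
      by apply: dom_sum => i; exact: Dab.
    move=> w; case: (boolP (above c m w)) => [/existsP[i Zi]|_]; last first.
      by apply: sumr_ge0 => *; exact: ind_ge0.
    rewrite (bigD1 i)//= Zi lerDl; by apply: sumr_ge0 => *; exact: ind_ge0.
  rewrite ev_sum; last by move=> i; exact: Dab.
  rewrite (eq_bigr (fun=> E (fun w => ind (2 ^+ m < Z 0%N w)))); last first.
    move=> i _; exact: (law_dom i (measurable_lt_ind (2 ^+ m)) (Dab _ _)).2.
  by rewrite sumr_const card_ord mulrA -natrX -natrM mulr_natl.
rewrite -mulr_sumr ler_wpM2l//.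
under eq_bigr do rewrite -(evZ _ (Dab _ _)).
rewrite -ev_sum; last by move=> m; apply: domZ; exact: Dab.
rewrite -evZ//; apply: ev_le; last by move=> w; exact: sum_dyadic_above.
  by apply: dom_sum => m; apply: domZ; exact: Dab.
exact: domZ.
Qed.

Let measurable_avg c m : measurable_fun setT (fun w =>
  ((c * 2 ^ m)%N%:R)^-1 * \sum_(i < c * 2 ^ m) clip (Z i w) m - a m).
Proof.
apply: measurable_funB => //; apply: measurable_funM => //.
apply: measurable_sum => i.
exact: measurableT_comp (measurable_clip m) (mZ i).
Qed.

Let measurable_far c e m : measurable [set w | far c e m w].
Proof.
apply: measurable_set_le => //.
exact: measurable_norm.
Qed.

(** Chebyshev's inequality: cross terms vanish by pairwise independence, and the variance of a
    clipped term is at most its second moment. The 2^-m makes the bounds summable by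
    [sum_dyadic_below]. *)
Let far_bound c e m : (0 < c)%N -> 0 < e ->
  E (fun w => ind (far c e m w)) <=
  (c%:R * e ^+ 2)^-1 * ((2 ^+ m)^-1 * E (fun w => clip (Z 0%N w) m ^+ 2)).
Proof.
move=> c0 e0; pose k := (c * 2 ^ m)%N.
have k0 : 0 < k%:R :> R by rewrite ltr0n muln_gt0 c0 expn_gt0.
pose x i w := clip (Z i w) m - a m.
have mx : measurable_fun setT (fun z : R => clip z m - a m).
  by apply: measurable_funB => //; exact: measurable_clip.
have Dx i : dom (PE P) (x i) /\ E (x i) = 0.
  have [] := law_dom i mx _; first by apply: domB => //; exact: dom_cst.
  by move=> Dxi ->; split=> //; rewrite evB ?ev_cst ?subrr//; exact: dom_cst.
have Dx2 : dom (PE P) (fun w => x 0%N w ^+ 2).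
  have := @PE_le _ _ _ P (fun w => x 0%N w ^+ 2)
    (fun w => 2 * clip (Z 0%N w) m ^+ 2 + (2 * a m ^+ 2)).
  apply.
  - by apply: measurable_funX; exact: PE_measurable (Dx _).1.
  - by apply: domD; [exact: domZ|exact: dom_cst].
  move=> w; rewrite ger0_norm ?sqr_ge0// ger0_norm; last first.
    by have := sqr_ge0 (clip (Z 0%N w) m); have := sqr_ge0 (a m); lra.
  by have := sqr_ge0 (clip (Z 0%N w) m + a m); rewrite /x; nra.
have Dxx i j : dom (PE P) (fun w => x i w * x j w).
  have [->|ij] := eqVneq i j.
    apply: eq_dom (law_dom j (measurable_funX 2 mx) Dx2).1 => w.
    by rewrite /x expr2.
  exact: (indep_mul (indep_comp mx mx (Z_indep ij)) (Dx i).1 (Dx j).1).1.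
have xx0 i j : i != j -> E (fun w => x i w * x j w) = 0.
  move=> ij; have := indep_mul (indep_comp mx mx (Z_indep ij)) (Dx i).1 (Dx j).1.
  by case=> _ ->; rewrite (Dx i).2 mul0r.
have [D2 E2] := @ev_sqr_sum R T (PE P) nat (index_iota 0 k) x (iota_uniq _ _) Dxx
  (fun i j _ _ => xx0 i j).
have avgE w : k%:R^-1 * \sum_(i < k) clip (Z i w) m - a m =
    k%:R^-1 * \sum_(i <- index_iota 0 k) x i w.
  rewrite /x sumrB !big_mkord sumr_const card_ord.
  by rewrite mulrBr -[a m *+ k]mulr_natl mulKf// gt_eqF.
have farE w : far c e m w = (e * k%:R <= `|\sum_(i <- index_iota 0 k) x i w|).
  rewrite /far avgE normrM gtr0_norm ?invr_gt0//.
  by rewrite ler_pdivlMl// mulrC.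
have -> : (fun w => ind (far c e m w)) =
    (fun w => ind (e * k%:R <= `|\sum_(i <- index_iota 0 k) x i w|)) :> (T -> R).
  by apply/funext => w; rewrite farE.
apply: le_trans (ev_chebyshev _ D2 _) _; first by rewrite mulr_gt0.
  apply: PE_ind_dom; have := measurable_far c e m.
  by congr measurable; apply/seteqP; split => w /=; rewrite farE.
rewrite E2 (eq_bigr (fun=> E (fun w => x 0%N w ^+ 2))); last first.
  by move=> i _; exact: (law_dom i (measurable_funX 2 mx) Dx2).2.
rewrite big_mkord sumr_const card_ord.
have V : E (fun w => x 0%N w ^+ 2) <= E (fun w => clip (Z 0%N w) m ^+ 2).
  have -> : E (fun w => x 0%N w ^+ 2) =
      E (fun w => clip (Z 0%N w) m ^+ 2) - a m ^+ 2.
    have -> : (fun w => x 0%N w ^+ 2) =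
        (fun w => (- (2 * a m)) * clip (Z 0%N w) m + (clip (Z 0%N w) m ^+ 2 + a m ^+ 2)).
      by apply/funext => w; rewrite /x; ring.
    rewrite ev_lin ?evD ?ev_cst -/(a m)//; try exact: dom_cst.
      by ring.
    by apply: domD => //; exact: dom_cst.
  by rewrite gerBl sqr_ge0.
have -> : E (fun w => x 0%N w ^+ 2) *+ k / (e * k%:R) ^+ 2 =
   (c%:R * e ^+ 2)^-1 * ((2 ^+ m)^-1 * E (fun w => x 0%N w ^+ 2)).
  rewrite -[_ *+ k]mulr_natl /k natrM natrX; field.
  by rewrite !gt_eqF ?exprn_gt0// ltr0n.
rewrite ler_wpM2l//; first by rewrite invr_ge0 mulr_ge0// exprn_ge0// ltW.
by rewrite ler_wpM2l// invr_ge0 exprn_ge0.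
Qed.

Let dyadic_law c : (0 < c)%N ->
  {ae P, forall w : T, ((c * 2 ^ m)%N%:R^-1 * \sum_(i < c * 2 ^ m) Z i w)
     @[m --> \oo] --> mu}.
Proof.
move=> c0.
(* The radii 1 / (q+1) are countably many, so that the exceptional null sets can be merged. *)
have H q : {ae P, forall w : T, exists N, forall m, (N <= m)%N ->
    ~~ (above c m w || far c (q.+1%:R^-1) m w)}.
  pose e : R := q.+1%:R^-1; have e0 : 0 < e by rewrite invr_gt0.
  pose b m := E (fun w => ind (above c m w)) +
    (c%:R * e ^+ 2)^-1 * ((2 ^+ m)^-1 * E (fun w => clip (Z 0%N w) m ^+ 2)).
  apply: (@borel_cantelli_ae _ _ _ P _ b (c%:R * (2 * mu) + (c%:R * e ^+ 2)^-1 * (2 * mu))).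
  - move=> m; rewrite (_ : [set w | _] = [set w | above c m w] `|` [set w | far c e m w]).
      exact: measurableU.
    apply/seteqP; split => w /=; first by move=> /orP.
    by move=> ?; apply/orP.
  - move=> m; apply: le_trans (lerD (lexx _) (far_bound m c0 e0)).
    rewrite -evD; [|exact: PE_ind_dom..].
    apply: ev_le; [apply: PE_ind_dom| apply: domD; exact: PE_ind_dom|].
      rewrite (_ : [set w | _] = [set w | above c m w] `|` [set w | far c e m w]).
        exact: measurableU.
      apply/seteqP; split => w /=; first by move=> /orP.
      by move=> ?; apply/orP.
    by move=> w; rewrite /ind; case: above; case: far => /=; rewrite -?natrD ler_nat.
  - move=> M; rewrite big_split/= lerD ?above_sum// -mulr_sumr.
    rewrite ler_wpM2l//; first by rewrite invr_ge0 mulr_ge0// exprn_ge0// ltW.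
    under eq_bigr do rewrite -(evZ _ (clip2_dom _)).
    rewrite -ev_sum; last by move=> m; exact: domZ.
    rewrite -evZ//; apply: ev_le.
    + by apply: dom_sum => m; exact: domZ.
    + exact: domZ.
    + by move=> w; under eq_bigr do rewrite clip_sqr; exact: sum_dyadic_below.
have := ae_foralln H; apply: filterS => w Hw.
apply/cvgrPdist_le => e e0.
pose q := Num.truncn (2 / e).
have qe : q.+1%:R^-1 <= e / 2.
  rewrite -[leRHS]invrK lef_pV2 ?posrE ?invr_gt0 ?divr_gt0// invf_div ltW//.
  exact: truncnS_gt.
have [N NP] := Hw q.
have /cvgrPdist_le /(_ (e / 2)) [|N' _ N'P] := a_cvg; first by rewrite divr_gt0.
exists (maxn N N') => // m /=; rewrite geq_max => /andP[Nm N'm].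
have := NP m Nm; rewrite negb_or => /andP[/existsPn nab nf].
have cZ (i : 'I_(c * 2 ^ m)) : clip (Z i w) m = Z i w.
  by rewrite /clip leNgt nab mulr1.
rewrite -ltNge in nf; move: nf; rewrite (eq_bigr _ (fun i _ => cZ i)) => nf.
have am := N'P m N'm; apply: le_trans (ler_distD (a m) _ _) _.
rewrite [X in _ + X]distrC; have := ltW (lt_le_trans nf qe); rewrite /= in am.
lra.
Qed.

Lemma strong_law_ge0 :
  {ae P, forall w : T, (n%:R^-1 * \sum_(i < n) Z i w) @[n --> \oo] --> mu}.
Proof.
have := ae_foralln (fun c => dyadic_law (c := c.+1) isT).
apply: filterS => w Hw; apply: (@cvg_average_dyadic _ (fun i => Z i w)) => //.
by case=> // c _; exact: Hw.
Qed.

End nonnegative.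

(** Positive and negative parts inherit pairwise independence and a common law, and the nonnegative
    case applies to each. *)
Theorem strong_law (Z : nat -> T -> R) :
  (forall i, measurable_fun setT (Z i)) ->
  (forall i j, i != j -> indep_rv P (Z i) (Z j)) ->
  (forall i B, measurable B -> P (Z i @^-1` B) = P (Z 0%N @^-1` B)) ->
  dom (PE P) (Z 0%N) ->
  {ae P, forall w : T, (n%:R^-1 * \sum_(i < n) Z i w) @[n --> \oo] --> E (Z 0%N)}.
Proof.
move=> mZ Zi Zl D0.
have mp : measurable_fun setT (fun z : R => Num.max z 0) by exact: measurable_maxr.
have mn : measurable_fun setT (fun z : R => Num.max (- z) 0).
  by apply: measurable_maxr => //; exact: measurableT_comp.
have part (f : R -> R) : measurable_fun setT f -> (forall z, 0 <= f z <= `|z|) ->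
    dom (PE P) (fun w => f (Z 0%N w)) /\
    {ae P, forall w : T, (n%:R^-1 * \sum_(i < n) f (Z i w)) @[n --> \oo] -->
      E (fun w => f (Z 0%N w))}.
  move=> mf f0.
  have Df : dom (PE P) (fun w => f (Z 0%N w)).
    apply: (@PE_le _ _ _ P _ _ _ D0); first exact: measurableT_comp.
    by move=> w; have /andP[? ?] := f0 (Z 0%N w); rewrite ger0_norm.
  split => //; apply: (@strong_law_ge0 (fun i => f \o Z i)) => //.
  - by move=> i; exact: measurableT_comp.
  - by move=> i j ij; apply: indep_comp => //; exact: Zi.
  - move=> i B mB; apply: (Zl i (f @^-1` B)).
    by rewrite -[X in measurable X]setTI; exact: mf.
  - by move=> i w; have /andP[] := f0 (Z i w).
have [|Dp Lp] := part _ mp.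
  move=> z; case: (leP z 0) => z0; first by rewrite lexx normr_ge0.
  by rewrite ger0_norm ?lexx ltW.
have [|Dn Ln] := part _ mn.
  move=> z; case: (leP (- z) 0) => z0; first by rewrite lexx normr_ge0.
  by rewrite -(normrN z) ger0_norm ?lexx ltW.
have ZE (z : R) : z = Num.max z 0 - Num.max (- z) 0.
  by case: (leP z 0) => ?; case: (leP (- z) 0) => ?; lra.
move: Lp Ln; apply: filterS2 => w Lp Ln.
have -> : E (Z 0%N) = E (fun w => Num.max (Z 0%N w) 0) - E (fun w => Num.max (- Z 0%N w) 0).
  by rewrite -evB//; apply: eq_ev => v; exact: ZE.
rewrite (_ : (fun n => _) = (fun n => n%:R^-1 * \sum_(i < n) Num.max (Z i w) 0) -
  (fun n => n%:R^-1 * \sum_(i < n) Num.max (- Z i w) 0)); first exact: cvgB.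
apply/funext => n; rewrite fctE -mulrBr -sumrB; congr (_ * _).
by apply: eq_bigr => i _; rewrite -ZE.
Qed.

End strong_law.

(** * Lindeberg replacement for independent data *)

Lemma PE_L2_L1 {R : realType} {d : measure_display} {T : measurableType d}
    (P : probability T R) (f : T -> R) : measurable_fun setT f ->
  dom (PE P) (fun w => f w ^+ 2) -> dom (PE P) f.
Proof.
move=> mf D2; apply: (@PE_le _ _ _ P _ _ mf (domD (dom_cst _ 1) D2)) => w.
rewrite [leRHS]ger0_norm; last by rewrite addr_ge0// sqr_ge0.
rewrite -(real_normK (num_real (f w))).
by have := sqr_ge0 (`|f w| - 1); nra.
Qed.

Section grouping.
Context {R : realType} {d : measure_display} {T : measurableType d}
  {I : choiceType}.
Variables (P : probability T R) (S : I -> set_system T).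
Hypothesis S_indep : mutually_independent P S.
Hypothesis S_meas : forall i A, S i A -> measurable A.
Hypothesis S_setT : forall i, S i setT.
Hypothesis S_setI : forall i A B, S i A -> S i B -> S i (A `&` B).

(** A pi-system generating the sigma-algebra of the observations indexed by J. *)
Definition boxes (J : {fset I}) : set_system T :=
  [set A | exists2 F : I -> set T, (forall i, S i (F i)) &
    A = \bigcap_(i in [set` J]) F i].

Lemma boxes_measurable J : boxes J `<=` measurable.
Proof.
move=> _ [F SF ->]; apply: fin_bigcap_measurable; first exact: finite_fset.
by move=> i _; apply: S_meas (SF i).
Qed.

Lemma boxes_setT J : boxes J setT.
Proof.
exists (fun=> setT); first exact: S_setT.
by apply/seteqP; split.
Qed.

Lemma boxes_setI J : setI_closed (boxes J).
Proof.
move=> _ _ [F SF ->] [G SG ->]; exists (fun i => F i `&` G i).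
  by move=> i; exact: S_setI.
by rewrite -bigcapI.
Qed.

Lemma boxes_sub J i A : i \in J -> S i A -> boxes J A.
Proof.
move=> iJ SA; exists (fun j => if j == i then A else setT).
  by move=> j; case: eqP => [->|_] //; exact: S_setT.
apply/seteqP; split => w.
  by move=> Aw j _ /=; case: eqP.
by move=> /(_ i iJ); rewrite eqxx.
Qed.

(** For fixed B, the finite measures P(. & B) and P(.) P(B) agree on the pi-system [boxes J], hence
    on the sigma-algebra it generates. *)
Lemma grouping (J : {fset I}) i0 A B : i0 \notin J ->
  <<s boxes J >> A -> S i0 B -> P (A `&` B) = (P A * P B)%E.
Proof.
move=> iJ sA SB; have mB := S_meas SB.
pose m1 := mrestr P mB.
have PB0 : 0 <= fine (P B) by rewrite fine_ge0.
pose m2 := mscale (NngNum PB0) P.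
have fPB : (fine (P B))%:E = P B by rewrite fineK// fin_num_measure.
have m2E X : m2 X = (P X * P B)%E by rewrite muleC -fPB.
suff : m1 A = m2 A by rewrite m2E.
apply: (@g_sigma_algebra_measure_unique _ _ _ (boxes J) (@boxes_measurable J)
  (fun=> setT)) => //.
- by move=> _; exact: boxes_setT.
- by rewrite bigcup_const//; exists 0%N.
- exact: boxes_setI.
- move=> _ [F SF ->]; apply: etrans (esym (m2E _)).
  pose F' i := if i == i0 then B else F i.
  have FF' i : i \in J -> F' i = F i.
    by rewrite /F'; case: eqP => // -> iJ'; rewrite iJ' in iJ.
  have F'0 : F' i0 = B by rewrite /F' eqxx.
  have SF' i : S i (F' i) by rewrite /F'; case: eqP => [->|].
  have e1 := S_indep (fun i (_ : i \in (i0 |` J)%fset) => SF' i).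
  have e2 := S_indep (fun i (_ : i \in J) => SF' i).
  rewrite big_fsetU1//= F'0 -e2 muleC in e1.
  have -> : \bigcap_(i in [set` J]) F i = \bigcap_(i in [set` J]) F' i.
    by apply: eq_bigcapr => i /= iJ'; rewrite FF'.
  rewrite -e1; apply: (congr1 P); apply/seteqP; split => w.
    move=> [H Bw] i /=; rewrite !inE => /orP[/eqP ->|iJ']; first by rewrite F'0.
    exact: H.
  move=> H; split; last by have := H i0; rewrite F'0; apply; rewrite /= !inE eqxx.
  by move=> i /= iJ'; apply: H; rewrite /= !inE iJ' orbT.
- move=> _; rewrite /m1 /mrestr/= (le_lt_trans (probability_le1 _ _)) ?ltry//.
  by rewrite setTI.
Qed.

End grouping.

Section spline_measurable.
Context {R : realType} {d : measure_display} {V : measurableType d}.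

Lemma measurable_cubp : measurable_fun setT (@cubp R).
Proof. by apply: measurable_funX; exact: measurable_maxr. Qed.

Lemma measurable_spline : measurable_fun setT (@spline R).
Proof.
have mc (c : R) : measurable_fun setT (fun x : R => cubp (x - c)).
  by apply: measurableT_comp measurable_cubp _; exact: measurable_funB.
have m0 := measurable_cubp.
apply: measurable_funM => //; apply: measurable_funB => //.
apply: measurable_funD; last by apply: measurable_funM.
by apply: measurable_funB => //; apply: measurable_funM.
Qed.

Lemma measurable_orthant (D Gam : finType) (J : pred D) (A : D -> Gam -> R) s t
    (u : V -> Gam -> R) : (forall g, measurable_fun setT (fun v => u v g)) ->
  measurable_fun setT (fun v => orthant J A s t (u v)).
Proof.
move=> mu; rewrite /orthant.
have mf j : measurable_fun setT (fun v => spline (s * (t j - \sum_g A j g * u v g))).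
  apply: (measurableT_comp measurable_spline).
  apply: measurable_funM => //; apply: measurable_funB => //.
  by apply: measurable_sum => g; apply: measurable_funM.
elim: (index_enum D) => [|j r IH].
  by rewrite (_ : (fun v => _) = fun=> 1)//; apply/funext => v; rewrite big_nil.
pose f v := spline (s * (t j - \sum_g A j g * u v g)).
rewrite (_ : (fun v => _) = if J j then (fun v => f v *
    \prod_(j0 <- r | J j0) spline (s * (t j0 - \sum_g A j0 g * u v g)))
  else (fun v => \prod_(j0 <- r | J j0) spline (s * (t j0 - \sum_g A j0 g * u v g)))).
  by case: (J j) => //; apply: measurable_funM => //; exact: mf.
by apply/funext => v; rewrite big_cons; case: (J j).
Qed.

Lemma orthant_itv (D Gam : finType) (J : pred D) (A : D -> Gam -> R) s t u :
  `|orthant J A s t u| <= 1.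
Proof.
rewrite ger0_norm; last by apply: prodr_ge0 => j _; exact: spline_ge0.
by apply: prodr_ile1 => j _; exact: spline_itv.
Qed.

End spline_measurable.

Section lindeberg_independent.
Context {R : realType} {d : measure_display} {T : measurableType d}
  {I : choiceType} {D Gam O : finType}.
Variables (P : probability T R) (S : I -> set_system T).
Hypothesis S_indep : mutually_independent P S.
Hypothesis S_meas : forall i A, S i A -> measurable A.
Hypothesis S_setT : forall i, S i setT.
Hypothesis S_setI : forall i A B, S i A -> S i B -> S i (A `&` B).
Variables (idx : O -> I) (grp : O -> Gam) (xi : O -> T -> R) (tau : O -> R).
Hypothesis idx_inj : injective idx.
Hypothesis xi_S : forall o B, measurable B -> S (idx o) (xi o @^-1` B).
Hypothesis xi_L2 : forall o, dom (PE P) (fun w => xi o w ^+ 2).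
Hypothesis xi_mean : forall o, ev (PE P) (xi o) = 0.
Variables (J : pred D) (A : D -> Gam -> R) (s C : R) (t : D -> R).
Hypothesis C_smooth : smooth C (orthant J A s t).

Let psi := orthant J A s t.

Let mxi o : measurable_fun setT (xi o).
Proof. by move=> _ B mB; rewrite setTI; apply: S_meas (xi_S o mB). Qed.

Let measurable_gsum (d' : measure_display) (V : measurableType d')
    (x : O -> V -> R) (os : seq O) a g :
  (forall o, o \in os -> measurable_fun setT (x o)) ->
  measurable_fun setT (fun v => (gsum grp x os v + a) g).
Proof.
move=> mx; have mp (r : R) : measurable_fun setT (fun _ : V => r) by [].
apply: measurable_funD => //.
elim: os mx => [|o os IH] mx.
  rewrite (_ : (fun v => _) = fun=> 0)//; apply/funext => v.
  by rewrite /gsum big_nil.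
rewrite (_ : (fun v => _) =
    (fun v => pt (grp o) (x o v) g + gsum grp x os v g)); last first.
  by apply/funext => v; rewrite /gsum big_cons.
apply: measurable_funD; last by apply: IH => p pos; apply: mx; rewrite inE pos orbT.
by rewrite /pt; case: eqP => // _; apply: mx; rewrite inE eqxx.
Qed.

Let dom_psi (u : T -> Gam -> R) : (forall g, measurable_fun setT (fun v => u v g)) ->
  dom (PE P) (fun w => psi (u w)).
Proof.
move=> mu; apply: (@PE_bounded _ _ _ P _ 1); first exact: measurable_orthant.
by move=> w; exact: orthant_itv.
Qed.

Let indep o os a : o \notin os ->
  dom (PE P) (fun w => ev (PE P) (fun w' => psi (gsum grp xi os w + a + pt (grp o) (xi o
    w')))) /\
  ev (PE P) (fun w => psi (gsum grp xi os w + a + pt (grp o) (xi o w))) =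
  ev (PE P) (fun w => ev (PE P) (fun w' => psi (gsum grp xi os w + a + pt (grp o) (xi o w')))).
Proof.
move=> oos.
pose JJ : {fset I} := [fset idx p | p in os]%fset.
(* T itself, with the sigma-algebra of the observations in os, serves as value space: the partial
   sum over os is then a function of the identity map into V, which is independent of [xi o]. *)
pose V := g_sigma_algebraType (boxes S JJ).
have mid : measurable_fun setT (id : T -> V).
  move=> _ B sB; rewrite setTI.
  have := @smallest_sub _ _ _ _ (@sigma_algebra_measurable _ T) (boxes_measurable S_meas (J
    := JJ)).
  exact.
pose h (p : V * R) := psi (gsum grp xi os p.1 + a + pt (grp o) p.2).
have mxV p : p \in os -> measurable_fun setT (xi p : V -> R).
  move=> pos _ B mB; rewrite setTI; apply: sub_sigma_algebra.
  apply: (boxes_sub S_setT (i := idx p)); last exact: xi_S.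
  by apply/imfsetP; exists p.
have mh : measurable_fun setT h.
  apply: measurable_orthant => g.
  apply: measurable_funD.
    have := measurable_gsum a g mxV => m1.
    exact: (measurableT_comp m1 measurable_fst).
  by rewrite /pt; case: eqP => // _; exact: measurable_snd.
have [] := @indep_fubini R d T P _ _ V R id (xi o) h mid (mxi o) _ mh.
- move=> B C' sB mC; apply: (grouping S_indep S_meas S_setT S_setI (J := JJ) (i0 := idx o))
  => //.
    by apply/imfsetP => -[p /= pos /idx_inj op]; rewrite op pos in oos.
  exact: xi_S.
- by exists 1 => p; exact: orthant_itv.
by [].
Qed.

Lemma lindeberg_independent :
  `|ev (PE P) (fun w => psi (gsum grp xi (index_enum O) w)) -
    avg (fun r => psi (radsum grp tau r))| <=
  \sum_o (4 * C * (ev (PE P) (fun w => trunc3 (xi o w)) + `|tau o| ^+ 3) +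
          C * `|ev (PE P) (fun w => xi o w ^+ 2) - tau o ^+ 2|).
Proof.
have Dxi o : dom (PE P) (xi o) by exact: PE_L2_L1.
apply: lindeberg_rademacher => //.
- move=> os a; apply: dom_psi => g; exact: measurable_gsum.
- move=> o a; apply: dom_psi => g; apply: measurable_funD => //.
  by rewrite /pt; case: eqP.
- by move=> o os a oos; have [] := indep a oos.
- by move=> o os a oos; have [] := indep a oos.
- move=> o; apply: (@PE_le _ _ _ P _ _ _ (xi_L2 o)).
    apply: measurable_minr; first exact: measurable_funX.
    by apply: measurable_funX; exact: measurable_norm.
  move=> w; rewrite ger0_norm ?trunc3_ge0// ger0_norm ?sqr_ge0//.
  exact: trunc3_le_sqr.
Qed.

End lindeberg_independent.

(** * The estimator and its linearisation *)

Section master.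
Context {R : realType} {K d : nat}.
Variables (w : 'rV[R]_K) (m : 'M[R]_(K, d)) (beta : 'cV[R]_(1 + d)).
Hypothesis w_pos : forall k, 0 < w 0 k.
Hypothesis full_rank : \rank (design m) = (1 + d)%N.

Definition group : finType := ('I_K + 'I_K)%type.

Definition influence (j : 'I_(1 + d)) (g : group) : R :=
  match g with
  | inl k => wls w (design m) j k
  | inr k => - wls w (design m) j k
  end.

(** To first order the regressors act only through their score along [beta], so each of the 2K
    samples contributes one real coordinate. *)
Definition increment (s : R) (y : 'cV[R]_K) (x : 'M[R]_(K, d)) (g : group) : R :=
  match g with
  | inl k => s * y k 0
  | inr k => s * \sum_l beta (rshift 1 l) 0 * x k l
  end.

Lemma lin_increment s (y0 y1 : 'cV[R]_K) (m0 m1 : 'M[R]_(K, d)) j :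
  lin influence (increment s (y1 - y0) (m1 - m0)) j =
  (wls w (design m) *m (s *: ((y1 - y0) - (design m1 - design m0) *m beta))) j 0.
Proof.
rewrite /lin mxE (big_sumType _ _ _)/= -big_split/=; apply: eq_bigr => k _.
set X := y1 - y0 - _.
have -> : (s *: X) k 0 = s * X k 0 by rewrite mxE.
rewrite {}/X; have -> : ((y1 - y0) - (design m1 - design m0) *m beta) k 0 =
    (y1 - y0) k 0 - \sum_l beta (rshift 1 l) 0 * (m1 - m0) k l.
  rewrite [LHS]mxE; congr (_ + _); rewrite [LHS]mxE; congr (- _).
  have dD j' : (design m1 - design m0) k j' = design m1 k j' - design m0 k j'.
    by rewrite [LHS]mxE; congr (_ + _); rewrite [LHS]mxE.
  rewrite mxE big_split_ord/= big1 ?add0r; last first.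
    by move=> i _; rewrite dD /design !row_mxEl !mxE subrr mul0r.
  apply: eq_bigr => l _; rewrite dD /design !row_mxEr mulrC; congr (_ * _).
  by rewrite [RHS]mxE; congr (_ + _); rewrite [RHS]mxE.
by ring.
Qed.

Variables (sig : group -> R) (J : pred 'I_(1 + d)) (c0 : R).
Hypothesis c0_gt0 : 0 < c0.
Hypothesis c0P : forall j, J j -> exists g, c0 <= `|influence j g * sig g|.

(* For the data, (m0, y0, b0) are the population values; for the bootstrap they
   are the values on the sample. *)
Lemma master_bound (e V : R) : 0 < e -> 0 <= V -> exists2 eta, 0 < eta &
  exists N, forall n, (N <= n)%N ->
  forall (Om : Type) (E : expectation R Om) (m0 : 'M[R]_(K, d)) (y0 : 'cV[R]_K)
    (b0 : 'cV[R]_(1 + d)) (m1 : Om -> 'M[R]_(K, d)) (y1 : Om -> 'cV[R]_K)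
    (b1 : Om -> 'cV[R]_(1 + d)) (lam : R),
  let s := Num.sqrt n%:R in
  let U v := increment s (y1 v - y0) (m1 v - m0) in
  let T v j := (s *: (b1 v - b0)) j 0 in
  mxle (m0 - m) eta -> mxle (b0 - beta) eta -> mxle (y0 - design m0 *m b0) eta ->
  (design m0)^T *m diag_mx w *m (y0 - design m0 *m b0) = 0 ->
  (forall v, \rank (design (m1 v)) = (1 + d)%N ->
    b1 v = wls w (design (m1 v)) *m y1 v) ->
  (forall L k, 0 < L -> dom E (fun v => ind (L <= `|s * (y1 v - y0) k 0|)) /\
    ev E (fun v => ind (L <= `|s * (y1 v - y0) k 0|)) <= V / L ^+ 2) ->
  (forall L k l, 0 < L -> dom E (fun v => ind (L <= `|s * (m1 v - m0) k l|)) /\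
    ev E (fun v => ind (L <= `|s * (m1 v - m0) k l|)) <= V / L ^+ 2) ->
  (forall a t, dom E (fun v => orthant J influence a t (U v))) ->
  (forall C a t, smooth C (orthant J influence a t) ->
    `|ev E (fun v => orthant J influence a t (U v)) -
      avg (fun r => orthant J influence a t (@rad R group sig n r))| <= C * lam) ->
  lam <= eta ->
  (forall t, dom E (fun v => ind (below J (T v) t))) ->
  forall t, `|ev E (fun v => ind (below J (T v) t)) - radcdf J influence sig n t| <= e.
Proof.
move=> e0 V0.
(* Error budget: e/4 for Chebyshev's bound over the K + K d entries, e/4 for the swaps, e/8 for the
   window of length 2h and e/8 for the term in 1 / sqrt n. L is chosen first, then h, then C, and
   finally n. *)
pose q : R := (K + K * d)%N%:R.
have q0 : 0 <= q by exact: ler0n.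
have [L L0 qL] : exists2 L : R, 0 < L & q * (V / L ^+ 2) <= e / 4.
  exists (Num.sqrt (4 * q * V / e + 1)).
    by rewrite sqrtr_gt0 ltr_wpDl// !mulr_ge0// invr_ge0 ltW.
  have p : 0 <= 4 * q * V / e by rewrite !mulr_ge0// invr_ge0 ltW.
  rewrite sqr_sqrtr ?addr_ge0// mulrA ler_pdivrMr; last by rewrite ltr_wpDl.
  have -> : q * V = e / 4 * (4 * q * V / e) by field; rewrite gt_eqF.
  by rewrite ler_wpM2l ?lerDl// divr_ge0// ltW.
pose D : R := #|{: 'I_(1 + d)}|%:R.
have D0 : 0 <= D by exact: ler0n.
pose h := e / 8 * c0 / (2 * D + 1).
have D1 : 0 < 2 * D + 1 by lra.
have h0 : 0 < h by rewrite !divr_gt0// !mulr_gt0 ?invr_gt0.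
have Dh : D * (2 * h / c0) <= e / 8.
  have -> : D * (2 * h / c0) = e / 8 * (2 * D / (2 * D + 1)).
    by rewrite /h; field; rewrite !gt_eqF.
  rewrite ler_piMr//; first by rewrite divr_ge0// ltW.
  by rewrite ler_pdivrMr// mul1r lerDl.
have [eta0 eta00 pert] := wls_perturbation w_pos full_rank beta (ltW L0) h0.
have [C C0 Csm] : exists2 C, 0 <= C & forall t, smooth C (orthant J influence (3 / h) t).
  have [C Csm] := orthant_smooth J influence (3 / h); exists `|C| => // t u g.
  exact: jet2_le (ler_norm C) (Csm t u g).
exists (Num.min (eta0 / 2) (e / 4 / (C + 1))).
  by rewrite lt_min !divr_gt0// ltr_wpDl.
(* The three summands ensure D / sqrt n <= e/8, L / sqrt n <= eta0/2 and sqrt n > 0. *)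
pose N := (Num.truncn ((8 * D / e + 2 * L / eta0 + 1) ^+ 2)).+1.
exists N => n Nn Om E m0 y0 b0 m1 y1 b1 lam s U T m0m b0b r0 ne b1E cy cx dU close lame dT t.
have xpos : 0 <= 8 * D / e + 2 * L / eta0 + 1.
  by rewrite !addr_ge0// !mulr_ge0// ?invr_ge0 ltW.
have sn : 8 * D / e + 2 * L / eta0 + 1 <= s.
  rewrite /s -[leLHS]ger0_norm// -sqrtr_sqr.
  rewrite ler_wsqrtr// ltW// (lt_le_trans (truncnS_gt _))//.
  by rewrite ler_nat.
have s0 : 0 < s.
  apply: lt_le_trans sn; rewrite ltr_wpDl// addr_ge0// !mulr_ge0// ?invr_ge0 ltW//.
have n0 : (0 < n)%N by apply: leq_trans Nn.
have sD : D / s <= e / 8.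
  rewrite ler_pdivrMr//; apply: (@le_trans _ _ (e / 8 * (8 * D / e))).
    by rewrite le_eqVlt; apply/orP; left; apply/eqP; field; rewrite gt_eqF.
  rewrite ler_wpM2l//; first by rewrite divr_ge0// ltW.
  apply: le_trans sn; rewrite -addrA lerDl addr_ge0//.
  by rewrite !mulr_ge0// ?invr_ge0 ltW.
have sL : L / s <= eta0 / 2.
  rewrite ler_pdivrMr//; apply: (@le_trans _ _ (eta0 / 2 * (2 * L / eta0))).
    by rewrite le_eqVlt; apply/orP; left; apply/eqP; field; rewrite gt_eqF.
  rewrite ler_wpM2l//; first by rewrite divr_ge0// ltW.
  apply: le_trans sn; rewrite -addrA addrCA lerDl addr_ge0//.
  by rewrite !mulr_ge0// ?invr_ge0 ltW.
(* A count of the scaled entries of size at least L, so [bad v < 1] means that there is none. *)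
pose bad v := \sum_k ind (L <= `|s * (y1 v - y0) k 0|) +
  \sum_k \sum_l ind (L <= `|s * (m1 v - m0) k l|) : R.
have Dbad : dom E bad.
  apply: domD; first by apply: dom_sum => k; exact: (cy L k L0).1.
  by apply: dom_sum => k; apply: dom_sum => l; exact: (cx L k l L0).1.
have bad0 v : 0 <= bad v.
  by rewrite addr_ge0//; apply: sumr_ge0 => *; [|apply: sumr_ge0 => *]; exact: ind_ge0.
have Ebad : ev E bad <= e / 4.
  apply: le_trans qL; rewrite /q natrD natrM mulrDl /bad evD; last 2 first.
  - by apply: dom_sum => k; exact: (cy L k L0).1.
  - by apply: dom_sum => k; apply: dom_sum => l; exact: (cx L k l L0).1.
  rewrite !ev_sum; last 2 first.
  - by move=> k; apply: dom_sum => l; exact: (cx L k l L0).1.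
  - by move=> k; exact: (cy L k L0).1.
  apply: lerD.
    apply: (@le_trans _ _ (\sum_(k < K) V / L ^+ 2)); last first.
      by rewrite sumr_const card_ord mulr_natl.
    by apply: ler_sum => k _; exact: (cy L k L0).2.
  apply: (@le_trans _ _ (\sum_(k < K) d%:R * (V / L ^+ 2))); last first.
    by rewrite sumr_const card_ord -mulrA [leRHS]mulr_natl.
  apply: ler_sum => k _; rewrite ev_sum; last by move=> l; exact: (cx L k l L0).1.
  apply: (@le_trans _ _ (\sum_(l < d) V / L ^+ 2)); last first.
    by rewrite sumr_const card_ord mulr_natl.
  by apply: ler_sum => l _; exact: (cx L k l L0).2.
have good v : bad v < 1 -> mxle (s *: (y1 v - y0)) L /\ mxle (s *: (m1 v - m0)) L.
  move=> b1lt; split.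
    move=> k j; rewrite (ord1 j) mxE leNgt; apply/negP => Lk.
    move: b1lt; apply/negP; rewrite -leNgt /bad (bigD1 k)//= (ltW Lk) -!addrA lerDl.
    by rewrite addr_ge0//; apply: sumr_ge0 => *; [|apply: sumr_ge0 => *]; exact: ind_ge0.
  move=> k l; rewrite mxE leNgt; apply/negP => Lk.
  move: b1lt; apply/negP; rewrite -leNgt /bad [X in _ + X](bigD1 k)//=.
  rewrite [X in _ + (X + _)](bigD1 l)//= (ltW Lk) -[leLHS]add0r lerD//.
    by apply: sumr_ge0 => *; exact: ind_ge0.
  rewrite -addrA lerDl addr_ge0//; apply: sumr_ge0 => *; first exact: ind_ge0.
  by apply: sumr_ge0 => *; exact: ind_ge0.
have mono p r (M : 'M[R]_(p, r)) x y : x <= y -> mxle M x -> mxle M y.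
  by move=> xy Mx i j; exact: le_trans (Mx i j) xy.
have etal : Num.min (eta0 / 2) (e / 4 / (C + 1)) <= eta0 / 2 by rewrite ge_min lexx.
have etar : Num.min (eta0 / 2) (e / 4 / (C + 1)) <= e / 4 / (C + 1).
  by rewrite ge_min lexx orbT.
have eta2 : eta0 / 2 <= eta0 by lra.
have apx v : bad v < 1 -> forall j, J j -> `|T v j - lin influence (U v) j| <= h.
  move=> /good[yL mL] j _; rewrite lin_increment.
  (* Half of eta0 goes to m0 - m, the other half to m1 - m0, which is at most L / sqrt n. Near m the
     design has full rank, so the formula for b1 is in force. *)
  have m1m : mxle (m1 v - m) eta0.
    rewrite -(subrK m0 (m1 v)) -addrA -[eta0]/(eta0) (_ : eta0 = eta0 / 2 + eta0 / 2); last
      by field.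
    apply: mxleD; last exact: mono m0m.
    move=> k l; have := mL k l; rewrite mxE normrM (gtr0_norm s0) => sl.
    apply: le_trans sL; rewrite ler_pdivlMr// mulrC; exact: sl.
  have b0b' : mxle (b0 - beta) eta0 by apply: mono b0b; exact: le_trans eta2.
  have r0' : mxle (y0 - design m0 *m b0) eta0 by apply: mono r0; exact: le_trans eta2.
  have := pert s m0 (m1 v) y0 (y1 v) b0 (b1 v) m1m b0b' r0' ne (b1E v) yL mL j 0.
  by rewrite mxE [X in _ + X]mxE.
have lam_small : C * lam <= e / 4.
  apply: (@le_trans _ _ (C * (e / 4 / (C + 1)))).
    by rewrite ler_wpM2l// (le_trans lame).
  rewrite mulrCA ler_piMr//; first by rewrite divr_ge0// ltW.
  by rewrite ler_pdivrMr ?mul1r ?lerDl// ltr_wpDl.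
have := @kolmogorov_bound R _ group J influence sig n c0 c0_gt0 c0P n0 Om E U T bad h
  (C * lam) h0 Dbad bad0 apx (dU (3 / h)) dT (fun t => close C (3 / h) t (Csm t)) t.
move/le_trans; apply; rewrite /window -/D mulrDr.
have := Dh; have := sD; rewrite /s; lra.
Qed.

End master.

Section consistency.
Context {R : realType} {K d : nat}.
Variables (w : 'rV[R]_K) (m : 'M[R]_(K, d)) (beta : 'cV[R]_(1 + d)).
Hypothesis w_pos : forall k, 0 < w 0 k.
Hypothesis full_rank : \rank (design m) = (1 + d)%N.

Lemma mxle_design (m0 m1 : 'M[R]_(K, d)) (c : R) : 0 <= c -> mxle (m1 - m0) c ->
  mxle (design m1 - design m0) c.
Proof.
move=> c0 mc i j; rewrite /design opp_row_mx add_row_mx.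
case: (split_ordP j) => j' ->; last by rewrite row_mxEr.
by rewrite row_mxEl !mxE subrr normr0.
Qed.

(** Supplies what [master_bound] asks of a base point computed from a sample. Indeed b' - beta = wls
    (y' - M' beta), and y' - M' beta is small since y' is near M beta and M' near M. *)
Lemma wls_consistency (eta : R) : 0 < eta -> exists2 del, 0 < del &
  forall (m' : 'M[R]_(K, d)) (y' : 'cV[R]_K) (b' : 'cV[R]_(1 + d)),
  mxle (m' - m) del -> mxle (y' - design m *m beta) del ->
  (\rank (design m') = (1 + d)%N -> b' = wls w (design m') *m y') ->
  [/\ mxle (b' - beta) eta, mxle (y' - design m' *m b') eta &
    (design m')^T *m diag_mx w *m (y' - design m' *m b') = 0].
Proof.
move=> eta0.
have [a a0 Aa] := mxle_ex (wls w (design m)).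
have [e e0 eP] := mxle_ex beta.
have [f f0 fP] := mxle_ex (design m).
have [b b0 [del1 del10 delP]] := wls_continuous w_pos full_rank (ltr01 (R := R)).
pose q1 := 1 + (1 + d)%:R * e.
pose q2 := K%:R * ((a + 1) * q1).
pose q3 := q1 + (1 + d)%:R * ((f + del1) * q2).
have q10 : 0 <= q1 by rewrite addr_ge0// mulr_ge0.
have q20 : 0 <= q2 by rewrite !mulr_ge0// addr_ge0.
have q30 : 0 <= q3 by rewrite !addr_ge0// !mulr_ge0// addr_ge0// ltW.
pose del := Num.min del1 (eta / (q2 + q3 + 1)).
have qp : 0 < q2 + q3 + 1 by rewrite ltr_wpDl// addr_ge0.
have del0 : 0 < del by rewrite lt_min del10 divr_gt0.
exists del => // m' y' b' mm yy bE.
have mono p r (M : 'M[R]_(p, r)) x y : x <= y -> mxle M x -> mxle M y.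
  by move=> xy Mx i j; exact: le_trans (Mx i j) xy.
have dd1 : del <= del1 by rewrite ge_min lexx.
have [uG wA _] := delP _ (mono _ _ _ _ _ dd1 mm).
have {}bE := bE (rank_gram uG).
have W1 : mxle (wls w (design m')) (a + 1).
  by rewrite -(subrKC (wls w (design m)) (wls w (design m'))); apply: mxleD.
have r1 : mxle (y' - design m' *m beta) (del * q1).
  have -> : y' - design m' *m beta =
      (y' - design m *m beta) + - ((design m' - design m) *m beta).
    by rewrite mulmxBl opprB addrA subrK.
  apply: mono (mxleD yy (mxleN (mxleM (mxle_design (ltW del0) mm) eP))).
  by rewrite le_eqVlt /q1; apply/orP; left; apply/eqP; ring.
have bb : b' - beta = wls w (design m') *m (y' - design m' *m beta).
  by rewrite mulmxBr mulmxA wlsK// mul1mx -bE.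
have bq : mxle (b' - beta) (del * q2).
  rewrite bb; apply: mono (mxleM W1 r1).
  by rewrite le_eqVlt /q2; apply/orP; left; apply/eqP; ring.
have Mf : mxle (design m') (f + del1).
  rewrite -(subrKC (design m) (design m')); apply: mxleD => //.
  by apply: mxle_design (ltW del10) _; exact: mono mm.
have rq : mxle (y' - design m' *m b') (del * q3).
  have -> : y' - design m' *m b' =
      (y' - design m' *m beta) + - (design m' *m (b' - beta)).
    by rewrite mulmxBr opprB addrA subrK.
  apply: mono (mxleD r1 (mxleN (mxleM Mf bq))).
  by rewrite le_eqVlt /q3; apply/orP; left; apply/eqP; ring.
have dq x : 0 <= x -> x <= q2 + q3 + 1 -> del * x <= eta.
  move=> x0 xq; apply: (@le_trans _ _ (eta / (q2 + q3 + 1) * x)).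
    by rewrite ler_wpM2r// ge_min lexx orbT.
  rewrite -mulrA ler_piMr ?(ltW eta0)//.
  by rewrite mulrC ler_pdivrMr// mul1r.
split.
- by apply: mono bq; apply: dq => //; lra.
- by apply: mono rq; apply: dq => //; lra.
- by rewrite bE; exact: normal_equations.
Qed.

End consistency.

Section lindeberg_condition.
Context {R : realType}.

(** The cube is used for |u| <= M, where scaling leaves a factor 1 / sqrt n, and the square beyond
    M. *)
Lemma trunc3_scale n (u M : R) : (0 < n)%N -> 0 <= M ->
  n%:R * trunc3 (u / Num.sqrt n%:R) <=
  M ^+ 3 / Num.sqrt n%:R + u ^+ 2 * ind (M < `|u|).
Proof.
move=> n0 M0; set s := Num.sqrt n%:R.
have s0 : 0 < s by rewrite sqrtr_gt0 ltr0n.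
have s2 : n%:R = s ^+ 2 by rewrite sqr_sqrtr// ler0n.
rewrite s2; case: ltP => Mu.
  rewrite mulr1; apply: (@le_trans _ _ (u ^+ 2)); last first.
    by rewrite lerDr divr_ge0 ?exprn_ge0// ltW.
  apply: le_trans (ler_wpM2l (exprn_ge0 _ (ltW s0)) (trunc3_le_sqr _)) _.
  rewrite le_eqVlt; apply/orP; left; apply/eqP; field; exact: lt0r_neq0.
rewrite mulr0 addr0.
apply: le_trans (ler_wpM2l (exprn_ge0 _ (ltW s0)) (trunc3_le_norm _)) _.
rewrite normrM (gtr0_norm (_ : 0 < s^-1)) ?invr_gt0//.
have -> : s ^+ 2 * (`|u| / s) ^+ 3 = `|u| ^+ 3 / s by field; exact: lt0r_neq0.
by rewrite ler_wpM2r ?invr_ge0 ?(ltW s0)// lerXn2r ?nnegrE.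
Qed.

(** If |z - c| > 2M with |c| <= M, then |z| > M and |z - c| <= 2 |z|. Doubling the threshold and a
    factor 4 thus remove the centring from the tail. *)
Lemma lindeberg_small Om (E : expectation R Om) (z : Om -> R) (c M : R) n :
  (0 < n)%N -> `|c| <= M ->
  dom E (fun v => trunc3 ((z v - c) / Num.sqrt n%:R)) ->
  dom E (fun v => z v ^+ 2 * ind (M < `|z v|)) ->
  n%:R * ev E (fun v => trunc3 ((z v - c) / Num.sqrt n%:R)) <=
  (2 * M) ^+ 3 / Num.sqrt n%:R + 4 * ev E (fun v => z v ^+ 2 * ind (M < `|z v|)).
Proof.
move=> n0 cM D3 D2; have M0 : 0 <= M by exact: le_trans cM.
rewrite -!evZ// -[X in X + _](ev_cst E) -evD; [|exact: dom_cst|exact: domZ].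
apply: ev_le; [exact: domZ|by apply: domD; [exact: dom_cst|exact: domZ]|].
move=> v; apply: le_trans (trunc3_scale _ n0 (_ : 0 <= 2 * M)) _; first by rewrite mulr_ge0.
rewrite lerD2l; case: (ltP (2 * M) `|z v - c|) => Mz; last first.
  by rewrite mulr0 mulr_ge0// mulr_ge0 ?sqr_ge0 ?ind_ge0.
have zc : `|z v - c| <= `|z v| + M by apply: le_trans (ler_normB _ _) _; rewrite lerD2l.
have Mzv : M < `|z v| by lra.
rewrite Mzv !mulr1 -(real_normK (num_real (z v - c))) -(real_normK (num_real (z v))).
have -> : 4 * `|z v| ^+ 2 = (2 * `|z v|) ^+ 2 by ring.
by rewrite lerXn2r ?nnegrE ?mulr_ge0//; lra.
Qed.

End lindeberg_condition.

Section resampling.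
Context {R : realType} {Gam : finType} {n : nat} (n_gt0 : (0 < n)%N).

Let i0 : 'I_n := Ordinal n_gt0.

Definition resample : expectation R {ffun Gam * 'I_n -> 'I_n} :=
  uniform [ffun=> i0].

Lemma resample_proj o (h : 'I_n -> R) :
  ev resample (fun v => h (v o)) = avg h.
Proof. exact: (avg_proj o h i0). Qed.

Lemma avg_ord (h : nat -> R) : avg (fun i : 'I_n => h i) = n%:R^-1 * \sum_(i < n) h i.
Proof. by rewrite /avg card_ord mulrC. Qed.

(** Averaging over one of two distinct draws already kills their cross term. *)
Lemma resample_second_moment g (f : 'I_n -> R) : avg f = 0 ->
  ev resample (fun v => (\sum_i f (v (g, i))) ^+ 2) = n%:R * avg (fun i => f i ^+ 2).
Proof.
move=> f0.
have cross : {in index_enum 'I_n &, forall i j, i != j ->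
    ev resample (fun v => f (v (g, i)) * f (v (g, j))) = 0}.
  move=> i j _ _ ij; rewrite /= (avg_resample (g, i)).
  rewrite (_ : (fun s => _) = fun=> 0); first by rewrite (avg_cst [ffun=> i0]).
  apply/funext => s; rewrite (_ : (fun x => _) = fun x => f (s (g, j)) * f x + 0).
    by rewrite avg_lin f0 mulr0 add0r (avg_cst i0).
  apply/funext => x; rewrite updE ffunE addr0 mulrC xpair_eqE eqxx/=.
  by rewrite eq_sym (negPf ij).
have [_ ->] := ev_sqr_sum (E := resample) (x := fun i v => f (v (g, i)))
  (index_enum_uniq _) (fun _ _ => I) cross.
rewrite (eq_bigr (fun=> avg (fun i => f i ^+ 2))).
  by rewrite sumr_const card_ord mulr_natl.
by move=> i _; exact: (resample_proj (g, i) (fun x => f x ^+ 2)).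
Qed.

Lemma resample_chebyshev g (f : 'I_n -> R) (L : R) : avg f = 0 -> 0 < L ->
  ev resample (fun v => ind (L <= `|\sum_i f (v (g, i))|)) <=
  n%:R * avg (fun i => f i ^+ 2) / L ^+ 2.
Proof.
by move=> f0 L0; rewrite -(resample_second_moment g f0); exact: ev_chebyshev.
Qed.

Lemma lindeberg_resample (sig : Gam -> R) (c : Gam -> 'I_n -> R) C psi :
  (forall g, avg (c g) = 0) -> smooth C psi ->
  `|ev resample (fun v => psi (fun g => \sum_i c g (v (g, i)))) -
    avg (fun r => psi (@rad R Gam sig n r))| <=
  C * \sum_(o : Gam * 'I_n)
    (4 * (avg (fun i => trunc3 (c o.1 i)) + `|sig o.1 / Num.sqrt n%:R| ^+ 3) +
     `|avg (fun i => c o.1 i ^+ 2) - (sig o.1 / Num.sqrt n%:R) ^+ 2|).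
Proof.
move=> c0 psiC.
pose xi o (v : {ffun Gam * 'I_n -> 'I_n}) := c o.1 (v o).
have gs v : gsum fst xi (index_enum (Gam * 'I_n)%type) v = (fun g => \sum_i c g (v (g, i))).
  apply/funext => g; rewrite /gsum fct_sumE.
  transitivity (\sum_g' \sum_i pt g' (c g' (v (g', i))) g).
    by rewrite pair_big/=; apply: eq_bigr => -[].
  rewrite (bigD1 g)//= [X in _ + X]big1 ?addr0.
    by apply: eq_bigr => i _; rewrite /pt eqxx.
  by move=> g' /negPf gg'; apply: big1 => i _; rewrite /pt eq_sym gg'.
have indep (o : Gam * 'I_n) os a : o \notin os ->
  ev resample (fun v => psi (gsum fst xi os v + a + pt o.1 (xi o v))) =
  ev resample (fun v => ev resample (fun v' => psi (gsum fst xi os v + a + pt o.1 (xi o v')))).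
  exact: (@finite_indep R Gam _ _ fst (fun o i => c o.1 i) i0).
have xi0 o : ev resample (xi o) = 0 by rewrite (resample_proj o (c o.1)).
have := @lindeberg_rademacher _ _ _ _ resample fst xi
  (fun o => sig o.1 / Num.sqrt n%:R) psi C psiC
  (fun _ _ => I) (fun _ _ => I) (fun _ _ _ _ => I) indep
  (fun _ => I) (fun _ => I) (fun _ => I) xi0.
under [X in ev _ X]eq_fun do rewrite gs.
move=> /le_trans; apply; rewrite mulr_sumr; apply: ler_sum => o _.
rewrite (resample_proj o (fun i => trunc3 (c o.1 i))) (resample_proj o (fun i => c o.1 i ^+ 2)).
by rewrite le_eqVlt; apply/orP; left; apply/eqP; ring.
Qed.

End resampling.

(** * Bootstrap *)

Section empirical_limits.
Context {R : realType}.

Definition mean (n : nat) (f : nat -> R) : R := n%:R^-1 * \sum_(i < n) f i.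

Lemma cvg_inv_sqrt : (Num.sqrt (n%:R : R))^-1 @[n --> \oo] --> (0 : R).
Proof.
apply/cvgrPdist_le => e e0.
exists (Num.truncn (e^-1 ^+ 2)).+1 => // n /= Nn.
have n1 : e^-1 ^+ 2 <= n%:R.
  by rewrite ltW// (lt_le_trans (truncnS_gt _))// ler_nat.
have s0 : e^-1 <= Num.sqrt n%:R.
  by rewrite -[leLHS]ger0_norm ?invr_ge0 ?(ltW e0)// -sqrtr_sqr ler_wsqrtr.
have sp : 0 < Num.sqrt (n%:R : R) by apply: lt_le_trans s0; rewrite invr_gt0.
rewrite sub0r normrN gtr0_norm ?invr_gt0//.
by rewrite -[leRHS]invrK lef_pV2// posrE invr_gt0.
Qed.

Definition centered n (f : nat -> R) (i : nat) : R := (f i - mean n f) / Num.sqrt n%:R.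

Lemma avg_centered n (f : nat -> R) : (0 < n)%N ->
  avg (fun i : 'I_n => centered n f i) = 0.
Proof.
move=> n0; rewrite avg_ord; apply/eqP; rewrite mulf_eq0; apply/orP; right.
rewrite -mulr_suml mulf_eq0 sumrB sumr_const card_ord /mean -[_ *+ n]mulr_natl mulVKf ?subrr
  ?eqxx//.
by rewrite pnatr_eq0 -lt0n.
Qed.

Lemma avg_centered_sqr n (f : nat -> R) : (0 < n)%N ->
  n%:R * avg (fun i : 'I_n => centered n f i ^+ 2) =
  mean n (fun i => f i ^+ 2) - mean n f ^+ 2.
Proof.
move=> n0; have n1 : n%:R != 0 :> R by rewrite pnatr_eq0 -lt0n.
have s2 : (Num.sqrt n%:R) ^- 2 = n%:R^-1 :> R by rewrite sqr_sqrtr// ler0n.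
rewrite (avg_ord (fun i => centered n f i ^+ 2)) mulVKf//.
transitivity (\sum_(i < n) (n%:R^-1 * (f i ^+ 2) + (- (2 * mean n f / n%:R) * f i +
   mean n f ^+ 2 / n%:R))).
  by apply: eq_bigr => i _; rewrite /centered expr_div_n -s2; ring.
rewrite !big_split/= -!mulr_sumr sumr_const card_ord.
have -> : \sum_(i < n) f i = n%:R * mean n f by rewrite /mean mulVKf.
by rewrite -/(mean n (fun i => f i ^+ 2)) -[_ *+ n]mulr_natl; field.
Qed.

Lemma lindeberg_term_small (z : nat -> R) (mu s2 sig : R) (t : nat -> R) (eta : R) :
  mean n z @[n --> \oo] --> mu ->
  mean n (fun i => z i ^+ 2) @[n --> \oo] --> s2 ->
  sig ^+ 2 = s2 - mu ^+ 2 ->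
  (forall M : nat, mean n (fun i => z i ^+ 2 * ind (M%:R < `|z i|)) @[n --> \oo] --> t M) ->
  t M @[M --> \oo] --> 0 -> 0 < eta ->
  \forall n \near \oo,
    n%:R * (4 * (avg (fun i : 'I_n => trunc3 (centered n z i)) +
                 `|sig / Num.sqrt n%:R| ^+ 3) +
            `|avg (fun i : 'I_n => centered n z i ^+ 2) - (sig / Num.sqrt n%:R) ^+ 2|)
    <= eta.
Proof.
move=> zmu zs2 sigE zt t0 eta0.
(* The margin 1 keeps the empirical mean below M eventually, as [lindeberg_small] requires; the
   limit of [B n] is 16 t M. *)
have [M [Mmu tM]] : exists M : nat, `|mu| + 1 <= M%:R /\ t M < eta / 16.
  have /cvgr_lt /(_ (eta / 16)) [|N _ NP] := t0; first by rewrite divr_gt0.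
  exists (maxn N (Num.truncn (`|mu| + 1)).+1); split; last by apply: NP; rewrite /= leq_maxl.
  by rewrite ltW// (lt_le_trans (truncnS_gt _))// ler_nat leq_maxr.
pose B n := 4 * ((2 * M%:R) ^+ 3 * (Num.sqrt n%:R)^-1 +
    4 * mean n (fun i => z i ^+ 2 * ind (M%:R < `|z i|)) +
    `|sig| ^+ 3 * (Num.sqrt n%:R)^-1) +
  `|mean n (fun i => z i ^+ 2) - mean n z ^+ 2 - sig ^+ 2|.
have BB : B n @[n --> \oo] --> 4 * ((2 * M%:R) ^+ 3 * 0 + 4 * t M + `|sig| ^+ 3 * 0) +
    `|s2 - mu ^+ 2 - sig ^+ 2|.
  have cM (a b : R) (f : nat -> R) : f n @[n --> \oo] --> b -> a * f n @[n --> \oo] --> a * b.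
    by move=> fb; apply: cvgM => //; exact: cvg_cst.
  apply: cvgD.
    apply: (cM); apply: cvgD; last by apply: (cM); exact: cvg_inv_sqrt.
    apply: cvgD; first by apply: (cM); exact: cvg_inv_sqrt.
    by apply: (cM); exact: zt.
  apply: cvg_norm; apply: cvgB; last exact: cvg_cst.
  by apply: cvgB => //; rewrite expr2; under eq_cvg do rewrite expr2; exact: cvgM.
have {}BB : \forall n \near \oo, B n < eta.
  apply: (cvgr_lt _ BB); rewrite !mulr0 add0r addr0 sigE subrr normr0 addr0; lra.
have mM : \forall n \near \oo, `|mean n z| <= M%:R.
  have /cvgrPdist_le /(_ 1 ltr01) := zmu; apply: filterS => n zn.
  by apply: le_trans Mmu; rewrite -(subrK mu (mean n z)) addrC (le_trans (ler_normD _ _))//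
    lerD2l distrC.
have np : \forall n \near \oo, (0 < n)%N by exists 1%N.
near=> n.
have n0 : (0 < n)%N by near: n.
have zM : `|mean n z| <= M%:R by near: n.
apply: le_trans (ltW (_ : B n < eta)); last by near: n.
have nR : 0 < n%:R :> R by rewrite ltr0n.
rewrite mulrDr mulrCA mulrDr /B; apply: lerD; last first.
  rewrite -[X in X * `|_|]gtr0_norm// -normrM mulrBr avg_centered_sqr//.
  rewrite le_eqVlt; apply/orP; left; apply/eqP; congr `|_ - _|.
  by rewrite expr_div_n sqr_sqrtr ?ler0n// mulrCA mulfV ?mulr1// gt_eqF.
rewrite ler_wpM2l//; apply: lerD; last first.
  have s0 : 0 < Num.sqrt n%:R :> R by rewrite sqrtr_gt0.
  have si : 0 < (Num.sqrt n%:R)^-1 :> R by rewrite invr_gt0.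
  rewrite normrM (gtr0_norm si) exprMn mulrCA ler_wpM2l ?exprn_ge0//.
  have nE : n%:R = Num.sqrt n%:R ^+ 2 :> R by rewrite sqr_sqrtr// ler0n.
  rewrite {1}nE le_eqVlt; apply/orP; left; apply/eqP.
  by field; rewrite gt_eqF.
have := @lindeberg_small R _ (uniform (Ordinal n0)) (fun i => z i) (mean n z) M%:R n n0 zM I I.
move=> /= /le_trans; apply; rewrite lerD2l ler_wpM2l//.
by rewrite (avg_ord (fun i => z i ^+ 2 * ind (M%:R < `|z i|))).
Unshelve. all: by end_near.
Qed.

End empirical_limits.

Lemma mxBE (R : realType) p q (A B : 'M[R]_(p, q)) i j : (A - B) i j = A i j - B i j.
Proof. by rewrite [LHS]mxE [X in _ + X]mxE. Qed.

Lemma Pstar_uniform (R : realType) K n (A : pred (draw K n)) :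
  Pstar A = avg (fun s => ind (A s)) :> R.
Proof.
rewrite /Pstar /avg; congr (_ / _); rewrite -sum1_card natr_sum big_mkcond/=.
by apply: eq_bigr => s _; rewrite unfold_in /ind; case: (A s).
Qed.

Section bootstrap_limit.
Context {R : realType} {K d : nat}.
Variables (w : 'rV[R]_K) (m : 'M[R]_(K, d)) (beta : 'cV[R]_(1 + d)).
Hypothesis w_pos : forall k, 0 < w 0 k.
Hypothesis full_rank : \rank (design m) = (1 + d)%N.
Local Notation group := (group (K := K)).
Variables (sig : group -> R) (J : pred 'I_(1 + d)) (c0 : R).
Hypothesis c0_gt0 : 0 < c0.
Hypothesis c0P : forall j, J j -> exists g, c0 <= `|influence w m j g * sig g|.
Variables (y : 'I_K -> nat -> R) (x : 'I_K -> nat -> d.-tuple R).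

Definition score (g : group) (i : nat) : R :=
  match g with
  | inl k => y k i
  | inr k => linear_part beta (x k i)
  end.

Variables (qy : 'I_K -> R) (qx : 'I_K -> 'I_d -> R) (mu s2 : group -> R)
  (t : group -> nat -> R).
Hypothesis y_mean : forall k, mean n (y k) @[n --> \oo] --> (design m *m beta) k 0.
Hypothesis x_mean : forall k l,
  mean n (fun i => tnth (x k i) l) @[n --> \oo] --> m k l.
Hypothesis y_sqr : forall k, mean n (fun i => y k i ^+ 2) @[n --> \oo] --> qy k.
Hypothesis x_sqr : forall k l,
  mean n (fun i => tnth (x k i) l ^+ 2) @[n --> \oo] --> qx k l.
Hypothesis score_mean : forall g, mean n (score g) @[n --> \oo] --> mu g.
Hypothesis score_sqr : forall g,
  mean n (fun i => score g i ^+ 2) @[n --> \oo] --> s2 g.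
Hypothesis sigE : forall g, sig g ^+ 2 = s2 g - mu g ^+ 2.
Hypothesis score_tail : forall g (M : nat),
  mean n (fun i => score g i ^+ 2 * ind (M%:R < `|score g i|)) @[n --> \oo] --> t g M.
Hypothesis t_cvg : forall g, t g M @[M --> \oo] --> 0.

Let Dr n := {ffun group * 'I_n -> 'I_n}.

(** Turns a table indexed by group and rank, the shape of [resample] and [rad], into the pair of
    tables of a [draw]. *)
Definition draw_of n (v : Dr n) : draw K n :=
  ([ffun k => [ffun i => v (inl k, i)]], [ffun k => [ffun i => v (inr k, i)]]).

Lemma draw_of_bij n : bijective (@draw_of n).
Proof.
exists (fun s : draw K n => [ffun p => match p.1 with
  | inl k => s.1 k p.2 | inr k => s.2 k p.2 end]).
  by move=> v; apply/ffunP => -[[k|k] i]; rewrite ffunE /= !ffunE.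
by move=> [s1 s2']; congr (_, _); apply/ffunP => k; apply/ffunP => i; rewrite !ffunE/=.
Qed.

Lemma Pstar_avg n (A : pred (draw K n)) :
  Pstar A = avg (fun v => ind (A (draw_of v))) :> R.
Proof. by rewrite Pstar_uniform; exact: avg_bij (draw_of_bij n). Qed.

Variables (bS : forall n, draw K n -> 'cV[R]_(1 + d)) (bM : nat -> 'cV[R]_(1 + d)).
Arguments bS : clear implicits.
Hypothesis bM_def : forall n,
  moment_estimate w (fun k (i : 'I_n) => y k i) (fun k (i : 'I_n) => x k i) (bM n).
Hypothesis bS_def : forall n (s : draw K n),
  moment_estimate w (fun k i => y k (s.1 k i)) (fun k i => x k (s.2 k i)) (bS n s).

Let y0 n := sample_mean_Y (fun k (i : 'I_n) => y k i).
Let m0 n := sample_mean_X (fun k (i : 'I_n) => x k i).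
Let y1 n (v : Dr n) := sample_mean_Y (fun k i => y k ((draw_of v).1 k i)).
Let m1 n (v : Dr n) := sample_mean_X (fun k i => x k ((draw_of v).2 k i)).

Let sqrt_mean n (f : nat -> R) (h : 'I_n -> nat) : (0 < n)%N ->
  Num.sqrt n%:R * (n%:R^-1 * \sum_(i < n) f (h i) - mean n f) =
  \sum_(i < n) centered n f (h i).
Proof.
move=> n0; have s0 : Num.sqrt n%:R != 0 :> R by rewrite gt_eqF// sqrtr_gt0 ltr0n.
have nE : n%:R = Num.sqrt n%:R ^+ 2 :> R by rewrite sqr_sqrtr// ler0n.
rewrite /centered -mulr_suml sumrB sumr_const card_ord -[mean n f *+ n]mulr_natl.
move: (mean n f) (\sum_(i < n) f (h i)) => mf sf.
set s := Num.sqrt n%:R in s0 nE *; rewrite nE; by field.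
Qed.

Let dy n (v : Dr n) k : (0 < n)%N -> Num.sqrt n%:R * (y1 v - y0 n) k 0 =
  \sum_(i < n) centered n (y k) (v (inl k, i)).
Proof.
move=> n0; rewrite -sqrt_mean// mxBE; congr (_ * (_ - _)).
  by rewrite mxE; congr (_ * _); apply: eq_bigr => i _; rewrite !ffunE.
by rewrite mxE.
Qed.

Let dx n (v : Dr n) k l : (0 < n)%N -> Num.sqrt n%:R * (m1 v - m0 n) k l =
  \sum_(i < n) centered n (fun i => tnth (x k i) l) (v (inr k, i)).
Proof.
move=> n0; rewrite -(sqrt_mean _ (fun i => v (inr k, i)))// mxBE; congr (_ * (_ - _)).
  by rewrite mxE; congr (_ * _); apply: eq_bigr => i _; rewrite !ffunE.
by rewrite mxE.
Qed.

Let incr n (v : Dr n) : (0 < n)%N ->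
  increment beta (Num.sqrt n%:R) (y1 v - y0 n) (m1 v - m0 n) =
  (fun g => \sum_(i < n) centered n (score g) (v (g, i))).
Proof.
move=> n0; apply/funext => -[k|k] /=; first exact: dy.
transitivity (\sum_(l < d) \sum_(i < n) beta (rshift 1 l) 0 *
    centered n (fun i => tnth (x k i) l) (v (inr k, i))).
  by rewrite mulr_sumr; apply: eq_bigr => l _; rewrite mulrCA dx// mulr_sumr.
rewrite exchange_big/=; apply: eq_bigr => i _.
rewrite /centered /= /linear_part.
transitivity ((\sum_(l < d) (beta (rshift 1 l) 0 * tnth (x k (v (inr k, i))) l -
    beta (rshift 1 l) 0 * mean n (fun i => tnth (x k i) l))) / Num.sqrt n%:R).
  by rewrite mulr_suml; apply: eq_bigr => l _; rewrite mulrA mulrBr.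
rewrite sumrB; congr ((_ - _) / _).
rewrite /mean exchange_big/= mulr_sumr; apply: eq_bigr => l _.
by rewrite mulrCA mulr_sumr.
Qed.

(** The data are fixed sequences, known only through the limits of their empirical moments; the draw
    is the sole source of randomness. The base point is the fitted model, handled by
    [wls_consistency]. *)
Lemma bootstrap_close (e : R) : 0 < e -> \forall n \near \oo, forall T,
  `|Pstar [pred s | below J (fun j => (Num.sqrt n%:R *: (bS n s - bM n)) j 0) T] -
    radcdf J (influence w m) sig n T| <= e.
Proof.
move=> e0.
(* The summand 1 puts V strictly above all the limits, so the empirical second moments are
   eventually below V. *)
pose V := \sum_k `|qy k| + \sum_k \sum_l `|qx k l| + 1.
have V0 : 0 <= V.
  rewrite !addr_ge0//; apply: sumr_ge0 => *; first exact: normr_ge0.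
  by apply: sumr_ge0.
have [eta eta0 [N NP]] := master_bound beta w_pos full_rank c0_gt0 c0P e0 V0.
have [del del0 delP] := wls_consistency beta w_pos full_rank eta0.
pose term g n := 4 * (avg (fun i : 'I_n => trunc3 (centered n (score g) i)) +
    `|sig g / Num.sqrt n%:R| ^+ 3) +
  `|avg (fun i : 'I_n => centered n (score g) i ^+ 2) - (sig g / Num.sqrt n%:R) ^+ 2|.
pose lam n := \sum_(o : group * 'I_n) term o.1 n.
pose eg := eta / (#|group|%:R + 1).
have cg0 : 0 < #|group|%:R + 1 :> R by rewrite ltr_wpDl.
have eg0 : 0 < eg by rewrite divr_gt0.
have lamP : \forall n \near \oo, lam n <= eta.
  have : \forall n \near \oo, forall g : group, n%:R * term g n <= eg.
    apply: filter_forall => g.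
    exact: (lindeberg_term_small (@score_mean g) (@score_sqr g) (sigE g)
      (@score_tail g) (@t_cvg g) eg0).
  apply: filterS => n Hn; rewrite /lam.
  rewrite -(pair_big xpredT xpredT (fun g (_ : 'I_n) => term g n))/=.
  apply: (@le_trans _ _ (\sum_(g : group) eg)).
    by apply: ler_sum => g _; rewrite sumr_const card_ord -[_ *+ n]mulr_natl.
  rewrite sumr_const -[_ *+ _]mulr_natl /eg mulrCA ler_piMr ?(ltW eta0)//.
  by rewrite ler_pdivrMr// mul1r lerDl.
have yP : \forall n \near \oo, mxle (y0 n - design m *m beta) (Num.min eta del).
  apply: near_forall2 => k j.
  have md : 0 < Num.min eta del by rewrite lt_min eta0.
  have /cvgrPdist_le /(_ _ md) := y_mean (k := k); apply: filterS => n.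
  have e1 : y0 n k 0 = mean n (y k) by rewrite mxE.
  by rewrite (ord1 j) distrC mxBE e1.
have mP : \forall n \near \oo, mxle (m0 n - m) (Num.min eta del).
  apply: near_forall2 => k j.
  have md : 0 < Num.min eta del by rewrite lt_min eta0.
  have /cvgrPdist_le /(_ _ md) := x_mean (k := k) (l := j); apply: filterS => n.
  have e1 : m0 n k j = mean n (fun i => tnth (x k i) j) by rewrite mxE.
  by rewrite distrC mxBE e1.
have qyV k : qy k < V.
  apply: le_lt_trans (ler_norm _) _; rewrite /V (bigD1 k)//= -!addrA ltrDl ltr_wpDl//.
    by apply: sumr_ge0.
  by rewrite ltr_wpDl//; apply: sumr_ge0 => *; apply: sumr_ge0.
have qxV k l : qx k l < V.
  apply: le_lt_trans (ler_norm _) _; rewrite /V [X in _ + X + _](bigD1 k)//=.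
  rewrite [X in _ + (X + _) + _](bigD1 l)//=.
  have := @sumr_ge0 R _ (index_enum 'I_K) xpredT (fun k => `|qy k|) (fun _ _ => normr_ge0 _).
  have := @sumr_ge0 R _ (index_enum 'I_d) (fun j => j != l) (fun j => `|qx k j|) (fun _ _ =>
    normr_ge0 _).
  have : 0 <= \sum_(i < K | i != k) \sum_l0 `|qx i l0|.
    by apply: sumr_ge0 => *; apply: sumr_ge0.
  lra.
have yV : \forall n \near \oo, forall k, mean n (fun i => y k i ^+ 2) < V.
  apply: filter_forall => k.
  exact: (cvgr_lt _ (y_sqr (k := k)) _ (qyV k)).
have xV : \forall n \near \oo, forall k l, mean n (fun i => tnth (x k i) l ^+ 2) < V.
  apply: near_forall2 => k l.
  exact: (cvgr_lt _ (x_sqr (k := k) (l := l)) _ (qxV k l)).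
near=> n => T.
have n0 : (0 < n)%N by near: n; exists 1%N.
have Nn : (N <= n)%N by near: n; exists N.
have mono p r (M : 'M[R]_(p, r)) a b : a <= b -> mxle M a -> mxle M b.
  by move=> xy Mx i j; exact: le_trans (Mx i j) xy.
have y0d : mxle (y0 n - design m *m beta) (Num.min eta del) by near: n.
have m0d : mxle (m0 n - m) (Num.min eta del) by near: n.
have mindel : Num.min eta del <= del by rewrite ge_min lexx orbT.
have mineta : Num.min eta del <= eta by rewrite ge_min lexx.
have [bb rr ne] := delP (m0 n) (y0 n) (bM n) (mono _ _ _ _ _ mindel m0d)
  (mono _ _ _ _ _ mindel y0d) (@bM_def n).
have le_V (f : nat -> R) (g : group) (L : R) : mean n (fun i => f i ^+ 2) < V -> 0 < L ->
    ev (resample n0) (fun v => ind (L <= `|\sum_i centered n f (v (g, i))|)) <= V / L ^+ 2.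
  move=> fV L0.
  apply: le_trans (@resample_chebyshev R group n n0 g (fun i => centered n f i) L
    (avg_centered f n0) L0) _.
  rewrite ler_wpM2r ?invr_ge0 ?exprn_ge0 ?(ltW L0)// avg_centered_sqr//.
  by rewrite ltW// (le_lt_trans _ fV)// gerBl sqr_ge0.
rewrite Pstar_avg.
have := NP n Nn _ (resample n0) (m0 n) (y0 n) (bM n) (@m1 n) (@y1 n)
  (fun v => bS n (draw_of v)) (lam n) (mono _ _ _ _ _ mineta m0d) bb rr ne.
apply => //.
- by move=> v; exact: bS_def.
- move=> L k L0; split => //.
  rewrite (_ : (fun v => _) = (fun v : Dr n =>
      ind (L <= `|\sum_i centered n (y k) (v (inl k, i))|))); last first.
    by apply/funext => v; rewrite dy.
  by apply: le_V => //; move: k; near: n.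
- move=> L k l L0; split => //.
  rewrite (_ : (fun v => _) = (fun v : Dr n =>
      ind (L <= `|\sum_i centered n (fun i => tnth (x k i) l) (v (inr k, i))|))); last first.
    by apply/funext => v; rewrite dx.
  by apply: (le_V (fun i => tnth (x k i) l)) => //; move: k l; near: n.
- move=> C a T' sm; rewrite (_ : (fun v => orthant _ _ _ _ _) = (fun v : Dr n =>
      orthant J (influence w m) a T' (fun g => \sum_(i < n) centered n (score g) (v (g,
        i))))); last first.
    by apply/funext => v; rewrite incr.
  have := @lindeberg_resample R group n n0 sig (fun g i => centered n (score g) i) C _
    (fun g => avg_centered (score g) n0) sm.
  exact.
- by near: n.
Unshelve. all: by end_near.
Qed.

End bootstrap_limit.

(** * Sampling distribution *)

Section iid.
Context {R : realType} {d : measure_display} {T : measurableType d}.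
Variable P : probability T R.
Local Notation E := (ev (PE P)).

(** Independence is taken pairwise: this form passes to measurable images and feeds both the strong
    law and the computation of variances. *)
Definition iid d' (V : measurableType d') (Z : nat -> T -> V) : Prop :=
  [/\ forall i, measurable_fun setT (Z i),
      forall i j, i != j -> indep_rv P (Z i) (Z j) &
      forall i B, measurable B -> P (Z i @^-1` B) = P (Z 0%N @^-1` B)].

Lemma iid_comp d1 d2 (V : measurableType d1) (W : measurableType d2)
    (Z : nat -> T -> V) (f : V -> W) :
  measurable_fun setT f -> iid Z -> iid (fun i => f \o Z i).
Proof.
move=> mf [mZ iZ lZ]; split.
- by move=> i; exact: measurableT_comp.
- by move=> i j ij; apply: indep_comp => //; exact: iZ.
- move=> i B mB; apply: (lZ i (f @^-1` B)).
  by rewrite -[X in measurable X]setTI; exact: mf.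
Qed.

Lemma iid_ev d1 (V : measurableType d1) (Z : nat -> T -> V) (f : V -> R) i :
  measurable_fun setT f -> iid Z -> dom (PE P) (f \o Z 0%N) ->
  dom (PE P) (f \o Z i) /\ E (f \o Z i) = E (f \o Z 0%N).
Proof. by move=> mf [mZ _ lZ] D; apply: (@same_law _ _ _ _ _ _ _ P P) => // B; exact: lZ. Qed.

Lemma iid_strong_law (Z : nat -> T -> R) : iid Z -> dom (PE P) (Z 0%N) ->
  {ae P, forall v : T, mean n (fun i => Z i v) @[n --> \oo] --> E (Z 0%N)}.
Proof. by move=> [mZ iZ lZ] D; exact: strong_law. Qed.

(** The scaled error has the variance of a single term, so the Chebyshev constant V does not depend
    on n. *)
Lemma iid_second_moment (Z : nat -> T -> R) n : iid Z ->
  dom (PE P) (fun v => Z 0%N v ^+ 2) -> (0 < n)%N ->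
  dom (PE P) (fun v => (Num.sqrt n%:R * (mean n (fun i => Z i v) - E (Z 0%N))) ^+ 2) /\
  E (fun v => (Num.sqrt n%:R * (mean n (fun i => Z i v) - E (Z 0%N))) ^+ 2) <=
  E (fun v => Z 0%N v ^+ 2).
Proof.
move=> iidZ D2 n0; have [mZ iZ _] := iidZ.
set s := Num.sqrt n%:R; have s0 : 0 < s by rewrite sqrtr_gt0 ltr0n.
have nE : n%:R = s ^+ 2 by rewrite sqr_sqrtr// ler0n.
set mu := E (Z 0%N).
have D1 : dom (PE P) (Z 0%N) by exact: PE_L2_L1.
pose f (z : R) := s^-1 * (z - mu).
have mf : measurable_fun setT f by apply: measurable_funM => //; exact: measurable_funB.
have mf2 : measurable_fun setT (fun z => f z ^+ 2) by exact: measurable_funX.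
have mz2 : measurable_fun setT (fun z : R => z ^+ 2) by exact: measurable_funX.
have fE v : f (Z 0%N v) ^+ 2 = s ^- 2 * (Z 0%N v ^+ 2) +
    (- 2 * mu * s ^- 2 * Z 0%N v + mu ^+ 2 * s ^- 2).
  by rewrite /f exprMn exprVn; ring.
have Df2 : dom (PE P) (fun v => f (Z 0%N v) ^+ 2).
  by apply: eq_dom (fun v => esym (fE v)) _; apply: domD; [exact: domZ|apply: domD; [exact:
    domZ|exact: dom_cst]].
have Ef2 : n%:R * E (fun v => f (Z 0%N v) ^+ 2) <= E (fun v => Z 0%N v ^+ 2).
  rewrite (eq_ev _ fE) evD ?evZ ?evD ?ev_cst ?evZ//; last 4 first.
  - exact: domZ.
  - exact: dom_cst.
  - exact: domZ.
  - by apply: domD; [exact: domZ|exact: dom_cst].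
  rewrite -/mu nE; set q := E _; rewrite (_ : s ^+ 2 * _ = q - mu ^+ 2).
    by rewrite gerBl sqr_ge0.
  by field; rewrite gt_eqF.
have Df : dom (PE P) (fun v => f (Z 0%N v)).
  apply: (eq_dom (f := fun v => s^-1 * (Z 0%N v - mu))) => //.
  by apply: domZ; apply: domB => //; exact: dom_cst.
have Ef : E (fun v => f (Z 0%N v)) = 0.
  rewrite evZ; last by apply: domB => //; exact: dom_cst.
  by rewrite evB// ?ev_cst ?subrr ?mulr0//; exact: dom_cst.
have iidf := iid_comp mf iidZ.
have Dfi i : dom (PE P) (fun v => f (Z i v)) by have [] := iid_ev i mf iidZ Df.
have Efi i : E (fun v => f (Z i v)) = 0 by have [_ ->] := iid_ev i mf iidZ Df.
have Df2i i : dom (PE P) (fun v => f (Z i v) ^+ 2) by have [] := iid_ev i mf2 iidZ Df2.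
have Ef2i i : E (fun v => f (Z i v) ^+ 2) = E (fun v => f (Z 0%N v) ^+ 2).
  by have [_ ->] := iid_ev i mf2 iidZ Df2.
have cr i j : i != j -> dom (PE P) (fun v => f (Z i v) * f (Z j v)) /\
    E (fun v => f (Z i v) * f (Z j v)) = 0.
  move=> ij; have [_ /(_ _ _ ij) ii _] := iidf.
  by have [D ->] := indep_mul ii (Dfi i) (Dfi j); rewrite Efi mul0r.
have Dcr i j : dom (PE P) (fun v => f (Z i v) * f (Z j v)).
  by have [->|/cr[]//] := eqVneq i j; apply: eq_dom (Df2i j) => v; rewrite expr2.
have [D EE] := ev_sqr_sum (iota_uniq 0 (n - 0)) Dcr (fun i j _ _ ij => (cr i j ij).2).
have sE v : s * (mean n (fun i => Z i v) - mu) = \sum_(0 <= i < n) f (Z i v).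
  rewrite big_mkord -mulr_sumr sumrB sumr_const card_ord.
  rewrite -[mu *+ n]mulr_natl /mean nE; set q := \sum_(i < n) _.
  by field; rewrite gt_eqF.
rewrite (_ : (fun v => _ ^+ 2) = (fun v => (\sum_(0 <= i < n) f (Z i v)) ^+ 2)); last first.
  by apply/funext => v; rewrite sE.
split => //; rewrite EE (eq_bigr _ (fun i _ => Ef2i i)).
by rewrite big_mkord sumr_const card_ord -[_ *+ n]mulr_natl.
Qed.

End iid.

Lemma mutually_independent_pair {R : realType} {d : measure_display}
    {T : measurableType d} (P : probability T R) (I : choiceType)
    (S : I -> set_system T) i j A B :
  mutually_independent P S -> i != j -> S i A -> S j B ->
  P (A `&` B) = (P A * P B)%E.
Proof.
move=> iS ij SA SB; pose F k := if k == i then A else B.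
have ji : (j == i) = false by rewrite eq_sym; exact/negbTE.
have := iS [fset i; j]%fset F; rewrite big_fsetU1 ?inE//= big_seq_fset1.
have [FA FB] : F i = A /\ F j = B by rewrite /F eqxx ji.
rewrite FA FB => <-.
  congr (P _); apply/seteqP; split => v.
    by move=> [Av Bv] k /=; rewrite !inE => /orP[/eqP ->|/eqP ->]; rewrite ?FA ?FB.
  move=> H; split.
    by rewrite -FA; apply: H; rewrite /= !inE eqxx.
  by rewrite -FB; apply: H; rewrite /= !inE eqxx orbT.
by move=> k; rewrite !inE => /orP[/eqP ->|/eqP ->]; rewrite ?FA ?FB.
Qed.

Lemma PE_L2_sum {R : realType} {d : measure_display} {T : measurableType d}
    (P : probability T R) (I : Type) (r : seq I) (f : I -> T -> R) :
  (forall i, measurable_fun setT (f i)) -> (forall i, dom (PE P) (fun v => f i v ^+ 2)) ->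
  dom (PE P) (fun v => (\sum_(i <- r) f i v) ^+ 2).
Proof.
move=> mf Df; elim: r => [|i r IH].
  by apply: eq_dom (dom_cst _ 0) => v; rewrite big_nil expr0n.
apply: PE_le (domZ 2 (domD (Df i) IH)) _ => [|v].
  by apply: measurable_funX; apply: measurable_sum.
rewrite big_cons; set b := \sum_(j <- r) _; have ab := sqr_ge0 (f i v - b).
rewrite !ger0_norm ?sqr_ge0//; first by nra.
by rewrite mulr_ge0 ?addr_ge0 ?sqr_ge0.
Qed.

Lemma measurable_linear_part {R : realType} {d : nat} (beta : 'cV[R]_(1 + d)) :
  measurable_fun setT (linear_part beta).
Proof.
apply: measurable_sum => j; apply: measurable_funM => //.
exact: measurable_tnth.
Qed.

Lemma measurable_below {R : realType} {d : measure_display} {T : measurableType d}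
    (D : finType) (J : pred D) (x : T -> D -> R) (t : D -> R) :
  (forall j, measurable_fun setT (fun v => x v j)) ->
  measurable [set v | below J (x v) t].
Proof.
move=> mx.
rewrite (_ : [set v | _] = \bigcap_(j in [set j | J j]) [set v | x v j <= t j]).
  apply: fin_bigcap_measurable => // j _; exact: measurable_set_le.
apply/seteqP; split => v.
  by move=> /forallP H j /= Jj; have := H j; rewrite Jj.
by move=> H; apply/forallP => j; apply/implyP; exact: H.
Qed.

Section sample.
Context {R : realType} {K d : nat} {d1 : measure_display} {T : measurableType d1}.
Variables (P : probability T R) (w : 'rV[R]_K) (m : 'M[R]_(K, d))
  (beta : 'cV[R]_(1 + d)).
Variables (Ys : 'I_K -> nat -> T -> R) (Xs : 'I_K -> nat -> T -> d.-tuple R).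
Hypothesis Ys_meas : forall k i, measurable_fun setT (Ys k i).
Hypothesis Xs_meas : forall k i, measurable_fun setT (Xs k i).
Hypothesis Ys_law : forall k i B, measurable B ->
  P (Ys k i @^-1` B) = P (Ys k 0%N @^-1` B).
Hypothesis Xs_law : forall k i B, measurable B ->
  P (Xs k i @^-1` B) = P (Xs k 0%N @^-1` B).
Hypothesis data_indep : mutually_independent P (data_events Ys Xs).
Hypothesis Y_L2 : forall k, dom (PE P) (fun v => Ys k 0%N v ^+ 2).
Hypothesis X_L2 : forall k l, dom (PE P) (fun v => tnth (Xs k 0%N v) l ^+ 2).
Hypothesis Y_mean : forall k, ev (PE P) (Ys k 0%N) = (design m *m beta) k 0.
Hypothesis X_mean : forall k l, ev (PE P) (fun v => tnth (Xs k 0%N v) l) = m k l.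
Local Notation E := (ev (PE P)).
Local Notation group := (group (K := K)).

Definition sample_score (g : group) (i : nat) (v : T) : R :=
  score beta (fun k i => Ys k i v) (fun k i => Xs k i v) g i.

Lemma Ys_iid k : iid P (Ys k).
Proof.
split => // [i j ij A B mA mB|i B mB]; last exact: Ys_law.
apply: (mutually_independent_pair data_indep (i := inl (k, i)) (j := inl (k, j))).
- by rewrite (inj_eq (@inl_inj _ _)) xpair_eqE eqxx.
- by exists A => //; rewrite setTI.
- by exists B => //; rewrite setTI.
Qed.

Lemma Xs_iid k : iid P (Xs k).
Proof.
split => // [i j ij A B mA mB|i B mB]; last exact: Xs_law.
apply: (mutually_independent_pair data_indep (i := inr (k, i)) (j := inr (k, j))).
- by rewrite (inj_eq (@inr_inj _ _)) xpair_eqE eqxx.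
- by exists A => //; rewrite setTI.
- by exists B => //; rewrite setTI.
Qed.

Lemma sample_score_iid g : iid P (sample_score g).
Proof.
case: g => k; first exact: Ys_iid.
exact: (iid_comp (measurable_linear_part beta) (Xs_iid k)).
Qed.

Lemma Xs_coord_iid k l : iid P (fun i v => tnth (Xs k i v) l).
Proof. exact: (iid_comp (@measurable_tnth _ _ _ l) (Xs_iid k)). Qed.

Lemma sample_score_L2 g : dom (PE P) (fun v => sample_score g 0%N v ^+ 2).
Proof.
case: g => k; first exact: Y_L2.
apply: (@PE_L2_sum _ _ _ P _ _ (fun l v => beta (rshift 1 l) 0 * tnth (Xs k 0%N v) l)) => l.
  by apply: measurable_funM => //; apply: measurableT_comp (@measurable_tnth _ _ _ l) _.
by apply: eq_dom (domZ (beta (rshift 1 l) 0 ^+ 2) (X_L2 k l)) => v; rewrite exprMn.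
Qed.

Variable sig : group -> R.
Hypothesis sigE : forall g,
  sig g ^+ 2 = E (fun v => sample_score g 0%N v ^+ 2) - E (sample_score g 0%N) ^+ 2.

Let mu g := E (sample_score g 0%N).
Let tail g (M : R) := E (fun v => sample_score g 0%N v ^+ 2 * ind (M < `|sample_score g 0%N
  v|)).

Lemma measurable_tail_ind (M : R) : measurable_fun setT (fun z : R => z ^+ 2 * ind (M < `|z|)).
Proof.
apply: measurable_funM; first exact: measurable_funX.
apply: (measurableT_comp (measurable_lt_ind M)); exact: measurable_norm.
Qed.

Lemma dom_tail g M : dom (PE P) (fun v => sample_score g 0%N v ^+ 2 * ind (M < `|sample_score
  g 0%N v|)).
Proof.
have [ms _ _] := sample_score_iid g.
apply: PE_le (sample_score_L2 g) _; first exact: (measurableT_comp (measurable_tail_ind M)).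
by move=> v; rewrite normrM ler_piMr// ger0_norm ?ind_ge0 ?ind_le1.
Qed.

Lemma tail_cvg g : tail g M%:R @[M --> \oo] --> 0.
Proof.
have [ms _ _] := sample_score_iid g.
rewrite -[X in _ --> X](ev0 (PE P)).
apply: (@PE_dominated _ _ _ P _ _ (fun v => sample_score g 0%N v ^+ 2)).
- by move=> M; exact: (measurableT_comp (measurable_tail_ind M%:R)).
- by [].
- exact: sample_score_L2.
- move=> M v; rewrite [leLHS]ger0_norm; last exact: mulr_ge0 (sqr_ge0 _) (ind_ge0 _).
  by rewrite ler_piMr ?sqr_ge0 ?ind_le1.
- apply: aeW => v; apply: cvg_near_cst.
  exists (Num.truncn `|sample_score g 0%N v|).+1 => // M /= vM.
  rewrite ltNge (ltW (lt_le_trans (truncnS_gt _) _)) ?mulr0// ler_nat//.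
Qed.

Definition data_index n (o : group * 'I_n) : ('I_K * nat) + ('I_K * nat) :=
  match o.1 with inl k => inl (k, val o.2) | inr k => inr (k, val o.2) end.

Definition scaled_score n (o : group * 'I_n) (v : T) : R :=
  (sample_score o.1 o.2 v - mu o.1) / Num.sqrt n%:R.

Lemma data_index_inj n : injective (@data_index n).
Proof.
by move=> [[k|k] i] [[k'|k'] i'] //= [-> /val_inj ->].
Qed.

Lemma data_events_measurable o A : data_events Ys Xs o A -> measurable A.
Proof. by case: o => -[k i] [B mB <-]; [exact: Ys_meas|exact: Xs_meas]. Qed.

Lemma data_events_setT o : data_events Ys Xs o setT.
Proof. by case: o => -[k i]; exists setT => //; rewrite preimage_setT setIT. Qed.

Lemma data_events_setI o A B :
  data_events Ys Xs o A -> data_events Ys Xs o B -> data_events Ys Xs o (A `&` B).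
Proof.
by case: o => -[k i] [C mC <-] [D mD <-]; exists (C `&` D);
  rewrite ?preimage_setI ?setTI//; exact: measurableI.
Qed.

Let measurable_rescale n c : measurable_fun setT (fun z : R => (z - c) / Num.sqrt n%:R).
Proof. by apply: measurable_funM => //; exact: measurable_funB. Qed.

Lemma scaled_score_events n (o : group * 'I_n) B : measurable B ->
  data_events Ys Xs (data_index o) (scaled_score o @^-1` B).
Proof.
move=> mB; case: o => -[k|k] i; rewrite /data_index /=.
  exists ((fun z => (z - mu (inl k)) / Num.sqrt n%:R) @^-1` B); last by rewrite setTI.
  by rewrite -[X in measurable X]setTI; exact: measurable_rescale.
exists ((fun z => (linear_part beta z - mu (inr k)) / Num.sqrt n%:R) @^-1` B); last by
  rewrite setTI.
rewrite -[X in measurable X]setTI.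
exact: (measurableT_comp (measurable_rescale n (mu (inr k))) (measurable_linear_part beta)).
Qed.

Lemma scaled_score_moments n (o : group * 'I_n) : (0 < n)%N ->
  [/\ dom (PE P) (fun v => scaled_score o v ^+ 2), E (scaled_score o) = 0,
      E (fun v => scaled_score o v ^+ 2) = (sig o.1 / Num.sqrt n%:R) ^+ 2 &
      n%:R * E (fun v => trunc3 (scaled_score o v)) =
      n%:R * E (fun v => trunc3 ((sample_score o.1 0%N v - mu o.1) / Num.sqrt n%:R))].
Proof.
move=> n0; set s := Num.sqrt n%:R; have s0 : 0 < s by rewrite sqrtr_gt0 ltr0n.
case: o => g i /=.
have iidS := sample_score_iid g; have D2 := sample_score_L2 g.
have [mS _ _] := iidS; have D1 := PE_L2_L1 (mS 0%N) D2.
pose f (z : R) := (z - mu g) / s; have mf : measurable_fun setT f by exact: measurable_rescale.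
have mf2 : measurable_fun setT (fun z => f z ^+ 2) by exact: measurable_funX.
have mf3 : measurable_fun setT (fun z => trunc3 (f z)).
  apply: measurable_minr; first exact: measurable_funX.
  by apply: measurable_funX; exact: measurable_norm.
have fE v : f (sample_score g 0%N v) = s^-1 * sample_score g 0%N v + - (mu g / s).
  by rewrite /f; ring.
have Df : dom (PE P) (f \o sample_score g 0%N).
  by apply: eq_dom (fun v => esym (fE v)) _; apply: domD; [exact: domZ|exact: dom_cst].
have f2E v : f (sample_score g 0%N v) ^+ 2 = s ^- 2 * sample_score g 0%N v ^+ 2 +
    (- 2 * mu g * s ^- 2 * sample_score g 0%N v + mu g ^+ 2 * s ^- 2).
  by rewrite /f expr_div_n; ring.
have DL : dom (PE P) (fun v => - 2 * mu g * s ^- 2 * sample_score g 0%N v + mu g ^+ 2 * s ^- 2).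
  by apply: domD; [exact: domZ|exact: dom_cst].
have Df2 : dom (PE P) ((fun z => f z ^+ 2) \o sample_score g 0%N).
  by apply: eq_dom (fun v => esym (f2E v)) _; apply: domD => //; exact: domZ.
have Df3 : dom (PE P) ((fun z => trunc3 (f z)) \o sample_score g 0%N).
  apply: PE_le Df2 _; first exact: measurableT_comp mf3 (mS 0%N).
  by move=> v /=; rewrite !ger0_norm ?sqr_ge0 ?trunc3_ge0// trunc3_le_sqr.
have [_ e1] := iid_ev i mf iidS Df.
have [D e2] := iid_ev i mf2 iidS Df2.
have [_ e3] := iid_ev i mf3 iidS Df3.
split.
- exact: D.
- apply: (etrans e1); rewrite (eq_ev _ fE) evD ?evZ ?ev_cst//; [|exact: domZ|exact: dom_cst].
  by rewrite -/(mu g); ring.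
- apply: (etrans e2); rewrite (eq_ev _ f2E) evD//; last exact: domZ.
  have -> : E (fun v => - 2 * mu g * s ^- 2 * sample_score g 0%N v + mu g ^+ 2 * s ^- 2) =
      - 2 * mu g * s ^- 2 * mu g + mu g ^+ 2 * s ^- 2.
    apply: etrans (evD (domZ _ D1) (dom_cst _ _)) _; congr (_ + _); last exact: ev_cst.
    exact: evZ.
  by rewrite evZ// expr_div_n sigE -/(mu g); ring.
- by congr (_ * _); exact: e3.
Qed.

Variables (J : pred 'I_(1 + d)) (c0 : R) (bM : nat -> T -> 'cV[R]_(1 + d)).
Hypothesis w_pos : forall k, 0 < w 0 k.
Hypothesis full_rank : \rank (design m) = (1 + d)%N.
Hypothesis c0_gt0 : 0 < c0.
Hypothesis c0P : forall j, J j -> exists g, c0 <= `|influence w m j g * sig g|.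
Hypothesis bM_meas : forall n j, measurable_fun setT (fun v => bM n v j 0).
Hypothesis bM_def : forall n v,
  moment_estimate w (fun k (i : 'I_n) => Ys k i v) (fun k (i : 'I_n) => Xs k i v) (bM n v).

Let y1 n v := sample_mean_Y (fun k (i : 'I_n) => Ys k i v).
Let x1 n v := sample_mean_X (fun k (i : 'I_n) => Xs k i v).

Lemma increment_scaled_score n v : (0 < n)%N ->
  increment beta (Num.sqrt n%:R) (y1 n v - design m *m beta) (x1 n v - m) =
  gsum fst (@scaled_score n) (index_enum (group * 'I_n)%type) v.
Proof.
move=> n0; set s := Num.sqrt n%:R; have s0 : 0 < s by rewrite sqrtr_gt0 ltr0n.
have nE : n%:R = s ^+ 2 by rewrite sqr_sqrtr// ler0n.
have sumE (f : nat -> R) c : s * (n%:R^-1 * \sum_(i < n) f i - c) =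
    \sum_(i < n) (f i - c) / s.
  rewrite -mulr_suml sumrB sumr_const card_ord -[c *+ n]mulr_natl nE.
  by set q := \sum_(i < n) _; field; rewrite gt_eqF.
have gs g : gsum fst (@scaled_score n) (index_enum (group * 'I_n)%type) v g =
    \sum_(i < n) scaled_score (g, i) v.
  rewrite /gsum fct_sumE.
  transitivity (\sum_g' \sum_(i < n) pt g' (scaled_score (g', i) v) g).
    by rewrite pair_big; apply: eq_bigr => -[].
  rewrite (bigD1 g)//= [X in _ + X]big1 ?addr0.
    by apply: eq_bigr => i _; rewrite /pt eqxx.
  by move=> g' gg'; rewrite big1// => i _; rewrite /pt eq_sym (negPf gg').
apply/funext => g; rewrite gs; case: g => k /=.
  by rewrite mxBE -Y_mean [y1 _ _ _ _]mxE (sumE (fun i => Ys k i v)).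
apply: etrans (sumE (fun i => linear_part beta (Xs k i v)) (mu (inr k))); congr (_ * _).
have -> : mu (inr k) = \sum_l beta (rshift 1 l) 0 * m k l.
  have D l : dom (PE P) (fun v' => tnth (Xs k 0%N v') l).
    by apply: PE_L2_L1 => //; exact: measurableT_comp (@measurable_tnth _ _ _ l) _.
  apply: etrans (ev_sum _ (fun l => domZ (beta (rshift 1 l) 0) (D l))) _.
  by apply: eq_bigr => l _; rewrite evZ// X_mean.
rewrite exchange_big mulr_sumr/= -sumrB; apply: eq_bigr => l _.
by rewrite mxBE [x1 _ _ _ _]mxE mulrBr mulrCA mulr_sumr.
Qed.

Definition lindeberg_error n : R := \sum_(o : group * 'I_n)
  (4 * (E (fun v => trunc3 (scaled_score o v)) + `|sig o.1 / Num.sqrt n%:R| ^+ 3) +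
   `|E (fun v => scaled_score o v ^+ 2) - (sig o.1 / Num.sqrt n%:R) ^+ 2|).

Lemma lindeberg_error_small (e : R) : 0 < e -> \forall n \near \oo, lindeberg_error n <= e.
Proof.
move=> e0; pose eg := e / (#|group|%:R + 1).
have cg0 : 0 < #|group|%:R + 1 :> R by rewrite ltr_wpDl.
have eg0 : 0 < eg by rewrite divr_gt0.
pose B g (M : nat) n := 4 * ((2 * M%:R) ^+ 3 * (Num.sqrt n%:R)^-1 + 4 * tail g M%:R) +
  4 * `|sig g| ^+ 3 * (Num.sqrt n%:R)^-1.
have BP : \forall n \near \oo, forall g : group, exists M : nat, `|mu g| <= M%:R /\ B g M n <
  eg.
  apply: filter_forall => g.
  (* The limit of [B g M] is 16 times the tail; 17 leaves room for a strict inequality. *)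
  have e16 : 0 < eg / 17 by rewrite divr_gt0.
  have [M [tM muM]] : exists M : nat, tail g M%:R < eg / 17 /\ `|mu g| <= M%:R.
    have [M1 _ M1P] := cvgr_lt _ (tail_cvg g) _ e16.
    exists (maxn M1 (Num.truncn `|mu g|).+1); split; first by apply: M1P; exact: leq_maxl.
    by apply: le_trans (ltW (truncnS_gt _)) _; rewrite ler_nat leq_maxr.
  have cB : B g M n @[n --> \oo] --> 4 * ((2 * M%:R) ^+ 3 * 0 + 4 * tail g M%:R) + 4 * `|sig
    g| ^+ 3 * 0.
    apply: cvgD; last by apply: cvgM; [exact: cvg_cst|exact: cvg_inv_sqrt].
    apply: cvgM; first exact: cvg_cst.
    apply: cvgD; last exact: cvg_cst.
    by apply: cvgM; [exact: cvg_cst|exact: cvg_inv_sqrt].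
  have lt : 4 * ((2 * M%:R) ^+ 3 * 0 + 4 * tail g M%:R) + 4 * `|sig g| ^+ 3 * 0 < eg by lra.
  by apply: filterS (cvgr_lt _ cB _ lt) => n Bn; exists M.
near=> n.
have n0 : (0 < n)%N by near: n; exists 1%N.
have Bn : forall g : group, exists M : nat, `|mu g| <= M%:R /\ B g M n < eg by near: n.
have nR : 0 < n%:R :> R by rewrite ltr0n.
rewrite /lindeberg_error; apply: (@le_trans _ _ (\sum_(o : group * 'I_n) eg / n%:R)); last
  first.
  rewrite sumr_const card_prod card_ord -[_ *+ _]mulr_natl natrM.
  rewrite (_ : _ * _ = #|group|%:R * eg); last by field; rewrite gt_eqF.
  rewrite /eg mulrCA ler_piMr ?(ltW e0)//.
  by rewrite ler_pdivrMr// mul1r lerDl.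
apply: ler_sum => o _; have [_ _ -> t3] := scaled_score_moments o n0.
rewrite subrr normr0 addr0 ler_pdivlMr// mulrC mulrCA mulrDr t3.
have [M [muM /ltW BM]] := Bn o.1; apply: le_trans BM; rewrite /B mulrDr.
apply: lerD.
  rewrite ler_wpM2l//; apply: lindeberg_small => //; last exact: dom_tail.
  have [_ _ _] := scaled_score_moments (o.1, Ordinal n0) n0.
  move=> _; have [D _ _ _] := scaled_score_moments (o.1, Ordinal n0) n0.
  have [ms _ _] := sample_score_iid o.1.
  apply: PE_le D _.
    apply: measurable_minr; first by apply: measurable_funX; exact: (measurableT_comp
      (measurable_rescale n (mu o.1)) (ms 0%N)).
    apply: measurable_funX; apply: measurable_norm.
    exact: (measurableT_comp (measurable_rescale n (mu o.1)) (ms 0%N)).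
  by move=> v; rewrite [leLHS]ger0_norm ?trunc3_ge0// [leRHS]ger0_norm ?sqr_ge0// trunc3_le_sqr.
set s := Num.sqrt n%:R; have s0 : 0 < s by rewrite sqrtr_gt0.
have nE : n%:R = s ^+ 2 by rewrite sqr_sqrtr// ler0n.
rewrite normrM normfV (gtr0_norm s0) nE le_eqVlt; apply/orP; left; apply/eqP.
by field; rewrite gt_eqF.
Unshelve. all: by end_near.
Qed.

Lemma moment_estimate_close (e : R) : 0 < e -> \forall n \near \oo, forall t,
  `|E (fun v => ind (below J (fun j => (Num.sqrt n%:R *: (bM n v - beta)) j 0) t)) -
    radcdf J (influence w m) sig n t| <= e.
Proof.
move=> e0.
pose V := \sum_k E (fun v => Ys k 0%N v ^+ 2) +
  \sum_k \sum_l E (fun v => tnth (Xs k 0%N v) l ^+ 2).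
have ev_sqr (f : T -> R) : dom (PE P) (fun v => f v ^+ 2) -> 0 <= E (fun v => f v ^+ 2).
  by move=> D; rewrite -(ev0 (PE P)); apply: ev_le => // [|v]; [exact: dom_cst|exact: sqr_ge0].
have V0 : 0 <= V.
  rewrite addr_ge0//; apply: sumr_ge0 => *; first exact: ev_sqr.
  by apply: sumr_ge0 => *; exact: ev_sqr.
have [eta eta0 [N NP]] := master_bound beta w_pos full_rank c0_gt0 c0P e0 V0.
near=> n => t.
have n0 : (0 < n)%N by near: n; exists 1%N.
have Nn : (N <= n)%N by near: n; exists N.
have cheb (Z : nat -> T -> R) L : iid P Z -> dom (PE P) (fun v => Z 0%N v ^+ 2) ->
    E (fun v => Z 0%N v ^+ 2) <= V -> 0 < L ->
    dom (PE P) (fun v => ind (L <= `|Num.sqrt n%:R * (mean n (fun i => Z i v) - E (Z 0%N))|)) /\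
    E (fun v => ind (L <= `|Num.sqrt n%:R * (mean n (fun i => Z i v) - E (Z 0%N))|)) <= V / L
      ^+ 2.
  move=> iZ D ZV L0; have [mZ _ _] := iZ.
  have [D2 le2] := iid_second_moment iZ D n0.
  have DI : dom (PE P) (fun v => ind (L <= `|Num.sqrt n%:R * (mean n (fun i => Z i v) - E (Z
    0%N))|)).
    apply: PE_ind_dom; apply: measurable_set_le => //; apply: measurable_norm.
    apply: measurable_funM => //; apply: measurable_funB => //; apply: measurable_funM => //.
    by apply: measurable_sum => i; exact: mZ.
  split => //; apply: le_trans (ev_chebyshev L0 D2 DI) _.
  by rewrite ler_wpM2r ?invr_ge0 ?exprn_ge0 ?(ltW L0)//; exact: le_trans le2 ZV.
have mU g : measurable_fun setT (fun v => increment beta (Num.sqrt n%:R) (y1 n v - design m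
  *m beta) (x1 n v - m) g).
  rewrite (_ : (fun v => _) = (fun v => gsum fst (@scaled_score n) (index_enum (group *
    'I_n)%type) v g)).
    rewrite (_ : (fun v => _) = (fun v => \sum_(o : group * 'I_n) pt o.1 (scaled_score o v) g)).
      apply: measurable_sum => o; rewrite /pt; case: eqP => // _.
      by move=> _ B mB; rewrite setTI; exact: data_events_measurable (scaled_score_events o mB).
    by apply/funext => v; rewrite /gsum fct_sumE.
  by apply/funext => v; rewrite increment_scaled_score.
have le_nonneg (x y : R) : 0 <= y -> x <= x + y by move=> y0; rewrite lerDl.
have := NP n Nn _ (PE P) m (design m *m beta) beta (x1 n) (y1 n) (bM n) (lindeberg_error n).
have mx0 p q (c : R) : 0 < c -> mxle (0 : 'M[R]_(p, q)) c.
  by move=> c1 i j; rewrite mxE normr0 ltW.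
(* The base point is the population, where [design m *m beta] is the exact mean vector: deviations
   and residual are 0. *)
rewrite !subrr; apply.
- exact: mx0.
- exact: mx0.
- exact: mx0.
- by rewrite mulmx0.
- by move=> v; exact: bM_def.
- move=> L k L0.
  rewrite (_ : (fun v => _) = (fun v => ind (L <= `|Num.sqrt n%:R * (mean n (fun i => Ys k i
    v) - E (Ys k 0%N))|))); last first.
    by apply/funext => v; rewrite mxBE Y_mean [y1 _ _ _ _]mxE.
  apply: cheb => //; first exact: Ys_iid.
  rewrite /V (bigD1 k)//= -addrA; apply: le_nonneg; rewrite addr_ge0//.
    by apply: sumr_ge0 => *; exact: ev_sqr.
  by apply: sumr_ge0 => *; apply: sumr_ge0 => *; exact: ev_sqr.
- move=> L k l L0.
  rewrite (_ : (fun v => _) = (fun v => ind (L <= `|Num.sqrt n%:R * (mean n (fun i => tnth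
    (Xs k i v) l) - E (fun v => tnth (Xs k 0%N v) l))|))); last first.
    by apply/funext => v; rewrite mxBE X_mean [x1 _ _ _ _]mxE.
  apply: (cheb (fun i v => tnth (Xs k i v) l)) => //; first exact: Xs_coord_iid.
  rewrite /V addrC (bigD1 k)//= (bigD1 l)//= -!addrA; apply: le_nonneg; rewrite !addr_ge0//.
  + by apply: sumr_ge0 => *; exact: ev_sqr.
  + by apply: sumr_ge0 => *; apply: sumr_ge0 => *; exact: ev_sqr.
  + by apply: sumr_ge0 => *; exact: ev_sqr.
- move=> a t'; apply: (@PE_bounded _ _ _ P _ 1); first exact: measurable_orthant.
  by move=> v; exact: orthant_itv.
- move=> C a t' sm.
  rewrite (_ : (fun v => orthant _ _ _ _ _) = (fun v => orthant J (influence w m) a t'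
      (gsum fst (@scaled_score n) (index_enum (group * 'I_n)%type) v))); last first.
    by apply/funext => v; rewrite increment_scaled_score.
  have L2 (o : group * 'I_n) := let: And4 D _ _ _ := scaled_score_moments o n0 in D.
  have M1 (o : group * 'I_n) := let: And4 _ D _ _ := scaled_score_moments o n0 in D.
  have := lindeberg_independent data_indep data_events_measurable
    data_events_setT data_events_setI (fun o : group * 'I_n => o.1)
    (fun o => sig o.1 / Num.sqrt n%:R) (@data_index_inj n) (@scaled_score_events n)
    L2 M1 sm.
  move=> /le_trans; apply.
  rewrite /lindeberg_error mulr_sumr le_eqVlt; apply/orP; left; apply/eqP.
  by apply: eq_bigr => o _; ring.
- by near: n; exact: lindeberg_error_small.
- move=> t'; apply: PE_ind_dom; apply: measurable_below => j.
  rewrite (_ : (fun v => _) = (fun v => Num.sqrt n%:R * (bM n v j 0 - beta j 0))).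
    by apply: measurable_funM => //; exact: measurable_funB.
  by apply/funext => v; rewrite mxE mxBE.
Unshelve. all: by end_near.
Qed.

Variable bS : forall n, T -> draw K n -> 'cV[R]_(1 + d).
Arguments bS : clear implicits.
Hypothesis bS_def : forall n v (s : draw K n),
  moment_estimate w (fun k i => Ys k (s.1 k i) v) (fun k i => Xs k (s.2 k i) v) (bS n v s).

(** The null set comes from countably many strong laws, the tails being taken at integer levels M;
    it is therefore common to all e and t. *)
Lemma bootstrap_close_ae : {ae P, forall v : T, forall e : R, 0 < e ->
  \forall n \near \oo, forall t,
  `|Pstar [pred s | below J (fun j => (Num.sqrt n%:R *: (bS n v s - bM n v)) j 0) t] -
    radcdf J (influence w m) sig n t| <= e}.
Proof.
have sqr_meas : measurable_fun setT (fun z : R => z ^+ 2) by exact: measurable_funX.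
have hy : {ae P, forall v : T, forall k,
    mean n (fun i => Ys k i v) @[n --> \oo] --> (design m *m beta) k 0}.
  apply: filter_forall => k.
  by rewrite -Y_mean; apply: iid_strong_law (Ys_iid k) _; exact: PE_L2_L1.
have hx : {ae P, forall v : T, forall k l,
    mean n (fun i => tnth (Xs k i v) l) @[n --> \oo] --> m k l}.
  apply: near_forall2 => k l.
  rewrite -X_mean; apply: iid_strong_law (Xs_coord_iid k l) _.
  apply: PE_L2_L1 => //; exact: measurableT_comp (@measurable_tnth _ _ _ l) _.
have hy2 : {ae P, forall v : T, forall k,
    mean n (fun i => Ys k i v ^+ 2) @[n --> \oo] --> E (fun v => Ys k 0%N v ^+ 2)}.
  apply: filter_forall => k.
  exact: (iid_strong_law (iid_comp sqr_meas (Ys_iid k)) (Y_L2 k)).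
have hx2 : {ae P, forall v : T, forall k l,
    mean n (fun i => tnth (Xs k i v) l ^+ 2) @[n --> \oo] --> E (fun v => tnth (Xs k 0%N v) l
      ^+ 2)}.
  apply: near_forall2 => k l.
  exact: (iid_strong_law (iid_comp sqr_meas (Xs_coord_iid k l)) (X_L2 k l)).
have hs : {ae P, forall v : T, forall g,
    mean n (fun i => sample_score g i v) @[n --> \oo] --> mu g}.
  apply: filter_forall => g.
  have [mS _ _] := sample_score_iid g.
  by apply: iid_strong_law (sample_score_iid g) _; exact: PE_L2_L1 (sample_score_L2 g).
have hs2 : {ae P, forall v : T, forall g,
    mean n (fun i => sample_score g i v ^+ 2) @[n --> \oo] --> E (fun v => sample_score g 0%N
      v ^+ 2)}.
  apply: filter_forall => g.
  exact: (iid_strong_law (iid_comp sqr_meas (sample_score_iid g)) (sample_score_L2 g)).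
have ht : {ae P, forall v : T, forall g (M : nat),
    mean n (fun i => sample_score g i v ^+ 2 * ind (M%:R < `|sample_score g i v|)) @[n -->
      \oo] --> tail g M%:R}.
  apply: filter_forall => g.
  apply: ae_foralln => M.
  exact: (iid_strong_law (iid_comp (measurable_tail_ind M%:R) (sample_score_iid g)) (dom_tail
    g M%:R)).
near=> v => e e0.
have [vy vx] : (forall k, mean n (fun i => Ys k i v) @[n --> \oo] --> (design m *m beta) k 0) /\
   (forall k l, mean n (fun i => tnth (Xs k i v) l) @[n --> \oo] --> m k l) by split; near: v.
have [vy2 vx2] : (forall k, mean n (fun i => Ys k i v ^+ 2) @[n --> \oo] --> E (fun v => Ys k
  0%N v ^+ 2)) /\
  (forall k l, mean n (fun i => tnth (Xs k i v) l ^+ 2) @[n --> \oo] --> E (fun v => tnth (Xs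
    k 0%N v) l ^+ 2)) by split; near: v.
have vs : forall g, mean n (fun i => sample_score g i v) @[n --> \oo] --> mu g by near: v.
have vs2 : forall g, mean n (fun i => sample_score g i v ^+ 2) @[n --> \oo] --> E (fun v =>
  sample_score g 0%N v ^+ 2) by near: v.
have vt : forall g (M : nat), mean n (fun i => sample_score g i v ^+ 2 * ind (M%:R <
  `|sample_score g i v|)) @[n --> \oo] --> tail g M%:R by near: v.
exact: (@bootstrap_close R K d w m beta w_pos full_rank sig J c0 c0_gt0 c0P
  (fun k i => Ys k i v) (fun k i => Xs k i v) _ _ _ _ _ vy vx vy2 vx2 vs vs2 sigE vt tail_cvg
  (fun n => bS n v) (fun n => bM n v) (fun n => @bM_def n v) (fun n => @bS_def n v) e e0).
Unshelve. all: by end_near.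
Qed.

End sample.

(** * Bootstrap quantiles and coverage *)

Section finite_quantile.
Context {R : realType} {D : finType}.
Variable f : D -> R.

Definition fcdf (x : R) : R := avg (fun s => ind (f s <= x)).

Lemma fcdf_le x y : x <= y -> fcdf x <= fcdf y.
Proof. by move=> xy; apply: avg_le => s; apply: ind_le => /le_trans; exact. Qed.

(* The distribution function of f jumps at finitely many points, so the
   generalized inverse is attained. *)
Lemma fcdf_quantile (s0 : D) (u : R) : 0 < u <= 1 ->
  exists q, forall x, (u <= fcdf x) = (q <= x).
Proof.
move=> /andP[u0 u1].
have [sM _ sMP] : extremum_spec >=%O xpredT f [arg max_(s > s0) f s]%O by exact: arg_maxP.
have PM : u <= fcdf (f sM).
  rewrite (le_trans u1)// /fcdf (_ : (fun s => _) = fun=> 1) ?(avg_cst s0)//.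
  by apply/funext => s; rewrite (sMP s isT : f s <= f sM).
have [m Pm mP] : extremum_spec <=%O (fun s => u <= fcdf (f s)) f [arg min_(s < sM | u <= fcdf
  (f s)) f s]%O by exact: arg_minP.
exists (f m) => x; apply/idP/idP => [ux|/fcdf_le]; last exact: le_trans.
have [s1 s1x] : exists s, f s <= x.
  apply: contrapT => nx; move: ux; rewrite leNgt => /negP; apply.
  rewrite /fcdf (_ : (fun s => _) = fun=> 0) ?(avg_cst s0)//.
  by apply/funext => s; case: (boolP (f s <= x)) => // sx; case: nx; exists s.
have [t Pt tP] : extremum_spec >=%O (fun s => f s <= x) f [arg max_(s > s1 | f s <= x) f s]%O
  by exact: arg_maxP.
apply: le_trans Pt; apply: mP; apply: le_trans ux _; apply: avg_le => s.
by apply: ind_le => sx; exact: tP.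
Qed.

End finite_quantile.

Lemma Pstar_fcdf {R : realType} {K n : nat} (f : draw K n -> R) x :
  Pstar [pred s | f s <= x] = fcdf f x.
Proof. exact: Pstar_uniform. Qed.

(** The set in the infimum is a closed half-line, so quantile and distribution function form a
    Galois connection. *)
Lemma boot_quantile_le {R : realType} {K d n : nat} (bs : draw K n -> 'cV[R]_(1 + d)) j u x :
  0 < u <= 1 ->
  (boot_quantile bs j u <= x) = (u <= Pstar [pred s | bs s j 0 <= x]).
Proof.
move=> u01; have [q qP] := fcdf_quantile (fun s => bs s j 0)
  ([ffun=> [ffun i => i]], [ffun=> [ffun i => i]]) u01.
rewrite Pstar_fcdf qP /boot_quantile; congr (_ <= _).
rewrite (_ : [set x | _] = `[q, +oo[%classic) ?inf_itv//.
by apply/seteqP; split => y /=; rewrite Pstar_fcdf qP in_itv/= andbT.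
Qed.

Section coverage.
Context {R : realType} {d1 : measure_display} {T : measurableType d1}.
Variable P : probability T R.
Local Notation E := (ev (PE P)).
Variables (Gam : nat -> finType) (V : forall n, Gam n -> R).
Local Notation H n x := (fcdf (@V n) x).
Variables (Tn : nat -> T -> R) (B : nat -> T -> R -> R) (C : nat -> T -> bool) (a b : R).
Hypothesis Gam_inh : forall n, Gam n.
Hypothesis V_sym : forall n x, H n x = fcdf (fun s : Gam n => - V s) x.
Hypothesis V_window : forall e : R, 0 < e ->
  exists2 h : R, 0 < h & \forall n \near \oo, forall x, H n (x + h) <= H n x + e.
Hypothesis Tn_meas : forall n, measurable_fun setT (Tn n).
Hypothesis Tn_cdf : forall e : R, 0 < e -> \forall n \near \oo, forall x,
  `|E (fun v => ind (Tn n v <= x)) - H n x| <= e.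
Hypothesis B_cdf : {ae P, forall v : T, forall e : R, 0 < e -> \forall n \near \oo, forall x,
  `|B n v x - H n x| <= e}.
Hypothesis B_meas : forall n h, measurable_fun setT (fun v => B n v (- Tn n v - h)).
Hypothesis C_meas : forall n, measurable [set v | C n v].
(* B n v is the bootstrap distribution function. beta_j <= q bounds it only
   strictly to the left of beta_j, hence the shift by h. *)
Hypothesis C_lower : forall n v, (0 < n)%N -> a <= B n v (- Tn n v) -> B n v (- Tn n v) < b
  -> C n v.
Hypothesis C_upper : forall n v (h : R), (0 < n)%N -> 0 < h -> C n v ->
  a <= B n v (- Tn n v) /\ B n v (- Tn n v - h) < b.
Hypothesis ab : 0 < a <= b /\ b < 1.

Let fcdf_meas n h : measurable_fun setT (fun v => H n (- Tn n v - h)).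
Proof.
rewrite /fcdf /avg; apply: measurable_funM => //; apply: measurable_sum => s.
apply: measurable_ind; apply: measurable_set_le => //.
by apply: measurable_funB => //; exact: measurableT_comp.
Qed.

(** With q the c-quantile of H, the event is T <= -q, of probability close to H(-q). By symmetry
    H(-q) = 1 - H(q-), and H(q-) is within e of c because H has only small atoms. *)
Let tail_prob (e : R) : 0 < e -> \forall n \near \oo, forall c, 0 < c <= 1 ->
  `|E (fun v => ind (c <= H n (- Tn n v))) - (1 - c)| <= 2 * e.
Proof.
move=> e0; have [h h0 hP] := V_window e0.
near=> n => c c01.
have Hh x : H n (x + h) <= H n x + e by move: x; near: n.
have Tx x : `|E (fun v => ind (Tn n v <= x)) - H n x| <= e by move: x; near: n; exact: Tn_cdf.
have [q qP] := fcdf_quantile (@V n) (Gam_inh n) c01.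
rewrite (_ : (fun v => _) = (fun v => ind (Tn n v <= - q))); last first.
  by apply/funext => v; rewrite qP lerNr.
pose m := avg (fun s : Gam n => ind (V s < q)) : R.
have Hq : H n (- q) = 1 - m.
  have e1 : avg (fun s : Gam n => - 1 * ind (V s < q) + 1) = - 1 * m + 1.
    by rewrite avg_lin (avg_cst (Gam_inh n)).
  rewrite V_sym (_ : 1 - m = - 1 * m + 1); last by rewrite mulN1r addrC.
  rewrite -e1; congr avg; apply/funext => s.
  by rewrite lerN2 leNgt /ind; case: (V s < q) => /=; rewrite ?mulr1 ?mulr0 ?addNr ?add0r.
have m1 : H n (q - h) <= m.
  by apply: avg_le => s; apply: ind_le => /le_lt_trans; apply; rewrite ltrBlDr ltrDl.
have m2 : m <= H n q by apply: avg_le => s; apply: ind_le; exact: ltW.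
have q1 : c <= H n q by rewrite qP.
have q2 : H n (q - h) < c by rewrite ltNge qP -ltNge ltrBlDr ltrDl.
have := Hh (q - h); rewrite subrK => q3.
have := Tx (- q); rewrite Hq !ler_norml; lra.
Unshelve. all: by end_near.
Qed.

Let bad n (e h : R) v : R := ind (e < `|B n v (- Tn n v - h) - H n (- Tn n v - h)|).

Let bad_dom n (e h : R) : dom (PE P) (bad n e h).
Proof.
apply: PE_ind_dom; apply: measurable_set_lt => //; apply: measurable_norm.
exact: measurable_funB.
Qed.

(** Uniformity in x allows the random point -T - h as argument; dominated convergence then turns
    almost sure convergence into small expectation. *)
Let bad_small (e h : R) : 0 < e -> \forall n \near \oo, E (bad n e h) <= e.
Proof.
move=> e0; have : E (bad n e h) @[n --> \oo] --> 0.
  rewrite -[X in _ --> X](ev0 (PE P)); apply: (@PE_dominated _ _ _ P _ _ (fun=> 1)).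
  - by move=> n; exact: PE_measurable (bad_dom n e h).
  - by [].
  - exact: dom_cst.
  - by move=> n v; rewrite ger0_norm ?ind_ge0 ?ind_le1.
  - apply: filterS B_cdf => v /(_ e e0) Bv; apply: cvg_near_cst.
    by apply: filterS Bv => n /(_ (- Tn n v - h)); rewrite /bad ltNge => ->.
by move=> /cvgr_le /(_ _ e0).
Qed.

Lemma coverage : E (fun v => ind (C n v)) @[n --> \oo] --> b - a.
Proof.
have [/andP[a0 leab] b1] := ab.
apply/cvgrPdist_le => e0 e0_gt0.
(* The bounds a/2 and (1 - b)/2 keep the levels a - e and b + 2e within (0, 1]; at most 9e
   accumulates in the end. *)
pose e := Num.min (e0 / 16) (Num.min (a / 2) ((1 - b) / 2)).
have e_gt0 : 0 < e by rewrite !lt_min !divr_gt0// subr_gt0.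
have [e1 [e2 e3]] : e <= e0 / 16 /\ e <= a / 2 /\ e <= (1 - b) / 2.
  by have := lexx e; rewrite {2}/e !le_min => /and3P[].
have [h h0 hP] := V_window e_gt0.
have ind1 : ind true = 1 :> R by [].
have ind0 : ind false = 0 :> R by [].
near=> n.
have n0 : (0 < n)%N by near: n; exists 1%N.
have Hh x : H n (x + h) <= H n x + e by move: x; near: n.
have tp c : 0 < c <= 1 -> `|E (fun v => ind (c <= H n (- Tn n v))) - (1 - c)| <= 2 * e.
  by move: c; near: n; exact: tail_prob.
have bad0 : E (bad n e 0) <= e by near: n; exact: bad_small.
have badh : E (bad n e h) <= e by near: n; exact: bad_small.
have HD c : dom (PE P) (fun v => ind (c <= H n (- Tn n v))).
  apply: PE_ind_dom; apply: measurable_set_le => //.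
  by rewrite (_ : (fun v => _) = (fun v => H n (- Tn n v - 0)))//; apply/funext => v; rewrite
    subr0.
have CD : dom (PE P) (fun v => ind (C n v)) by exact: PE_ind_dom.
(* Off the bad events, coverage gives a - e <= H(-T) and H(-T - h) < b + e; the window bound removes
   the shift h at the price of one more e. *)
have hi : E (fun v => ind (C n v)) <= E (fun v => (ind (a - e <= H n (- Tn n v)) - ind (b + 2
  * e <= H n (- Tn n v))) + (bad n e 0 v + bad n e h v)).
  apply: ev_le => // [|v]; first by apply: domD; [exact: domB|exact: domD].
  rewrite /bad subr0.
  case: (ltP e `|B n v (- Tn n v) - _|) => [_|c1].
    apply: le_trans (ind_le1 _) _; have := @ind_ge0 R (e < `|B n v (- Tn n v - h) - H n (- Tn
      n v - h)|).
    have : ind (b + 2 * e <= H n (- Tn n v)) <= ind (a - e <= H n (- Tn n v)) :> R.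
      by apply: ind_le; lra.
    rewrite ?ind1 ?ind0; lra.
  case: (ltP e `|B n v (- Tn n v - h) - _|) => [_|c2].
    apply: le_trans (ind_le1 _) _.
    have : ind (b + 2 * e <= H n (- Tn n v)) <= ind (a - e <= H n (- Tn n v)) :> R.
      by apply: ind_le; lra.
    rewrite ?ind1 ?ind0; lra.
  rewrite !ind0 addr0 addr0.
  case: (boolP (C n v)) => [Cv|_]; last first.
    by rewrite subr_ge0; apply: ind_le; lra.
  have [p1 p2] := C_upper n0 h0 Cv.
  have := Hh (- Tn n v - h); rewrite subrK => p3.
  move: c1 c2; rewrite !ler_norml => c1 c2.
  have -> : a - e <= H n (- Tn n v) by lra.
  have /negbTE -> : ~~ (b + 2 * e <= H n (- Tn n v)) by rewrite -ltNge; lra.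
  by rewrite /ind subr0.
have lo : E (fun v => (ind (a + e <= H n (- Tn n v)) - ind (b - e <= H n (- Tn n v))) - bad n
  e 0 v) <= E (fun v => ind (C n v)).
  apply: ev_le => // [|v]; first by apply: domB => //; exact: domB.
  rewrite /bad subr0.
  case: (ltP e `|B n v (- Tn n v) - _|) => [_|c1].
    have := @ind_le1 R (a + e <= H n (- Tn n v)).
    have := @ind_ge0 R (b - e <= H n (- Tn n v)).
    have := @ind_ge0 R (C n v).
    rewrite ?ind1 ?ind0; lra.
  rewrite ind0 subr0.
  move: c1; rewrite !ler_norml => c1.
  case: (leP (b - e) (H n (- Tn n v))) => p1.
    rewrite ?ind1 ?ind0; have := @ind_le1 R (a + e <= H n (- Tn n v)).
    have := @ind_ge0 R (C n v); lra.
  rewrite ind0 subr0; apply: ind_le => p2.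
  by apply: C_lower => //; lra.
move: hi lo; rewrite evD; [|exact: domB|exact: domD].
rewrite !evB// ?evD//; last exact: domB.
have t1 := tp (a - e); have t2 := tp (b + 2 * e).
have t3 := tp (a + e); have t4 := tp (b - e).
have {}t1 : `|E (fun v => ind (a - e <= H n (- Tn n v))) - (1 - (a - e))| <= 2 * e by apply:
  t1; lra.
have {}t2 : `|E (fun v => ind (b + 2 * e <= H n (- Tn n v))) - (1 - (b + 2 * e))| <= 2 * e by
  apply: t2; lra.
have {}t3 : `|E (fun v => ind (a + e <= H n (- Tn n v))) - (1 - (a + e))| <= 2 * e by apply:
  t3; lra.
have {}t4 : `|E (fun v => ind (b - e <= H n (- Tn n v))) - (1 - (b - e))| <= 2 * e by apply:
  t4; lra.
move: t1 t2 t3 t4; rewrite !ler_norml; lra.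
Unshelve. all: by end_near.
Qed.

End coverage.

(** * Conditional laws and the population model *)

Section conditional_law.
Context {R : realType} {d0 : measure_display} {Om : measurableType d0}.
Variables (P : probability Om R) (A : set Om).
Hypothesis A_meas : measurable A.
Hypothesis A_pos : (0 < P A)%E.

(** As a bundled probability it falls under [PE], so conditional means become expectations;
    [cond_law_cond_prob] links it to [cond_prob]. *)
Definition cond_law : probability Om R := mnormalize (mrestr P A_meas) P.

Let c : R := (fine (P A))^-1.

Let fine_A_gt0 : 0 < fine (P A).
Proof. by rewrite fine_gt0// A_pos/= (le_lt_trans (probability_le1 _ _)) ?ltry. Qed.

Let c_ge0 : 0 <= c. Proof. by rewrite invr_ge0 ltW. Qed.

Let cond_lawE B : cond_law B = (P (B `&` A) * c%:E)%E.
Proof.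
pose mA : {measure set Om -> \bar R} := mrestr P A_meas.
have eT : mA setT = P A by rewrite /mA /= /mrestr setTI.
rewrite -[cond_law B]/(mnormalize mA P B) /mnormalize eT.
case: ifPn => [/orP[/eqP PA0|/eqP PAoo]|_] //; first by move: A_pos; rewrite PA0 ltxx.
by have := probability_le1 P A_meas; rewrite PAoo leye_eq.
Qed.

Lemma cond_law_cond_prob B : measurable B -> cond_law B = (cond_prob P A B)%:E.
Proof.
move=> mB; rewrite cond_lawE /cond_prob EFinM fineK// fin_num_measure//.
exact: measurableI.
Qed.

Lemma ge0_integral_cond_law (g : Om -> \bar R) : measurable_fun setT g ->
  (forall w, 0 <= g w)%E ->
  (\int[cond_law]_w g w = c%:E * \int[P]_(w in A) g w)%E.
Proof.
move=> mg g0; pose k := NngNum c_ge0.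
transitivity (\int[mscale k (mrestr P A_meas)]_w g w)%E.
  apply: eq_measure_integral => B mB _; apply: etrans (cond_lawE B) _.
  by rewrite muleC.
rewrite ge0_integral_mscale//; congr (_ * _)%E.
rewrite (@ge0_negligible_integral _ _ _ _ setT (~` A))//.
- rewrite setTD setCK; apply: eq_measure_integral => B mB BA.
  by rewrite /= /mrestr (setIidl BA).
- exact: measurableC.
- by rewrite /= /mrestr setICl measure0.
Qed.

Lemma dom_cond_law (f : Om -> R) : dom (PE P) f -> dom (PE cond_law) f.
Proof.
move=> /integrableP[mf fi]; apply/integrableP; split => //.
rewrite ge0_integral_cond_law//; last exact: measurableT_comp.
rewrite lte_mul_pinfty ?lee_fin//; apply: le_lt_trans fi.
by apply: ge0_subset_integral => //; exact: measurableT_comp.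
Qed.

Lemma ev_cond_law (f : Om -> R) : dom (PE P) f -> ev (PE cond_law) f = cond_mean P A f.
Proof.
move=> Df; have mf := PE_measurable Df.
have mEf : measurable_fun setT (EFin \o f) by exact/measurable_EFinP.
have Dp : P.-integrable A (EFin \o f) by exact: integrableS Df.
rewrite /= /Rintegral /cond_mean integralE.
rewrite !ge0_integral_cond_law//; [|exact: measurable_funeneg|exact: measurable_funepos].
rewrite /Rintegral [in RHS]integralE.
have fp : (\int[P]_(x in A) (EFin \o f)^\+ x \is a fin_num)%E.
  by apply: integrable_pos_fin_num.
have fn : (\int[P]_(x in A) (EFin \o f)^\- x \is a fin_num)%E.
  by apply: integrable_neg_fin_num.
by rewrite -(fineK fp) -(fineK fn) -!EFinM -!EFinB /= -mulrBr mulrC.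
Qed.

Lemma cond_varE (f : Om -> R) : measurable_fun setT f -> dom (PE P) (fun w => f w ^+ 2) ->
  cond_var P A f = ev (PE cond_law) (fun w => f w ^+ 2) - ev (PE cond_law) f ^+ 2.
Proof.
move=> mf D2; have D1 := PE_L2_L1 mf D2.
rewrite /cond_var -(ev_cond_law D1); set m := ev (PE cond_law) f.
have e1 w : (f w - m) ^+ 2 = f w ^+ 2 + (- 2 * m * f w + m ^+ 2) by ring.
have D' : dom (PE P) (fun w => - 2 * m * f w + m ^+ 2).
  by apply: domD; [exact: domZ|exact: dom_cst].
rewrite -ev_cond_law; last by apply: (eq_dom (fun w => esym (e1 w))); exact: domD.
rewrite (eq_ev _ e1) evD; [|exact: dom_cond_law|exact: dom_cond_law].
rewrite [X in _ + X](evD (domZ _ (dom_cond_law D1)) (dom_cst _ _)).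
rewrite (evZ _ (dom_cond_law D1)) ev_cst -/m; ring.
Qed.

Lemma cond_var_ge0 (f : Om -> R) : 0 <= cond_var P A f.
Proof.
rewrite /cond_var /cond_mean divr_ge0 ?(ltW fine_A_gt0)//.
by apply: Rintegral_ge0 => w _; exact: sqr_ge0.
Qed.

Section sample_of_cond_law.
Context {d1 d2 : measure_display} {T : measurableType d1} {V : measurableType d2}.
Variables (Q : probability T R) (Z : T -> V) (X : Om -> V).
Hypothesis Z_meas : measurable_fun setT Z.
Hypothesis X_meas : measurable_fun setT X.
Hypothesis Z_law : forall B, measurable B ->
  Q (Z @^-1` B) = (cond_prob P A (X @^-1` B))%:E.

Lemma sample_ev (f : V -> R) : measurable_fun setT f -> dom (PE P) (f \o X) ->
  dom (PE Q) (f \o Z) /\ ev (PE Q) (f \o Z) = ev (PE cond_law) (f \o X).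
Proof.
move=> mf Df; apply: same_law => // [B mB|]; last exact: dom_cond_law.
rewrite Z_law// cond_law_cond_prob//.
by rewrite -[X in measurable X]setTI; exact: X_meas.
Qed.

End sample_of_cond_law.

(* The conditional law given an event independent of eps leaves the law of eps unchanged. *)
Lemma cond_mean_indep (eps : Om -> R) : dom (PE P) eps ->
  (forall B, measurable B -> P (eps @^-1` B `&` A) = (P (eps @^-1` B) * P A)%E) ->
  ev (PE cond_law) eps = ev (PE P) eps.
Proof.
move=> D epsA; have me := PE_measurable D.
apply: (@same_law _ _ _ _ _ _ _ cond_law P eps eps id _ _ _ _ D).2 => // B mB.
have meB : measurable (eps @^-1` B) by rewrite -[X in measurable X]setTI; exact: me.
rewrite cond_lawE epsA// -muleA -[X in (_ * (X * _))%E]fineK ?fin_num_measure//.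
by rewrite -EFinM divff ?mule1// gt_eqF.
Qed.

End conditional_law.

Lemma radcdf_pred1 {R : realType} {Gam D : finType} (A : D -> Gam -> R) sig n j t :
  radcdf (pred1 j) A sig n t = fcdf (fun r => lin A (@rad R Gam sig n r) j) (t j).
Proof.
congr avg; apply/funext => r; congr (ind _); apply/idP/idP.
  by move=> /belowP /(_ j); apply; rewrite /= eqxx.
by move=> H; apply/belowP => j' /= /eqP ->.
Qed.

(** Flipping all signs is a bijection that negates every linear form of [rad]. *)
Lemma lin_rad_sym {R : realType} {Gam D : finType} (A : D -> Gam -> R) sig n j x :
  fcdf (fun r => lin A (@rad R Gam sig n r) j) x =
  fcdf (fun r => - lin A (@rad R Gam sig n r) j) x.
Proof.
pose neg (r : {ffun Gam * 'I_n -> bool}) := [ffun o => ~~ r o].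
have negK : involutive neg by move=> r; apply/ffunP => o; rewrite !ffunE negbK.
rewrite [RHS](@avg_bij _ _ _ neg _ (inv_bij negK)).
congr avg; apply/funext => r; congr (ind (_ <= x)).
rewrite /= /lin -sumrN; apply: eq_bigr => g _; rewrite -mulrN; congr (_ * _).
rewrite /rad /radsum !fct_sumE -sumrN; apply: eq_bigr => o _.
rewrite ffunE /signed /pt; case: eqP => _; last by rewrite oppr0.
by case: (r o); rewrite /= ?opprK.
Qed.

Section conclusions.
Context {R : realType} {K d : nat} {d1 : measure_display} {T : measurableType d1}.
Variables (P : probability T R) (beta : 'cV[R]_(1 + d)).
Variables (bM : nat -> T -> 'cV[R]_(1 + d)) (bS : forall n, T -> draw K n -> 'cV[R]_(1 + d)).
Arguments bS : clear implicits.
Hypothesis bM_meas : forall n j, measurable_fun setT (fun v => bM n v j 0).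
Hypothesis bS_meas : forall n s j, measurable_fun setT (fun v => bS n v s j 0).
Local Notation E := (ev (PE P)).

Lemma measurable_scaled_error n j :
  measurable_fun setT (fun v => (Num.sqrt n%:R *: (bM n v - beta)) j 0).
Proof.
rewrite (_ : (fun v => _) = (fun v => Num.sqrt n%:R * (bM n v j 0 - beta j 0))).
  by apply: measurable_funM => //; exact: measurable_funB.
by apply/funext => v; rewrite mxE mxBE.
Qed.

Lemma kolmogorov_consistency (H : nat -> ('I_(1 + d) -> R) -> R) :
  (forall e : R, 0 < e -> \forall n \near \oo, forall t,
    `|E (fun v => ind (below predT (fun j => (Num.sqrt n%:R *: (bM n v - beta)) j 0) t)) -
      H n t| <= e) ->
  {ae P, forall v : T, forall e : R, 0 < e -> \forall n \near \oo, forall t,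
    `|Pstar [pred s | below predT (fun j => (Num.sqrt n%:R *: (bS n v s - bM n v)) j 0) t] -
      H n t| <= e} ->
  {ae P, forall v : T,
    sup (range (fun t : 'cV[R]_(1 + d) =>
      `| boot_cdf (bS n v) (bM n v) t -
         fine (P [set v' | vec_le (Num.sqrt n%:R *: (bM n v' - beta)) t])
      |)) @[n --> \oo] --> (0 : R)}.
Proof.
move=> real_close; apply: filterS => v boot_close.
apply/cvgrPdist_le => e e0; have e2 : 0 < e / 2 by rewrite divr_gt0.
near=> n.
have real_n t : `|E (fun v => ind (below predT (fun j => (Num.sqrt n%:R *: (bM n v - beta)) j
  0) t)) -
      H n t| <= e / 2 by move: t; near: n; exact: real_close.
have boot_n t : `|Pstar [pred s | below predT (fun j => (Num.sqrt n%:R *: (bS n v s - bM n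
  v)) j 0) t] -
      H n t| <= e / 2 by move: t; near: n; exact: boot_close.
set F := fun t : 'cV[R]_(1 + d) => _.
have Fe t : F t <= e.
  rewrite /F -(PE_ind P (b := fun v' => vec_le (Num.sqrt n%:R *: (bM n v' - beta)) t)); last
    first.
    exact: (@measurable_below _ _ _ _ predT _ (fun j => t j 0) (measurable_scaled_error n)).
  have h1 := real_n (fun j => t j 0); have h2 := boot_n (fun j => t j 0).
  rewrite (splitr e); apply: le_trans (lerD h2 h1).
  by rewrite [X in _ <= _ + X]distrC; apply: ler_distD.
have ub : ubound (range F) e by move=> _ [t _ <-].
rewrite sub0r normrN ger0_norm; first by apply: ge_sup ub; exists (F 0), 0.
apply: le_trans (_ : 0 <= F 0) _; first exact: normr_ge0.
by apply: ub_le_sup; [exists e|exists 0].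
Unshelve. all: by end_near.
Qed.

Variables (A : 'I_(1 + d) -> group (K := K) -> R) (sig : group (K := K) -> R) (c0 : R) (j :
  'I_(1 + d)).
Hypothesis c0_gt0 : 0 < c0.
Hypothesis c0P : exists g, c0 <= `|A j g * sig g|.

Let Tn n v := (Num.sqrt n%:R *: (bM n v - beta)) j 0.
Let B n v (x : R) : R := Pstar [pred s | (Num.sqrt n%:R *: (bS n v s - bM n v)) j 0 <= x].
Let V n r := lin A (@rad R _ sig n r) j.

Let TnE n v : Tn n v = Num.sqrt n%:R * (bM n v j 0 - beta j 0).
Proof. by rewrite /Tn mxE mxBE. Qed.

(** [bM] cancels: at -T - x, the function B is the distribution function of the bootstrap estimate
    itself at beta_j - x / sqrt n. Comparing beta_j with a percentile amounts to comparing B with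
    its level. *)
Let BE n v x : (0 < n)%N ->
  B n v (- Tn n v - x) = Pstar [pred s | bS n v s j 0 <= beta j 0 - x / Num.sqrt n%:R].
Proof.
move=> n0; have s0 : 0 < Num.sqrt n%:R :> R by rewrite sqrtr_gt0 ltr0n.
rewrite /B; congr Pstar; apply/funext => s /=; rewrite TnE mxE mxBE.
have sx : Num.sqrt n%:R * (x / Num.sqrt n%:R) = x by rewrite mulrC divfK// gt_eqF.
rewrite -[RHS](ler_pM2l s0) [in RHS]mulrBr sx.
by apply/idP/idP; lra.
Qed.

Let Pstar_meas (n : nat) (f : T -> draw K n -> R) (g : T -> R) :
  (forall s, measurable_fun setT (fun v => f v s)) -> measurable_fun setT g ->
  measurable_fun setT (fun v => Pstar [pred s | f v s <= g v] : R).
Proof.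
move=> mf mg; rewrite (_ : (fun v => _) = (fun v => fcdf (f v) (g v))).
  rewrite /fcdf /avg; apply: measurable_funM => //; apply: measurable_sum => s.
  by apply: measurable_ind; exact: measurable_set_le.
by apply/funext => v; rewrite Pstar_fcdf.
Qed.

Lemma measurable_percentile n (u : R) : 0 < u <= 1 ->
  measurable [set v | boot_quantile (bS n v) j u <= beta j 0] /\
  measurable [set v | beta j 0 <= boot_quantile (bS n v) j u].
Proof.
move=> u01; have mq x : measurable [set v | boot_quantile (bS n v) j u <= x].
  rewrite (_ : [set v | _] = [set v | u <= Pstar [pred s | bS n v s j 0 <= x]]).
    by apply: measurable_set_le => //; exact: (Pstar_meas (g := fun=> x)).
  by apply/seteqP; split => v /=; rewrite boot_quantile_le.
split => //.
(* Galois connection handles events quantile <= x, so the strict inequality quantile < beta_j is a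
   countable union of them. *)
rewrite (_ : [set v | _] = ~` \bigcup_m [set v | boot_quantile (bS n v) j u <= beta j 0 -
  m.+1%:R^-1]).
  by apply: measurableC; apply: bigcup_measurable.
apply/seteqP; split => v /=.
  move=> bq [m _ /= qb]; have := le_trans bq qb.
  by rewrite leNgt ltrBlDr ltrDl invr_gt0 ltr0n.
move=> nq; rewrite leNgt; apply/negP => qb; apply: nq.
have qb0 : 0 < beta j 0 - boot_quantile (bS n v) j u by rewrite subr_gt0.
exists (Num.truncn (beta j 0 - boot_quantile (bS n v) j u)^-1) => //=.
rewrite lerBrDr -lerBrDl -[leRHS]invrK lef_pV2 ?posrE ?invr_gt0 ?ltr0n//.
exact: ltW (truncnS_gt _).
Qed.

Lemma percentile_coverage (alpha : R) : 0 < alpha < 1 ->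
  (forall e : R, 0 < e -> \forall n \near \oo, forall t,
    `|E (fun v => ind (below (pred1 j) (fun j => (Num.sqrt n%:R *: (bM n v - beta)) j 0) t)) -
      radcdf (pred1 j) A sig n t| <= e) ->
  {ae P, forall v : T, forall e : R, 0 < e -> \forall n \near \oo, forall t,
    `|Pstar [pred s | below (pred1 j) (fun j => (Num.sqrt n%:R *: (bS n v s - bM n v)) j 0) t] -
      radcdf (pred1 j) A sig n t| <= e} ->
  P [set v | boot_quantile (bS n v) j (alpha / 2) <= beta j 0 <=
             boot_quantile (bS n v) j (1 - alpha / 2)]
     @[n --> \oo] --> (1 - alpha)%:E.
Proof.
move=> /andP[a0 a1] real_close boot_close.
have u1 : 0 < alpha / 2 <= 1 by lra.
have u2 : 0 < 1 - alpha / 2 <= 1 by lra.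
have below1 (x t : 'I_(1 + d) -> R) : below (pred1 j) x t = (x j <= t j).
  apply/idP/idP; first by move=> /belowP /(_ j); apply; rewrite /= eqxx.
  by move=> H; apply/belowP => j' /= /eqP ->.
pose C n v := boot_quantile (bS n v) j (alpha / 2) <= beta j 0 <=
             boot_quantile (bS n v) j (1 - alpha / 2).
have mC n : measurable [set v | C n v].
  have [m1 _] := measurable_percentile n u1; have [_ m2] := measurable_percentile n u2.
  rewrite (_ : [set v | _] = [set v | boot_quantile (bS n v) j (alpha / 2) <= beta j 0] `&`
     [set v | beta j 0 <= boot_quantile (bS n v) j (1 - alpha / 2)]); first exact: measurableI.
  by apply/seteqP; split => v /=; rewrite /C => /andP.
have cov : E (fun v => ind (C n v)) @[n --> \oo] --> (1 - alpha / 2) - alpha / 2.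
  apply: (@coverage R d1 T P (fun n => {ffun group (K := K) * 'I_n -> bool}) V Tn B).
  - by move=> n; exact: [ffun=> true].
  - by move=> n x; exact: lin_rad_sym.
  - move=> e e0; pose D : R := #|'I_(1 + d)|%:R.
    have D0 : 0 < D by rewrite /D card_ord ltr0n.
    (* In [window] this h contributes e/2, and for large n the term in 1 / sqrt n at most e/2. *)
    exists (e / 2 / D * c0); first by rewrite mulr_gt0// !divr_gt0.
    have eD : 0 < e / 2 / D by rewrite !divr_gt0.
    have /cvgrPdist_le /(_ _ eD) cs := @cvg_inv_sqrt R.
    near=> n => x; have n0 : (0 < n)%N by near: n; exists 1%N.
    have sn : `|0 - (Num.sqrt (n%:R : R))^-1| <= e / 2 / D by near: n.
    have wP j' : pred1 j j' -> exists g, c0 <= `|A j' g * sig g| by move=> /eqP ->.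
    have := @radcdf_window R _ _ (pred1 j) A sig n c0 c0_gt0 wP n0 (fun=> x)
      (fun=> x + e / 2 / D * c0) (e / 2 / D * c0) _ (fun=> lexx _).
    rewrite !radcdf_pred1 => /(_ _) h; apply: le_trans (h _) _.
      by rewrite mulr_ge0 ?(ltW c0_gt0)// ltW.
    rewrite lerD2l /window -/D mulfK ?gt_eqF//.
    move: sn; rewrite sub0r normrN ger0_norm ?invr_ge0 ?sqrtr_ge0// => sn.
    rewrite [leRHS](_ : e = D * (e / 2 / D + e / 2 / D)); last by field; rewrite gt_eqF.
    by rewrite ler_pM2l// lerD2l.
  - by move=> n; exact: measurable_scaled_error.
  - move=> e e0; apply: filterS (real_close e e0) => n H x.
    by have := H (fun=> x); rewrite radcdf_pred1; under eq_fun do rewrite below1.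
  - apply: filterS boot_close => v H e e0; apply: filterS (H e e0) => n {}H x.
    have := H (fun=> x); rewrite radcdf_pred1 /B.
    rewrite (_ : Pstar _ = Pstar [pred s | (Num.sqrt n%:R *: (bS n v s - bM n v)) j 0 <= x]
      :> R)//.
    by congr Pstar; apply/funext => s /=; rewrite below1.
  - move=> n h; apply: Pstar_meas => [s|].
      rewrite (_ : (fun v => _) = (fun v => Num.sqrt n%:R * (bS n v s j 0 - bM n v j 0))).
        by apply: measurable_funM => //; exact: measurable_funB.
      by apply/funext => v; rewrite mxE mxBE.
    by apply: measurable_funB => //; apply: measurableT_comp => //; exact:
      measurable_scaled_error.
  - exact: mC.
  - move=> n v n0; rewrite -[- Tn n v]subr0 BE// mul0r subr0 => h1 h2.
    rewrite /C boot_quantile_le// h1 /=; apply: ltW; rewrite ltNge boot_quantile_le//.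
    by rewrite -ltNge.
  - move=> n v h n0 h0 /andP[q1 q2].
    rewrite -{1}[- Tn n v]subr0 !BE// mul0r subr0.
    split; first by rewrite -boot_quantile_le.
    rewrite ltNge -boot_quantile_le// -ltNge; apply: lt_le_trans q2.
    by rewrite ltrBlDr ltrDl divr_gt0// sqrtr_gt0 ltr0n.
  - by split; lra.
have PE_C n : P [set v | C n v] = (E (fun v => ind (C n v)))%:E.
  by rewrite PE_ind// fineK// fin_num_measure.
rewrite (_ : (fun n => P _) = (fun n => (E (fun v => ind (C n v)))%:E)); last first.
  by apply/funext => n; exact: PE_C.
apply: cvg_EFin; first exact: nearW.
rewrite (_ : 1 - alpha = (1 - alpha / 2) - alpha / 2); last by field.
exact: cov.
Unshelve. all: by end_near.
Qed.

End conclusions.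

Section population.
Context {R : realType} {K d : nat} {d0 : measure_display} {Om : measurableType d0}.
Variables (P0 : probability Om R) (Y eps : {RV P0 >-> R}) (X : {RV P0 >-> d.-tuple R})
  (G : Om -> 'I_K) (beta : 'cV[R]_(1 + d)) (sigma : R).
Hypothesis G_meas : forall k, measurable (G @^-1` [set k]).
Hypothesis G_pos : forall k, (0 < P0 (G @^-1` [set k]))%E.
Hypothesis model : {ae P0, forall v,
  Y v = beta (lshift d 0) 0 + linear_part beta (X v) + eps v}.
Hypothesis eps_indep : independent_systems P0 (g_sigma_algebra_preimage eps)
  (pair_events X G).
Hypothesis eps_mean : ('E_P0[eps] = 0)%E.
Hypothesis eps_var : ('V_P0[eps] = ((sigma ^+ 2)%R)%:E)%E.
Hypothesis Y_L2 : (\int[P0]_v ((Y v) ^+ 2)%:E < +oo)%E.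
Hypothesis X_L2 : (\int[P0]_v (\sum_(j < d) (tnth (X v) j) ^+ 2)%:E < +oo)%E.

Let m := pop_mean_X P0 X G.
Let Pk k := cond_law P0 (G_meas k).

Let dom_ge0 (f : Om -> R) : measurable_fun setT f -> (forall v, 0 <= f v) ->
  (\int[P0]_v (f v)%:E < +oo)%E -> dom (PE P0) f.
Proof.
move=> mf f0 fi; apply/integrableP; split; first exact/measurable_EFinP.
by under eq_integral do rewrite /= ger0_norm//.
Qed.

Let X_coord_meas j : measurable_fun setT (fun v => tnth (X v) j).
Proof. exact: measurableT_comp (@measurable_tnth _ _ _ j) _. Qed.

Lemma dom_Y_sqr : dom (PE P0) (fun v => Y v ^+ 2).
Proof. by apply: dom_ge0 => // [|v]; [exact: measurable_funX|exact: sqr_ge0]. Qed.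

Lemma dom_X_sqr j : dom (PE P0) (fun v => tnth (X v) j ^+ 2).
Proof.
have D : dom (PE P0) (fun v => \sum_(j < d) (tnth (X v) j) ^+ 2).
  apply: dom_ge0 => //; first by apply: measurable_sum => i; exact: measurable_funX.
  by move=> v; apply: sumr_ge0 => *; exact: sqr_ge0.
apply: (PE_le _ D) => [|v]; first exact: measurable_funX.
rewrite !ger0_norm ?sqr_ge0//.
  by rewrite (bigD1 j)//= lerDl; apply: sumr_ge0 => *; exact: sqr_ge0.
by apply: sumr_ge0 => *; exact: sqr_ge0.
Qed.

Lemma dom_linear_part_sqr : dom (PE P0) (fun v => linear_part beta (X v) ^+ 2).
Proof.
apply: (@PE_L2_sum _ _ _ P0 _ _ (fun l v => beta (rshift 1 l) 0 * tnth (X v) l)) => l.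
  exact: measurable_funM.
by apply: eq_dom (domZ (beta (rshift 1 l) 0 ^+ 2) (dom_X_sqr l)) => v; rewrite exprMn.
Qed.

Lemma dom_eps : dom (PE P0) eps.
Proof.
apply: PE_L2_L1 => //; apply: dom_ge0 => [|v|]; [exact: measurable_funX|exact: sqr_ge0|].
move: eps_var; rewrite /variance covariance.unlock eps_mean /= expectation.unlock.
rewrite (_ : (\int[P0]_w _)%E = (\int[P0]_v (eps v ^+ 2)%:E)%E); first by move=> ->; rewrite
  ltry.
by apply: eq_integral => v _; transitivity (((eps v - 0) * (eps v - 0))%:E) => //; rewrite
  subr0 expr2.
Qed.

Lemma cond_mean_eps k : ev (PE (Pk k)) eps = 0.
Proof.
rewrite /Pk (cond_mean_indep _ (G_pos k) dom_eps).
  by move: eps_mean; rewrite expectation.unlock /= /Rintegral => ->.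
move=> B mB; apply: eps_indep; first by exists B => //; rewrite setTI.
(* The event G = k belongs to [pair_events]: its section is everything at k and empty elsewhere. *)
exists (fun k' => if k' == k then setT else set0); first by move=> k'; case: eqP.
by apply/seteqP; split => v /=; [move=> ->; rewrite eqxx|case: eqP].
Qed.

Lemma pop_mean_XE k l : ev (PE (Pk k)) (fun v => tnth (X v) l) = m k l.
Proof.
rewrite ev_cond_law ?mxE//; apply: PE_L2_L1 => //; exact: dom_X_sqr.
Qed.

Lemma cond_mean_Y k : ev (PE (Pk k)) Y = (design m *m beta) k 0.
Proof.
have DY : dom (PE P0) Y by apply: PE_L2_L1 => //; exact: dom_Y_sqr.
have DX l : dom (PE P0) (fun v => tnth (X v) l) by apply: PE_L2_L1 => //; exact: dom_X_sqr.
have DL : dom (PE P0) (fun v => linear_part beta (X v)).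
  by apply: dom_sum => l; exact: domZ.
have DM : dom (PE P0) (fun v => beta (lshift d 0) 0 + linear_part beta (X v) + eps v).
  by apply: domD; [apply: domD => //; exact: dom_cst|exact: dom_eps].
have cl f : dom (PE P0) f -> dom (PE (Pk k)) f by exact: dom_cond_law.
transitivity (ev (PE (Pk k)) (fun v => beta (lshift d 0) 0 + linear_part beta (X v) + eps v)).
  rewrite !ev_cond_law//; congr (fine _ / _); apply: ae_eq_integral => //.
  - by apply/measurable_EFinP; exact: measurable_funTS.
  - by apply/measurable_EFinP; apply: measurable_funTS; exact: PE_measurable DM.
  - by apply: filterS model => v /= -> _.
rewrite evD; [|by apply: domD; [exact: dom_cst|exact: cl]|exact: cl dom_eps].
rewrite cond_mean_eps addr0 evD; [|exact: dom_cst|exact: cl].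
rewrite ev_cst ev_sum => [|l]; last by apply: domZ; exact: cl.
rewrite [RHS]mxE big_split_ord/= big_ord1 /design row_mxEl mxE mul1r; congr (_ + _).
apply: eq_bigr => l _; apply: etrans (evZ _ (cl _ (DX l))) _.
by rewrite pop_mean_XE row_mxEr mulrC.
Qed.

End population.

Theorem proposition6p1 (R : realType) (K d : nat)
  (d0 : measure_display) (Omega0 : measurableType d0)
  (P0 : probability Omega0 R)
  (Y eps : {RV P0 >-> R}) (X : {RV P0 >-> d.-tuple R}) (G : Omega0 -> 'I_K)
  (beta : 'cV[R]_(1 + d)) (sigma : R)
  (G_meas : forall k, measurable (G @^-1` [set k]))
  (G_pos : forall k, (0 < P0 (G @^-1` [set k]))%E)
  (model : {ae P0, forall v,
     Y v = beta (lshift d 0) 0 + linear_part beta (X v) + eps v})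
  (eps_indep : independent_systems P0 (g_sigma_algebra_preimage eps)
     (pair_events X G))
  (eps_mean : ('E_P0[eps] = 0)%E)
  (eps_var : ('V_P0[eps] = ((sigma ^+ 2)%R)%:E)%E)
  (d1 : measure_display) (Omega : measurableType d1) (P : probability Omega R)
  (Ys : 'I_K -> nat -> {RV P >-> R})
  (Xs : 'I_K -> nat -> {RV P >-> d.-tuple R})
  (Ys_law : forall k i (B : set R), measurable B ->
     P (Ys k i @^-1` B) = (cond_prob P0 (G @^-1` [set k]) (Y @^-1` B))%:E)
  (Xs_law : forall k i (B : set (d.-tuple R)), measurable B ->
     P (Xs k i @^-1` B) = (cond_prob P0 (G @^-1` [set k]) (X @^-1` B))%:E)
  (data_indep : mutually_independent P (data_events Ys Xs))
  (w : 'rV[R]_K) (w_pos : forall k, 0 < w 0 k) (w_sum : \sum_k w 0 k = 1)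
  (betaM : nat -> Omega -> 'cV[R]_(1 + d))
  (betaM_meas : forall n j, measurable_fun setT (fun v => betaM n v j 0))
  (betaM_def : forall n v,
     moment_estimate w (fun k (i : 'I_n) => Ys k i v)
       (fun k (i : 'I_n) => Xs k i v) (betaM n v))
  (betaS : forall n, Omega -> draw K n -> 'cV[R]_(1 + d))
  (betaS_meas : forall n s j, measurable_fun setT (fun v => betaS n v s j 0))
  (betaS_def : forall n v (s : draw K n),
     moment_estimate w (fun k i => Ys k (s.1 k i) v)
       (fun k i => Xs k (s.2 k i) v) (betaS n v s))
  (Y_L2 : (\int[P0]_v ((Y v) ^+ 2)%:E < +oo)%E)
  (X_L2 : (\int[P0]_v (\sum_(j < d) (tnth (X v) j) ^+ 2)%:E < +oo)%E)
  (full_rank : \rank (design (pop_mean_X P0 X G)) = (1 + d)%N)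
  (nondegenerate : forall j,
     0 < asymptotic_variance P0 Y X G w (design (pop_mean_X P0 X G)) beta j) :
  {ae P, forall v,
     sup (range (fun t : 'cV[R]_(1 + d) =>
       `| boot_cdf (betaS n v) (betaM n v) t -
          fine (P [set v' | vec_le (Num.sqrt n%:R *: (betaM n v' - beta)) t])
       |)) @[n --> \oo] --> (0 : R)}
  /\
  (forall (alpha : R) (j : 'I_(1 + d)), 0 < alpha < 1 ->
     P [set v | boot_quantile (betaS n v) j (alpha / 2) <= beta j 0 <=
                boot_quantile (betaS n v) j (1 - alpha / 2)]
       @[n --> \oo] --> (1 - alpha)%:E).

Proof.
set m := pop_mean_X P0 X G; pose Pk k := cond_law P0 (G_meas k).
have mlp := measurable_linear_part beta.
have msqr : measurable_fun setT (fun z : R => z ^+ 2) by exact: measurable_funX.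
have mtn l : measurable_fun setT (fun x : d.-tuple R => tnth x l) by exact: measurable_tnth.
have mtn2 l : measurable_fun setT (fun x : d.-tuple R => tnth x l ^+ 2) by exact:
  measurable_funX.
have mlp2 : measurable_fun setT (fun x : d.-tuple R => linear_part beta x ^+ 2) by exact:
  measurable_funX.
have mYs k i : measurable_fun setT (Ys k i) by [].
have mXs k i : measurable_fun setT (Xs k i) by [].
have mX : measurable_fun setT X by [].
have mY : measurable_fun setT Y by [].
have DY2 := dom_Y_sqr Y_L2; have DX2 := dom_X_sqr X_L2.
have DL2 := dom_linear_part_sqr beta X_L2.
have DY : dom (PE P0) Y by exact: PE_L2_L1.
have DX l : dom (PE P0) (fun v => tnth (X v) l).
  by apply: PE_L2_L1 => //; exact: measurableT_comp (mtn l) mX.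
have DL : dom (PE P0) (fun v => linear_part beta (X v)).
  by apply: PE_L2_L1 => //; exact: measurableT_comp mlp mX.
have evY k f := sample_ev (G_meas k) (G_pos k) (mYs k 0%N) mY (Ys_law k 0%N) (f := f).
have evX k f := sample_ev (G_meas k) (G_pos k) (mXs k 0%N) mX (Xs_law k 0%N) (f := f).
have YsE k i B : measurable B -> P (Ys k i @^-1` B) = P (Ys k 0%N @^-1` B).
  by move=> mB; rewrite !Ys_law.
have XsE k i B : measurable B -> P (Xs k i @^-1` B) = P (Xs k 0%N @^-1` B).
  by move=> mB; rewrite !Xs_law.
have DYs k : dom (PE P) (fun v => Ys k 0%N v ^+ 2) by have [] := evY k _ msqr DY2.
have DXs k l : dom (PE P) (fun v => tnth (Xs k 0%N v) l ^+ 2) by have [] := evX k _ (mtn2 l)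
  (DX2 l).
have EYs k : ev (PE P) (Ys k 0%N) = (design m *m beta) k 0.
  have [_ e1] := evY k id (@measurable_id _ _ _) DY.
  exact: etrans e1 (cond_mean_Y G_meas G_pos model eps_indep eps_mean eps_var Y_L2 X_L2 k).
have EXs k l : ev (PE P) (fun v => tnth (Xs k 0%N v) l) = m k l.
  have [_ e1] := evX k _ (mtn l) (DX l).
  exact: etrans e1 (pop_mean_XE G_meas G_pos X_L2 k l).
pose s2 (g : group (K := K)) := match g with
  | inl k => cond_var P0 (G @^-1` [set k]) Y
  | inr k => cond_var P0 (G @^-1` [set k]) (fun v => linear_part beta (X v)) end.
have s2_ge0 g : 0 <= s2 g by case: g => k; exact: (cond_var_ge0 (G_meas k) (G_pos k)).
pose sig g := Num.sqrt (s2 g).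
have sigE g : sig g ^+ 2 = ev (PE P) (fun v => sample_score beta (fun k i => Ys k i) (fun k i
  => Xs k i) g 0%N v ^+ 2) -
    ev (PE P) (sample_score beta (fun k i => Ys k i) (fun k i => Xs k i) g 0%N) ^+ 2.
  rewrite sqr_sqrtr//; case: g => k.
    rewrite /s2 (cond_varE (G_meas k) (G_pos k) mY DY2).
    have [_ e1] := evY k id (@measurable_id _ _ _) DY.
    have [_ e2] := evY k _ msqr DY2.
    by congr (_ - _ ^+ 2); [exact: esym e2|exact: esym e1].
  rewrite /s2 (cond_varE (G_meas k) (G_pos k) (measurableT_comp mlp mX) DL2).
  have [_ e1] := evX k _ mlp DL.
  have [_ e2] := evX k _ mlp2 DL2.
  by congr (_ - _ ^+ 2); [exact: esym e2|exact: esym e1].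
(* Up to sign, the two parts of the k-th summand of [asymptotic_variance] are squares of
   [influence * sig] at [inl k] and [inr k]; were they all 0, the variance would vanish. *)
have nz j : exists g, influence w m j g * sig g != 0.
  apply: contrapT => H; have := nondegenerate j.
  rewrite /asymptotic_variance big1 ?ltxx// => k _.
  have z g : influence w m j g ^+ 2 * s2 g = 0.
    have /negP/negPn/eqP e1 : ~ (influence w m j g * sig g != 0) by move=> ?; apply: H;
      exists g.
    by rewrite -(sqr_sqrtr (s2_ge0 g)) -exprMn -/(sig g) e1 expr0n.
  by rewrite mulrDr (z (inl k)) -(sqrrN (wls _ _ _ _)) (z (inr k)) addr0.
have [g gP] := choice nz.
(* 1 / c0 exceeds the inverse of each selected product, so c0 is a positive lower bound common to
   all j. *)
pose c0 : R := (1 + \sum_j `|influence w m j (g j) * sig (g j)|^-1)^-1.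
have s_ge0 : 0 <= \sum_j `|influence w m j (g j) * sig (g j)|^-1.
  by apply: sumr_ge0 => j _; rewrite invr_ge0.
have c0_gt0 : 0 < c0 by rewrite invr_gt0 ltr_wpDr.
have c0P j : exists g', c0 <= `|influence w m j g' * sig g'|.
  exists (g j); rewrite -[leRHS]invrK lef_pV2 ?posrE ?invr_gt0 ?normr_gt0 ?ltr_wpDr//.
  rewrite (bigD1 j)//= addrCA lerDl addr_ge0//.
  by apply: sumr_ge0 => *; rewrite invr_ge0.
(* J is left free: [predT] serves the joint statement, [pred1 j] the percentile interval. *)
have close (J : pred 'I_(1 + d)) (e : R) (e0 : 0 < e) := moment_estimate_close mYs mXs YsE
  XsE data_indep DYs DXs EYs EXs
  sigE w_pos full_rank c0_gt0 (fun j (_ : J j) => c0P j) betaM_meas betaM_def e0.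
have bclose (J : pred 'I_(1 + d)) := bootstrap_close_ae mYs mXs YsE XsE data_indep DYs DXs
  EYs EXs
  sigE w_pos full_rank c0_gt0 (fun j (_ : J j) => c0P j) betaM_def betaS_def.
split.
  exact: (kolmogorov_consistency betaM_meas (close predT) (bclose predT)).
move=> alpha j a01.
exact: (percentile_coverage betaM_meas betaS_meas c0_gt0 (c0P j) a01 (close (pred1 j))
  (bclose (pred1 j))).
Qed.
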